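(* Let $d\ge 1$ and $\alpha\in(-1,\infty)^d$. Each of the following kernels, defined for $x,y\in\mathbb{R}_+^d$, $x\ne y$, and taking values in the indicated Banach space $\mathbb{B}$, satisfies the standard estimates (growth estimate and both smoothness estimates) in the sense of the space of homogeneous type $(\mathbb{R}_+^d,d\mu_\alpha,|\cdot|)$: (1) $\mathcal{G}^{\alpha}(x,y)=\{G_t^\alpha(x,y)\}_{t>0}$, with $\mathbb{B}=L^\infty((0,\infty),dt)$; (2) $R_n^\alpha(x,y)=\frac{1}{\Gamma(|n|/2)}\int_0^\infty \delta_x^n G_t^\alpha(x,y)\,t^{|n|/2-1}\,dt$, with $\mathbb{B}=\mathbb{C}$, where $n\in\mathbb{N}^d$ satisfies $|n|>0$; (3) $\mathcal{H}^\alpha_{n,m}(x,y)=\{\partial_t^m\delta_x^nG_t^\alpha(x,y)\}_{t>0}$, with $\mathbb{B}=L^2((0,\infty),t^{|n|+2m-1}dt)$, where $n\in\mathbb{N}^d$ and $m\in\mathbb{N}$ satisfy $|n|+m>0$; (4) $K_\psi^\alpha(x,y)=-\int_0^\infty\psi(t)\,\partial_tG_t^\alpha(x,y)\,dt$, with $\mathbb{B}=\mathbb{C}$, where $\psi\in L^\infty((0,\infty),dt)$; (5) $K_\nu^\alpha(x,y)=\int_0^\infty G_t^\alpha(x,y)\,d\nu(t)$, with $\mathbb{B}=\mathbb{C}$, where $\nu$ is a signed or complex Borel measure on $(0,\infty)$ whose total variation $|\nu|$ satisfies $\int_0^\infty e^{-t(2d+2|\alpha|)}\,d|\nu|(t)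<\infty$.
   Context: Notation: $\mathbb{R}_+^d=(0,\infty)^d$, $\mathbb{N}=\{0,1,2,\ldots\}$, $|\alpha|=\alpha_1+\ldots+\alpha_d$ and $|n|=n_1+\ldots+n_d$ for multi-indices $\alpha\in(-1,\infty)^d$, $n\in\mathbb{N}^d$; $|x|$ is the Euclidean norm of a point $x$. The measure $\mu_\alpha$ on $\mathbb{R}_+^d$ is $\mu_\alpha(dx)=x_1^{2\alpha_1+1}\cdots x_d^{2\alpha_d+1}\,dx$, and $B(x,r)=\{y\in\mathbb{R}_+^d:|x-y|<r\}$. The Laguerre heat kernel is, for $t>0$ and $x,y\in\mathbb{R}_+^d$, $$G_t^\alpha(x,y)=(\sinh 2t)^{-d}\exp\Big(-\tfrac12\coth(2t)(|x|^2+|y|^2)\Big)\prod_{i=1}^d(x_iy_i)^{-\alpha_i}I_{\alpha_i}\Big(\frac{x_iy_i}{\sinh 2t}\Big),$$ where $I_\nu$ is the modified Bessel function of the first kind of order $\nu$. Laguerre partial derivatives: $\delta_{x_i}=\partial_{x_i}+x_i$ and $\delta_x^n=\delta_{x_1}^{n_1}\circ\cdots\circ\delta_{x_d}^{n_d}$ (acting in the $x$ variable). Standard estimates: a kernel $K(x,y)$ defined on $\{(x,y)\in\mathbb{R}_+^d\times\mathbb{R}_+^d: x\ne y\}$ with values in a Banach space $\mathbb{B}$ satisfies the standard estimates if there is a constant $C>0$ such that $$\|K(x,y)\|_{\mathbb{B}}\le \frac{C}{\mu_\alpha(B(x,|x-y|))},\qquad x\neq y,$$ $$\|K(x,y)-K(x',y)\|_{\mathbb{B}}\le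 C\,\frac{|x-x'|}{|x-y|}\,\frac{1}{\mu_\alpha(B(x,|x-y|))},\qquad |x-y|>2|x-x'|,$$ $$\|K(x,y)-K(x,y')\|_{\mathbb{B}}\le C\,\frac{|y-y'|}{|x-y|}\,\frac{1}{\mu_\alpha(B(x,|x-y|))},\qquad |x-y|>2|y-y'|.$$ *)

(* Defs.v *)
From HB Require Import structures.
From mathcomp Require Import all_boot all_order all_algebra complex.
From mathcomp Require Import all_classical all_reals all_analysis.
From mathcomp Require Import measurable_realfun.

Set Implicit Arguments.
Unset Strict Implicit.
Unset Printing Implicit Defensive.

Import Order.TTheory GRing.Theory Num.Theory.
Import numFieldNormedType.Exports.

Local Open Scope classical_set_scope.
Local Open Scope ring_scope.
Local Open Scope complex_scope.

Section Space.
Context {R : realType}.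

(* The norm of 'rV[R]_d in the library is the sup norm. *)
Definition enorm d (x : 'rV[R]_d) : R := Num.sqrt (\sum_(i < d) x 0 i ^+ 2).

Definition orthant d : set 'rV[R]_d := [set x | forall i, 0 < x 0 i].

Definition oball d (x : 'rV[R]_d) (r : R) : set 'rV[R]_d :=
  [set y | orthant y /\ enorm (x - y) < r].

(* Lebesgue integral over R^d of a nonnegative function, as an iterated
   integral. *)
Fixpoint iter_integral d : ('rV[R]_d -> \bar R) -> \bar R :=
  match d with
  | 0%N => fun f => f 0
  | d'.+1 => fun f =>
      (\int[lebesgue_measure]_t
         iter_integral (fun v : 'rV[R]_d' =>
           f (row_mx (t%:M : 'rV[R]_1) v : 'rV[R]_d'.+1)))%E
  end.

Definition mu_alpha d (alpha : 'I_d -> R) (A : set 'rV[R]_d) : \bar R :=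
  iter_integral (fun x =>
    (\1_(A `&` @orthant d) x * \prod_(i < d) x 0 i `^ (2 * alpha i + 1))%:E).

End Space.

Section Kernel.
Context {R : realType}.

Definition sinh (u : R) : R := (expR u - expR (- u)) / 2.
Definition cosh (u : R) : R := (expR u + expR (- u)) / 2.
Definition coth (u : R) : R := cosh u / sinh u.

(* Only meaningful for 0 < s. *)
Definition Gamma (s : R) : R :=
  \int[lebesgue_measure]_(t in `]0, +oo[) (t `^ (s - 1) * expR (- t)).

(* Modified Bessel function of the first kind, for -1 < nu and 0 < z. *)
Definition besselI (nu z : R) : R :=
  limn (series (fun k : nat =>
    (z / 2) `^ (2 * k%:R + nu) / (k`!%:R * Gamma (k%:R + nu + 1)))).

Definition heat_kernel d (alpha : 'I_d -> R) (t : R) (x y : 'rV[R]_d) : R :=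
  sinh (2 * t) ^- d
  * expR (- 2^-1 * coth (2 * t) * (enorm x ^+ 2 + enorm y ^+ 2))
  * \prod_(i < d) ((x 0 i * y 0 i) `^ (- alpha i)
                   * besselI (alpha i) (x 0 i * y 0 i / sinh (2 * t))).

Definition delta d (i : 'I_d) (f : 'rV[R]_d -> R) : 'rV[R]_d -> R :=
  fun x => 'D_(delta_mx 0 i) f x + x 0 i * f x.

Definition deltan d (n : 'I_d -> nat) (f : 'rV[R]_d -> R) : 'rV[R]_d -> R :=
  foldr (fun i g => iter (n i) (delta i) g) f (enum 'I_d).

Definition delta_heat d (alpha : 'I_d -> R) (n : 'I_d -> nat)
    (t : R) (x y : 'rV[R]_d) : R :=
  deltan n (fun z => heat_kernel alpha t z y) x.

Definition dt_delta_heat d (alpha : 'I_d -> R) (n : 'I_d -> nat) (m : nat)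
    (t : R) (x y : 'rV[R]_d) : R :=
  derive1n m (fun s => delta_heat alpha n s x y) t.

Definition dt_heat d (alpha : 'I_d -> R) (t : R) (x y : 'rV[R]_d) : R :=
  derive1 (fun s => heat_kernel alpha s x y) t.

End Kernel.

(* The measure t^a dt on ]0, +oo[, seen as a measure on R. *)
Definition pow_measure {R : realType} (a : R) (A : set R) : \bar R :=
  (\int[lebesgue_measure]_(t in A `&` `]0%R, +oo[) (t `^ a)%:E)%E.

Section PowMeasure.
Context {R : realType} (a : R).

Let pow_measure0 : pow_measure a set0 = 0%E.
Proof. by rewrite /pow_measure set0I integral_set0. Qed.

Let pow_measure_ge0 A : (0 <= pow_measure a A)%E.
Proof. by apply: integral_ge0 => t _; rewrite lee_fin powR_ge0. Qed.

Let pow_measure_sigma_additive : semi_sigma_additive (pow_measure a).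
Proof.
move=> F mF tF mUF; rewrite /pow_measure setI_bigcupl.
rewrite ge0_integral_bigcup//=.
- apply: is_cvg_ereal_nneg_natsum_cond => n _ _.
  exact: pow_measure_ge0.
- by move=> n; apply: measurableI; [exact: mF|exact: measurable_itv].
- apply/measurable_EFinP; apply: measurable_funS (@measurable_powR R a) => //.
- by move=> t _; rewrite lee_fin powR_ge0.
- exact: trivIset_setIr.
Qed.

HB.instance Definition _ := isMeasure.Build _ _ _ (pow_measure a)
  pow_measure0 pow_measure_ge0 pow_measure_sigma_additive.

End PowMeasure.

Section SignedMeasures.
Context {R : realType}.
Implicit Types nu : set R -> \bar R.

(* Countably additive with values in [-oo, +oo], at most one of the infinite
   values being taken. *)
Definition signed_measure nu : Prop :=
  [/\ nu set0 = 0%E,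
      (forall A, measurable A -> nu A != +oo%E) \/
      (forall A, measurable A -> nu A != -oo%E)
    & semi_sigma_additive nu].

Definition compact_itv (k : nat) : set R := `[k.+1%:R^-1, k.+1%:R].

Definition locally_signed_measure nu : Prop :=
  forall k, signed_measure (fun A => nu (A `&` compact_itv k)).

Lemma signed_measure_locally nu :
  signed_measure nu -> locally_signed_measure nu.
Proof.
move=> [nu0 nuoo nuS] k; have mk : measurable (compact_itv k).
  exact: measurable_itv.
split; first by rewrite set0I.
- by case: nuoo => H; [left|right] => A mA; apply: H; exact: measurableI.
- move=> F mF tF mUF; rewrite setI_bigcupl.
  apply: (nuS (fun i => F i `&` compact_itv k)).
  + by move=> i; exact: measurableI.
  + exact: trivIset_setIr.
  + by apply: bigcup_measurable => i _; exact: measurableI.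
Qed.

Lemma charge_signed_measure (nu : {charge set R -> \bar R}) :
  signed_measure nu.
Proof.
split; [exact: charge0| |exact: charge_semi_sigma_additive].
by left=> A mA; have := fin_num_measure nu A mA; rewrite fin_numE => /andP[].
Qed.

(* A Borel measure on ]0, +oo[, signed or complex, is given by its real and
   imaginary parts nu1 and nu2.  Neither |nu|(]0, +oo[) nor the value of nu on
   unbounded sets need make sense: only the values on Borel subsets of compact
   subsets of ]0, +oo[ are used. *)
Definition locally_complex_measure nu1 nu2 : Prop :=
  locally_signed_measure nu1 /\ locally_signed_measure nu2.

Definition rel_compact_borel (A : set R) : set (set R) :=
  [set B | [/\ measurable B, B `<=` A & exists k, B `<=` compact_itv k]].

Definition variation_measure nu1 nu2 (A : set R) : \bar R :=
  ereal_sup [set s | exists (p : nat) (F : 'I_p -> set R),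
    [/\ forall i, rel_compact_borel A (F i), trivIset setT F
      & s = (\sum_(i < p)
               sqrte (nu1 (F i) * nu1 (F i) + nu2 (F i) * nu2 (F i)))%E]].

(* Jordan decomposition: nu = positive_part nu - negative_part nu. *)
Definition positive_part nu (A : set R) : \bar R :=
  ereal_sup [set nu B | B in rel_compact_borel A].

Definition negative_part nu (A : set R) : \bar R :=
  ereal_sup [set (- nu B)%E | B in rel_compact_borel A].

Definition signed_integral nu (f : R -> R) : R :=
  fine (\int[positive_part nu]_(t in `]0%R, +oo[) (f t)%:E)%E
  - fine (\int[negative_part nu]_(t in `]0%R, +oo[) (f t)%:E)%E.

Definition complex_measure_integral nu1 nu2 (f : R -> R) : R[i] :=
  signed_integral nu1 f +i* signed_integral nu2 f.

End SignedMeasures.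

Section ComplexFunctions.
Context {R : realType}.

Definition cintegrable (D : set R) (f : R -> R[i]) : Prop :=
  lebesgue_measure.-integrable D (EFin \o (fun t => complex.Re (f t))) /\
  lebesgue_measure.-integrable D (EFin \o (fun t => complex.Im (f t))).

Definition cintegral (D : set R) (f : R -> R[i]) : R[i] :=
  (\int[lebesgue_measure]_(t in D) complex.Re (f t)) +i*
  (\int[lebesgue_measure]_(t in D) complex.Im (f t)).

Definition cnorm (z : R[i]) : \bar R := (ComplexField.Normc.normc z)%:E.

(* psi represents a class in L^oo(]0, +oo[, dt) *)
Definition cLinfty (psi : R -> R[i]) : Prop :=
  [/\ measurable_fun (`]0, +oo[%classic : set R) (fun t => complex.Re (psi t)),
      measurable_fun (`]0, +oo[%classic : set R) (fun t => complex.Im (psi t))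
    & ('N[pow_measure (0 : R)]_+oo [ cnorm \o psi ] < +oo)%E].

End ComplexFunctions.

Section StandardEstimates.
Context {R : realType}.

(* N is the norm of the Banach space; values of K may be representatives,
   e.g. functions for a space L^p. *)
Definition standard_estimates d (alpha : 'I_d -> R) (V : zmodType)
    (N : V -> \bar R) (K : 'rV[R]_d -> 'rV[R]_d -> V) : Prop :=
  exists2 C : R, 0 < C &
  [/\ forall x y, orthant x -> orthant y -> x != y ->
        (N (K x y) <= C%:E / mu_alpha alpha (oball x (enorm (x - y))))%E,
      forall x x' y, orthant x -> orthant x' -> orthant y ->
        enorm (x - y) > 2 * enorm (x - x') ->
        (N (K x y - K x' y)%R <=
           (C * (enorm (x - x') / enorm (x - y)))%:E
           / mu_alpha alpha (oball x (enorm (x - y))))%E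
    & forall x y y', orthant x -> orthant y -> orthant y' ->
        enorm (x - y) > 2 * enorm (y - y') ->
        (N (K x y - K x y')%R <=
           (C * (enorm (y - y') / enorm (x - y)))%:E
           / mu_alpha alpha (oball x (enorm (x - y))))%E].

Definition Lp_norm (mu : {measure set R -> \bar R}) (p : \bar R)
  (f : R -> R) : \bar R := 'N[mu]_p [ EFin \o f ].

(* Holds of P at every pair of points where the kernels are defined. *)
Definition off_diagonal d (P : 'rV[R]_d -> 'rV[R]_d -> Prop) : Prop :=
  forall x y, orthant x -> orthant y -> x != y -> P x y.

End StandardEstimates.

Section Kernels.
Context {R : realType} {d : nat} (alpha : 'I_d -> R).
Implicit Types x y : 'rV[R]_d.

(* Families indexed by 0 < t are extended by 0 to the whole line. *)
Definition maximal_kernel x y : R -> R :=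
  (fun t => heat_kernel alpha t x y) \_ `]0, +oo[.

Definition riesz_integrand (n : 'I_d -> nat) x y (t : R) : R :=
  delta_heat alpha n t x y * t `^ ((\sum_i n i)%:R / 2 - 1).

Definition riesz_kernel (n : 'I_d -> nat) x y : R[i] :=
  ((Gamma ((\sum_i n i)%:R / 2))^-1 *
   \int[lebesgue_measure]_(t in `]0, +oo[) riesz_integrand n x y t)%:C.

Definition square_kernel (n : 'I_d -> nat) (m : nat) x y : R -> R :=
  (fun t => dt_delta_heat alpha n m t x y) \_ `]0, +oo[.

Definition laplace_integrand (psi : R -> R[i]) x y (t : R) : R[i] :=
  psi t * (dt_heat alpha t x y)%:C.

Definition laplace_kernel (psi : R -> R[i]) x y : R[i] :=
  - cintegral `]0, +oo[ (laplace_integrand psi x y).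

Definition stieltjes_kernel (nu1 nu2 : set R -> \bar R) x y : R[i] :=
  complex_measure_integral nu1 nu2 (fun t => heat_kernel alpha t x y).

End Kernels.

(* Main.v *)
Require Import Defs.
From HB Require Import structures.
From mathcomp Require Import all_boot all_order all_algebra complex.
From mathcomp Require Import all_classical all_reals all_analysis.
From mathcomp Require Import measurable_realfun ess_sup_inf ring lra zify.
Import Order.TTheory GRing.Theory Num.Theory.
Import numFieldNormedType.Exports HBNNSimple.
Set Implicit Arguments.
Unset Strict Implicit.
Unset Printing Implicit Defensive.
Local Open Scope classical_set_scope.
Local Open Scope ring_scope.

(** Why the estimates hold.

    Put [z i = x i * y i / sinh (2 t)].  For [-1 < nu] the modified Bessel
    function is [2 `^ - nu * z `^ nu * expR z * (1 + z) `^ - (nu + 1/2)] times a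
    bounded function that belongs to a family stable under differentiation,
    each derivative gaining a factor [(1 + z)^-1] ([bessel_symbol]).  This
    comes out of Bessel's equation alone: an energy estimate bounds the
    function itself, and the equation, read as a first-order equation, then
    bounds the derivatives one after the other.  All orders [nu] above [-1] are
    treated alike.

    The factor [expR z] completes the square in the exponent of the heat
    kernel, which becomes an explicit prefactor times such bounded functions.
    Therefore every derivative of the kernel in [t], [x], [y] is the same
    prefactor times a polynomial in finitely many quantities.  These
    polynomials are handled as syntax ([symbol], [eval]): differentiating the
    kernel is an operation [D] on symbols ([der_kern]), and each symbol has an
    order, raised by at most 1 by [partial_x], [partial_y] and [delta_x], and
    by at most 2 by [partial_t].  With [s = root t = sqrt (tanh t)], a symbol
    of order [w] costs a factor [s ^- w] and a power of a weight that the
    Gaussian factor absorbs ([eval_dominated], [kern_bound]):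
    the kernel of [e] is at most
    [C * expR (- c t) * s ^- w / vol x s * expR (- (r / s) ^ 2 / 16)], where
    [r = |x - y|], [c = 2 d + 2 |alpha|], and [vol x s] is the size of the ball
    of radius [s].  Passing from [vol x s] to [vol x r] costs
    [(r / s) `^ gain * (1 + r / s) `^ K] with [0 < gain]; the Gaussian absorbs
    the second factor ([kern_growth]).  The mean value theorem along a segment
    that stays away from the diagonal gives a bound of the same form for
    differences, with the additional factor [|x - x'| / |x - y|] ([kern_smooth]).

    What remains is to take norms in [t] of the [majorant] so obtained.  The
    growth and the smoothness estimates then follow simultaneously
    ([standard_estimates_kern]).  Without singular power of [s] the majorant is
    at most [C * expR (- c t)]: this is the supremum norm, and the case of the
    measure [nu].  For the other kernels the available power of [t] matches
    the order of the symbol, and the majorant is dominated by [bump], a function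
    with an explicit bounded primitive ([majorant_bump], [majorant_bump_sqr]);
    the positive exponent [gain] is what makes the times beyond [r ^ 2] converge.

    For the kernels attached to a measure [nu], the total variation and the
    Jordan parts are suprema over finite disjoint families of relatively compact
    Borel sets.  Such suprema are measures as soon as the set function is
    countably subadditive ([sup_measure_sigma_additive]); that [nu] takes finite
    values on relatively compact sets, which is needed here, is a consequence
    of the integrability assumption ([locally_complex_finite]). *)

(** * Differentiation of functions of a real variable *)
Section Rules.
Context {R : realType}.
Implicit Types (f g : R -> R) (a b c z p : R).

Lemma derD f g z a b : is_derive z 1 f a -> is_derive z 1 g b ->
  is_derive z 1 (fun x => f x + g x) (a + b).
Proof. exact: is_deriveD. Qed.

Lemma derN f z a : is_derive z 1 f a -> is_derive z 1 (fun x => - f x) (- a).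
Proof. exact: is_deriveN. Qed.

Lemma derB f g z a b : is_derive z 1 f a -> is_derive z 1 g b ->
  is_derive z 1 (fun x => f x - g x) (a - b).
Proof. exact: is_deriveB. Qed.

Lemma derM f g z a b : is_derive z 1 f a -> is_derive z 1 g b ->
  is_derive z 1 (fun x => f x * g x) (a * g z + f z * b).
Proof.
move=> df dg; apply: is_derive_eq (is_deriveM df dg) _.
by rewrite /GRing.scale/= addrC mulrC.
Qed.

Lemma der_cst c z : is_derive z 1 (fun _ : R => c) 0.
Proof. exact: is_derive_cst. Qed.

Lemma der_id z : is_derive z 1 (fun x : R => x) 1.
Proof. exact: is_derive_id. Qed.

Lemma der_cM c f z a : is_derive z 1 f a -> is_derive z 1 (fun x => c * f x) (c * a).
Proof. by move=> df; apply: is_derive_eq (derM (der_cst c z) df) _; rewrite mul0r add0r. Qed.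

Lemma derV f z a : f z != 0 -> is_derive z 1 f a ->
  is_derive z 1 (fun x => (f x)^-1) (- (a / f z ^+ 2)).
Proof.
move=> f0 df; apply: is_derive_eq (is_deriveV f0 df) _.
by rewrite /GRing.scale/= mulNr mulrC.
Qed.

Lemma der_comp f g z a b : is_derive (g z) 1 f a -> is_derive z 1 g b ->
  is_derive z 1 (fun x => f (g x)) (a * b).
Proof. exact: is_derive1_comp. Qed.

Lemma der_exp f z a : is_derive z 1 f a ->
  is_derive z 1 (fun x => expR (f x)) (a * expR (f z)).
Proof. by move=> df; rewrite mulrC; apply: der_comp df; exact: is_derive_expR. Qed.

Lemma der_powR f p z a : 0 < f z -> is_derive z 1 f a ->
  is_derive z 1 (fun x => f x `^ p) (p * (a / f z) * f z `^ p).
Proof.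
move=> f0 df; apply: is_derive_eq (der_comp (is_derive1_powR p f0) df) _.
rewrite powRB; last by rewrite (gt_eqF f0) implybT.
by rewrite powRr1 ?(ltW f0)//; field; rewrite gt_eqF.
Qed.

Lemma der_uniq f z a b : is_derive z 1 f a -> is_derive z 1 f b -> a = b.
Proof. by move=> [_ <-] [_ <-]. Qed.

End Rules.

(** * Integrals over the half-line *)
Section HalfLine.
Context {R : realType}.
Implicit Types (f F : R -> R) (a b r s t x : R).
Local Notation mu := (@lebesgue_measure R).
Local Notation pos := (`]0, +oo[%classic : set R).

Lemma is_derive_continuous f df t : is_derive t 1 f df -> {for t, continuous f}.
Proof.
by move=> [fd _]; apply: differentiable_continuous; apply/derivable1_diffP.
Qed.

Lemma continuous_pos_measurable f :
  (forall t, 0 < t -> {for t, continuous f}) -> measurable_fun pos f.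
Proof.
move=> cf; apply: open_continuous_measurable_fun => // t.
by rewrite inE/= in_itv/= andbT => /cf.
Qed.

Lemma compact_itv_pos k t : compact_itv k t -> 0 < t.
Proof.
by rewrite /compact_itv/= in_itv/= => /andP[+ _]; apply: lt_le_trans; rewrite invr_gt0.
Qed.

Lemma measurable_compact_itv k : measurable (@compact_itv R k).
Proof. exact: measurable_itv. Qed.

Lemma compact_itv_nd : nondecreasing_seq (@compact_itv R).
Proof.
move=> m n mn; apply/subsetPset => t; rewrite /compact_itv/= !in_itv/= => /andP[h1 h2].
apply/andP; split.
  by apply: le_trans h1; rewrite lef_pV2 ?posrE// ler_nat.
by apply: le_trans h2 _; rewrite ler_nat.
Qed.

Lemma bigcup_compact_itv : \bigcup_k (@compact_itv R k) = pos.
Proof.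
apply/seteqP; split => t.
  by move=> [k _ /compact_itv_pos t0]; rewrite /= in_itv/= t0.
rewrite /= in_itv/= andbT => t0.
exists (maxn (Num.truncn t) (Num.truncn t^-1)) => //.
rewrite /compact_itv/= in_itv/=; apply/andP; split.
  rewrite invf_ple ?posrE//; apply: le_trans (ltW (truncnS_gt _)) _.
  by rewrite ler_nat ltnS leq_maxr.
apply: le_trans (ltW (truncnS_gt _)) _.
by rewrite ler_nat ltnS leq_maxl.
Qed.

Lemma cvg_integral_compact_itv (f : R -> \bar R) : measurable_fun pos f ->
  (forall t, 0 < t -> (0 <= f t)%E) ->
  (\int[mu]_(t in compact_itv k) f t)%E @[k --> \oo] -->
  (\int[mu]_(t in pos) f t)%E.
Proof.
move=> mf f0; rewrite -bigcup_compact_itv.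
apply: ge0_nondecreasing_set_cvg_integral.
- exact: compact_itv_nd.
- by move=> i; exact: measurable_itv.
- move=> i; apply: measurable_funS mf => //.
  by move=> t /compact_itv_pos t0; rewrite /= in_itv/= t0.
- by move=> i t /compact_itv_pos; exact: f0.
Qed.

Lemma continuous_pos_within f k : (forall t, 0 < t -> {for t, continuous f}) ->
  {within compact_itv k, continuous f}.
Proof.
move=> cf; apply: continuous_in_subspaceT => t; rewrite inE => /compact_itv_pos.
exact: cf.
Qed.

Lemma integrable_compact_itv f k :
  (forall t, 0 < t -> {for t, continuous f}) ->
  mu.-integrable (compact_itv k) (EFin \o f).
Proof.
move=> cf; apply: continuous_compact_integrable; first exact: segment_compact.
exact: continuous_pos_within.
Qed.

Lemma integral_compact_itv_FTC F f k :
  (forall t, 0 < t -> is_derive t 1 F (f t)) ->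
  (forall t, 0 < t -> {for t, continuous f}) ->
  (\int[mu]_(t in compact_itv k) (f t)%:E = (F k.+1%:R - F k.+1%:R^-1)%:E)%E.
Proof.
move=> dF cf; have [->|k0] := eqVneq k 0%N.
  by rewrite /compact_itv invr1 set_itv1 integral_set1 subrr.
have k1 : (k.+1%:R^-1 < k.+1%:R :> R).
  rewrite (@lt_trans _ _ 1)//; last by rewrite ltr1n ltnS lt0n.
  by rewrite invf_lt1 ?ltr1n ?ltnS ?lt0n.
have cF t : 0 < t -> {for t, continuous F} by move=> /dF/is_derive_continuous.
rewrite /compact_itv (@continuous_FTC2 _ _ F _ _ k1 (continuous_pos_within (k := k) cf)) ?EFinB//.
- split.
  + move=> t; rewrite in_itv/= => /andP[t0 _].
    by have [] := dF t (lt_trans (_ : 0 < k.+1%:R^-1) t0); rewrite ?invr_gt0.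
  + by apply: cvg_at_right_filter; apply: cF; rewrite invr_gt0.
  + by apply: cvg_at_left_filter; exact: cF.
- move=> t; rewrite in_itv/= => /andP[t0 _].
  have tt : 0 < t by apply: lt_trans t0; rewrite invr_gt0.
  by rewrite derive1E; have [_ ->] := dF t tt.
Qed.

(** Fundamental theorem of calculus on compact intervals, and exhaustion. *)
Lemma integral_pos_le_primitive F f a b :
  (forall t, 0 < t -> is_derive t 1 F (f t)) ->
  (forall t, 0 < t -> {for t, continuous f}) ->
  (forall t, 0 < t -> 0 <= f t) ->
  (forall t, 0 < t -> a <= F t <= b) ->
  (\int[mu]_(t in pos) (f t)%:E <= (b - a)%:E)%E.
Proof.
move=> dF cf f0 Fab.
have mf : measurable_fun pos (EFin \o f).
  by apply/measurable_EFinP; exact: continuous_pos_measurable.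
have ef0 t : 0 < t -> (0 <= (f t)%:E)%E by move=> /f0; rewrite lee_fin.
have := cvg_integral_compact_itv mf ef0.
move=> /[dup] /cvgP c1 /cvg_lim <-//; apply: lime_le => //.
apply: nearW => k; rewrite (integral_compact_itv_FTC k dF cf) lee_fin.
have /andP[_ h1] := Fab k.+1%:R (ltr0Sn _ _).
have /andP[h2 _] : a <= F k.+1%:R^-1 <= b by apply: Fab; rewrite invr_gt0.
exact: lerB.
Qed.

(** The exponential wins over powers: [1 + t <= K * expR (b * t / (a + 1))],
    raised to the power [a]. *)
Lemma powR_expR_bounded a b : 0 <= a -> 0 < b ->
  exists2 C, 0 < C & forall t, 0 <= t -> (1 + t) `^ a * expR (- (b * t)) <= C.
Proof.
move=> a0 b0; pose K := 1 + (a + 1) / b.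
have K1 : 1 <= K by rewrite lerDl divr_ge0 ?addr_ge0// ltW.
exists (K `^ a); first by rewrite powR_gt0// (lt_le_trans ltr01).
move=> t t0.
have h : 1 + t <= K * expR (b / (a + 1) * t).
  apply: (@le_trans _ _ (K * (1 + b / (a + 1) * t))).
    have a1 : a + 1 != 0 by rewrite gt_eqF// ltr_wpDl.
    rewrite /K -subr_ge0.
    have -> : (1 + (a + 1) / b) * (1 + b / (a + 1) * t) - (1 + t) =
      (a + 1) / b + b / (a + 1) * t by field; rewrite a1 gt_eqF.
    have b0' := ltW b0; have a1' : 0 <= a + 1 by lra.
    by rewrite addr_ge0 ?mulr_ge0 ?invr_ge0 ?mulr_ge0 ?invr_ge0.
  by rewrite ler_wpM2l ?(le_trans ler01)// expR_ge1Dx.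
have h2 : (1 + t) `^ a <= K `^ a * expR (b * t).
  apply: le_trans (ge0_ler_powR a0 _ _ h) _.
  - by rewrite nnegrE addr_ge0.
  - by rewrite nnegrE mulr_ge0 ?expR_ge0// (le_trans ler01).
  rewrite powRM ?expR_ge0// ?(le_trans ler01)// ler_wpM2l ?powR_ge0//.
  rewrite -expRM ler_expR -mulrA [t * a]mulrC mulrA ler_wpM2r//.
  by rewrite -mulrA ger_pMr// mulrC ler_pdivrMr ?mul1r ?lerDl//; lra.
apply: le_trans (ler_wpM2r (expR_ge0 _) h2) _.
by rewrite expRN mulfK// gt_eqF// expR_gt0.
Qed.

(** In terms of [u = (t / r) `^ s] this is [u / (1 + u) ^ 2 / t]: with respect
    to [dt / t] it is concentrated around [t = r].  Being the derivative of
    [- (s * (1 + u))^-1], it has an integral bounded uniformly in [r]. *)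
Definition bump s r t := t^-1 * ((t / r) `^ s / (1 + (t / r) `^ s) ^+ 2).

Lemma bump_ge0 s r t : 0 < t -> 0 <= bump s r t.
Proof. by move=> t0; rewrite mulr_ge0 ?invr_ge0 ?(ltW t0)// divr_ge0 ?powR_ge0// sqr_ge0. Qed.

Lemma is_derive_powR_scaled s r t : 0 < r -> 0 < t ->
  is_derive t 1 (fun x => (x / r) `^ s) (s * t^-1 * (t / r) `^ s).
Proof.
move=> r0 t0; have tr : 0 < t / r by rewrite divr_gt0.
apply: is_derive_eq (@der_powR _ (fun x => x / r) s t _ tr (derM (der_id t) (der_cst r^-1 t))) _.
by field; rewrite !gt_eqF.
Qed.

Lemma is_derive_bump s r t : 0 < s -> 0 < r -> 0 < t ->
  is_derive t 1 (fun x => - (s^-1 * (1 + (x / r) `^ s)^-1)) (bump s r t).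
Proof.
move=> s0 r0 t0; have p0 : 0 < 1 + (t / r) `^ s by rewrite ltr_pwDl// powR_ge0.
have d := derD (der_cst 1 t) (is_derive_powR_scaled s r0 t0).
apply: is_derive_eq (derN (der_cM s^-1 (@derV _ (fun x => 1 + (x / r) `^ s) t _ (lt0r_neq0 p0) d))) _.
by rewrite /bump; field; rewrite !gt_eqF.
Qed.

Lemma continuous_bump s r t : 0 < r -> 0 < t -> {for t, continuous (bump s r)}.
Proof.
move=> r0 t0; have c := is_derive_continuous (is_derive_powR_scaled s r0 t0).
apply: continuousM; first exact: inv_continuous (lt0r_neq0 t0).
apply: continuousM => //.
have p0 : (1 + (t / r) `^ s) ^+ 2 != 0 by rewrite expf_neq0// gt_eqF// ltr_pwDl// powR_ge0.
apply: (@continuousV _ _ (fun x => (1 + (x / r) `^ s) ^+ 2) t) => //.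
by apply: continuousM; apply: continuousD => //; exact: cst_continuous.
Qed.

Lemma integral_bump_le s r : 0 < s -> 0 < r ->
  (\int[mu]_(t in pos) (bump s r t)%:E <= (s^-1)%:E)%E.
Proof.
move=> s0 r0; have -> : s^-1 = 0 - (- s^-1) by rewrite opprK add0r.
apply: integral_pos_le_primitive.
- by move=> t t0; exact: is_derive_bump.
- by move=> t t0; exact: continuous_bump.
- by move=> t t0; exact: bump_ge0.
move=> t t0; have p0 : 1 <= 1 + (t / r) `^ s by rewrite lerDl powR_ge0.
have q0 : 0 < 1 + (t / r) `^ s by rewrite (lt_le_trans ltr01).
rewrite oppr_le0 mulr_ge0 ?invr_ge0 ?(ltW s0) ?(ltW q0)// andbT.
by rewrite lerN2 ger_pMr ?invr_gt0// invf_le1.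
Qed.

End HalfLine.

(** * The Gamma function *)
Section GammaFunction.
Context {R : realType}.
Implicit Types (s t : R).
Local Notation mu := (@lebesgue_measure R).
Local Notation pos := (`]0, +oo[%classic : set R).

Definition gamma_density s t := t `^ (s - 1) * expR (- t).

Lemma gamma_density_ge0 s t : 0 <= gamma_density s t.
Proof. by rewrite mulr_ge0 ?powR_ge0 ?expR_ge0. Qed.

Lemma continuous_powR_pos s t : 0 < t -> {for t, continuous (fun x : R => x `^ s)}.
Proof. by move=> t0; exact: is_derive_continuous (is_derive1_powR s t0). Qed.

Lemma is_derive_expRN t : is_derive t 1 (fun x => expR (- x)) (- expR (- t)).
Proof. by apply: is_derive_eq (der_exp (derN (der_id t))) _; rewrite mulN1r. Qed.

Lemma continuous_gamma_density s t : 0 < t -> {for t, continuous (gamma_density s)}.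
Proof.
move=> t0; apply: continuousM; first exact: continuous_powR_pos.
exact: is_derive_continuous (is_derive_expRN t).
Qed.

Lemma measurable_gamma_density s : measurable_fun pos (EFin \o gamma_density s).
Proof.
apply/measurable_EFinP; apply: continuous_pos_measurable => t.
exact: continuous_gamma_density.
Qed.

Lemma powR_ge1 (a s : R) : 1 <= a -> 0 <= s -> 1 <= a `^ s.
Proof. by move=> a1 s0; rewrite -[leLHS](powRr0 a) ler_powR. Qed.

Lemma powR_le1 (a s : R) : 0 < a <= 1 -> 0 <= s -> a `^ s <= 1.
Proof. by move=> a1 s0; rewrite -[leRHS](powRr0 a) ger_powR. Qed.

(** The density is at most [t `^ s / t] near 0 and decays faster than any power
    at infinity. *)
Lemma gamma_density_le_bump s : 0 < s ->
  exists2 C, 0 < C & forall t, 0 < t -> gamma_density s t <= C * bump s 1 t.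
Proof.
move=> s0; have [C C0 hC] := @powR_expR_bounded R (s + s) 1 ltac:(lra) ltr01.
exists (4 * C); first by rewrite mulr_gt0.
move=> t t0; rewrite /gamma_density /bump divr1.
rewrite powRB ?powRr1 ?(ltW t0)//; last by rewrite (gt_eqF t0) implybT.
have h := hC t (ltW t0); rewrite mul1r in h.
have u0 := powR_ge0 t s; set u := t `^ s in u0 *.
have p0 : 0 < 1 + u by lra.
have hu : (1 + u) ^+ 2 <= 4 * (1 + t) `^ (s + s).
  rewrite powRD; last by rewrite (gt_eqF (_ : 0 < 1 + t)) ?implybT//; lra.
  have h1 : 1 <= (1 + t) `^ s by apply: powR_ge1; lra.
  have h2 : u <= (1 + t) `^ s by rewrite ge0_ler_powR ?nnegrE//; lra.
  by nra.
have E := expR_ge0 (- t).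
rewrite [X in _ <= X](_ : _ = u / t * (4 * C / (1 + u) ^+ 2)); last first.
  by field; rewrite !gt_eqF.
apply: ler_wpM2l; first by rewrite divr_ge0// ltW.
rewrite ler_pdivlMr ?exprn_gt0//.
apply: le_trans (ler_wpM2l E hu) _.
by rewrite mulrCA ler_wpM2l// mulrC.
Qed.

Lemma gamma_lty s : 0 < s -> (\int[mu]_(t in pos) (gamma_density s t)%:E < +oo)%E.
Proof.
move=> s0; have [C C0 hC] := gamma_density_le_bump s0.
have mb : measurable_fun pos (EFin \o bump s 1).
  by apply/measurable_EFinP; apply: continuous_pos_measurable => t; exact: continuous_bump.
apply: (@le_lt_trans _ _ (C%:E * \int[mu]_(t in pos) (bump s 1 t)%:E)%E).
  rewrite -ge0_integralZl_EFin//; last 2 first.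
  - by move=> t; rewrite /= in_itv/= andbT => t0; rewrite lee_fin bump_ge0.
  - exact: ltW.
  apply: ge0_le_integral => //.
  - by move=> t _; rewrite lee_fin gamma_density_ge0.
  - exact: measurable_gamma_density.
  - exact: measurable_funeM.
  - by move=> t; rewrite /= in_itv/= andbT => t0; rewrite lee_fin hC.
rewrite (@le_lt_trans _ _ (C * s^-1)%:E) ?ltry// EFinM lee_wpmul2l ?lee_fin ?(ltW C0)//.
exact: integral_bump_le.
Qed.

Lemma GammaE s : 0 < s -> ((Gamma s)%:E = \int[mu]_(t in pos) (gamma_density s t)%:E)%E.
Proof.
move=> s0; rewrite /Gamma /Rintegral fineK// ge0_fin_numE ?gamma_lty//.
by apply: integral_ge0 => t _; rewrite lee_fin gamma_density_ge0.
Qed.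

(** The density is bounded below on [[1, 2]]. *)
Lemma Gamma_gt0 s : 0 < s -> 0 < Gamma s.
Proof.
move=> s0; rewrite -lte_fin GammaE//.
pose m := Num.min 1 (2 `^ (s - 1)) * expR (- 2) : R.
have m0 : 0 < m by rewrite mulr_gt0 ?expR_gt0// lt_min ltr01 powR_gt0.
have s12 : `[1, 2]%classic `<=` pos.
  by move=> t; rewrite /= !in_itv/= andbT => /andP[t1 _]; rewrite (lt_le_trans ltr01).
apply: (@lt_le_trans _ _ (\int[mu]_(t in `[1%R, 2%R]) m%:E)%E).
  rewrite integral_cst//= lebesgue_measure_itv/= lte_fin ltr1n /= -EFinD -EFinM.
  by rewrite lte_fin mulr_gt0// subr_gt0 ltr1n.
apply: (@le_trans _ _ (\int[mu]_(t in `[1%R, 2%R]) (gamma_density s t)%:E)%E).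
  apply: ge0_le_integral => //.
  - by move=> t _; rewrite lee_fin ltW.
  - by apply: measurable_funS (measurable_gamma_density s).
  move=> t; rewrite /= in_itv/= => /andP[t1 t2]; rewrite lee_fin.
  apply: ler_pM; rewrite ?expR_ge0 ?le_min ?powR_ge0 ?ler01//; last by rewrite ler_expR lerN2.
  rewrite ge_min; have [s1|s1] := leP 1 s.
    by rewrite powR_ge1 ?subr_ge0.
  have t0 : 0 < (t : R) by rewrite (lt_le_trans ltr01).
  apply/orP; right; rewrite -(opprB 1 s) !powRN lef_pV2 ?posrE ?powR_gt0//.
  by rewrite ge0_ler_powR ?nnegrE ?subr_ge0 ?(ltW s1)// ltW.
apply: ge0_subset_integral => //.
- exact: measurable_gamma_density.
- by move=> t _; rewrite lee_fin gamma_density_ge0.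
Qed.

Lemma is_derive_powR_expRN s t : 0 < t ->
  is_derive t 1 (fun x => x `^ s * expR (- x)) (s * gamma_density s t - gamma_density (s + 1) t).
Proof.
move=> t0; have h := is_deriveM (is_derive1_powR s t0) (is_derive_expRN t).
apply: is_derive_eq h _; rewrite /gamma_density addrK /GRing.scale/=; ring.
Qed.

(** The boundary terms in the integration by parts for [GammaS]. *)
Lemma powR_expRN_cvg_compact s : 0 < s ->
  (k.+1%:R `^ s * expR (- k.+1%:R) - (k.+1%:R^-1) `^ s * expR (- k.+1%:R^-1) : R) @[k --> \oo] --> (0 : R).
Proof.
move=> s0; rewrite -[X in _ --> X](subr0 (0 : R)); apply: cvgB.
  have [C C0 hC] := @powR_expR_bounded R (s + 1) 1 ltac:(lra) ltr01.
  apply: (@squeeze_cvgr _ _ _ _ (cst 0) (fun k => C * k.+1%:R^-1)).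
  - apply: nearW => k; rewrite mulr_ge0 ?powR_ge0 ?expR_ge0//=.
    rewrite ler_pdivlMr// mulrAC.
    have := hC k.+1%:R (ler0n _ _); rewrite mul1r; apply: le_trans.
    apply: ler_wpM2r; first exact: expR_ge0.
    rewrite powRD ?powRr1//; last by rewrite (gt_eqF (_ : 0 < 1 + k.+1%:R)) ?implybT// ltr_wpDl.
    apply: ler_pM; rewrite ?powR_ge0// ?lerDr//.
    by rewrite ge0_ler_powR ?nnegrE ?lerDr// ltW.
  - exact: cvg_cst.
  - by rewrite -[X in _ --> X](mulr0 C); apply: cvgMr => //; exact: cvg_harmonic.
apply: (@squeeze_cvgr _ _ _ _ (cst 0) (fun k => (k.+1%:R^-1) `^ s)).
- apply: nearW => k; rewrite mulr_ge0 ?powR_ge0 ?expR_ge0//=.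
  by rewrite ger_pMr ?powR_gt0// expR_le1 oppr_le0.
- exact: cvg_cst.
have h0 : (@harmonic R k) @[k --> \oo] --> (0 : R)^'+.
  move=> P hP; have hN : \forall k \near \oo, 0 < harmonic k :> R -> P (harmonic k) := cvg_harmonic hP.
  by apply: filterS hN => k; apply; exact: harmonic_gt0.
exact: cvg_comp h0 (powR_cvg0 s0).
Qed.

(** Integration by parts on compact intervals that exhaust the half-line. *)
Lemma GammaS s : 0 < s -> Gamma (s + 1) = s * Gamma s.
Proof.
move=> s0; apply/EFin_inj; have s1 : 0 < s + 1 by lra.
rewrite EFinM !GammaE//.
pose F := fun x : R => x `^ s * expR (- x).
pose I s k := (\int[mu]_(t in compact_itv k) (gamma_density s t)%:E)%E.
have cg s' t : 0 < t -> {for t, continuous (gamma_density s')} by exact: continuous_gamma_density.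
have ig s' k : mu.-integrable (compact_itv k) (EFin \o gamma_density s').
  by apply: integrable_compact_itv; exact: cg.
have e k : (I (s + 1)%R k + (F k.+1%:R - F k.+1%:R^-1)%R%:E = s%:E * I s k)%E.
  have := @integral_compact_itv_FTC _ F _ k (fun t ht => is_derive_powR_expRN s ht).
  move=> <-; last first.
    move=> t t0; apply: continuousB; last exact: cg.
    by apply: continuousM; [exact: cvg_cst|exact: cg].
  have mk := @measurable_compact_itv R k; rewrite /I -integralZl//; last exact: ig.
  under [X in (_ + X)%E]eq_integral do rewrite EFinB EFinM.
  have isg : mu.-integrable (compact_itv k) (fun x => (s%:E * (EFin \o gamma_density s) x)%E) by exact: integrableZl.
  rewrite (integralB _ isg (ig (s + 1) k))//.
  rewrite addeC subeK//; exact: (integrable_fin_num _ (ig (s + 1) k)).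
have c s' : 0 < s' -> I s' k @[k --> \oo] --> (\int[mu]_(t in pos) (gamma_density s' t)%:E)%E.
  move=> s'0; apply: cvg_integral_compact_itv; first exact: measurable_gamma_density.
  by move=> t _; rewrite lee_fin gamma_density_ge0.
have c1 : (I (s + 1)%R k + (F k.+1%:R - F k.+1%:R^-1)%R%:E)%E @[k --> \oo] -->
    (\int[mu]_(t in pos) (gamma_density (s + 1)%R t)%:E + 0)%E.
  apply: cvgeD; [exact: fin_num_adde_defl|exact: c|].
  by apply: cvg_EFin; [exact: nearW|exact: powR_expRN_cvg_compact].
have c2 : (s%:E * I s k)%E @[k --> \oo] --> (s%:E * \int[mu]_(t in pos) (gamma_density s t)%:E)%E.
  by apply: cvgeZl => //; exact: c.
have ee : (fun k => I (s + 1)%R k + (F k.+1%:R - F k.+1%:R^-1)%R%:E)%E = (fun k => s%:E * I s k)%E.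
  by apply/funext => k; exact: e.
by move: c1; rewrite ee => c1; rewrite -[LHS]adde0; exact: cvg_unique c1 c2.
Qed.

End GammaFunction.

(** * Power series of the modified Bessel functions *)
Section Bessel.
Context {R : realType}.
Implicit Types (nu z x : R).

Definition phi_coef nu k : R := (k`!%:R * Gamma (k%:R + nu + 1))^-1.

(** The entire function such that [I_nu z = (z / 2) `^ nu * phi nu (z ^ 2 / 4)]
    ([besselIE]), that is, the hypergeometric function 0F1 divided by
    [Gamma (nu + 1)]. *)
Definition phi nu x : R := limn (pseries (phi_coef nu) x).

Lemma Gamma_shift_gt0 nu k : -1 < nu -> 0 < Gamma (k%:R + nu + 1).
Proof. by move=> n1; apply: Gamma_gt0; have := ler0n R k; lra. Qed.

Lemma phi_coef_gt0 nu k : -1 < nu -> 0 < phi_coef nu k.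
Proof. by move=> n1; rewrite invr_gt0 mulr_gt0 ?Gamma_shift_gt0// ltr0n fact_gt0. Qed.

Lemma phi_coefS nu k : -1 < nu ->
  phi_coef nu k = k.+1%:R * (k%:R + nu + 1) * phi_coef nu k.+1.
Proof.
move=> n1; rewrite /phi_coef.
have -> : k.+1%:R + nu + 1 = (k%:R + nu + 1) + 1 :> R by rewrite -natr1; ring.
have k0 := ler0n R k; have p0 : 0 < k%:R + nu + 1 by lra.
rewrite (GammaS p0) factS natrM.
have g0 := Gamma_shift_gt0 k n1.
have f0 : (k`!%:R : R) != 0 by rewrite pnatr_eq0 -lt0n fact_gt0.
have s0 : (k.+1%:R : R) != 0 by rewrite pnatr_eq0.
move: f0 s0 p0 g0; move: (k`!%:R) (k.+1%:R) (k%:R + nu + 1) (Gamma _) => a b c g a0 b0 c0 g0.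
by field; rewrite a0 b0 !gt_eqF.
Qed.

Lemma phi_coef_diffs nu : pseries_diffs (phi_coef nu) = phi_coef (nu + 1).
Proof.
apply/funext => k; rewrite /pseries_diffs /phi_coef factS natrM.
have -> : k.+1%:R + nu + 1 = k%:R + (nu + 1) + 1 :> R by rewrite -natr1; ring.
have s0 : (k.+1%:R : R) != 0 by rewrite pnatr_eq0.
by rewrite !invfM !mulrA mulfV// mul1r.
Qed.

(** Since [nu + 1 <= k + nu + 1], the recurrence [phi_coefS] dominates the
    coefficients by a multiple of those of [expR (x / (nu + 1))]. *)
Lemma cvg_phi nu x : -1 < nu -> cvgn (pseries (phi_coef nu) x).
Proof.
move=> n1; pose m := nu + 1; have m0 : 0 < m by rewrite /m; lra.
have le k : phi_coef nu k <= phi_coef nu 0 * (m^-1 ^+ k / k`!%:R).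
  elim: k => [|k IH]; first by rewrite expr0 fact0 divr1 mulr1.
  have e := phi_coefS k n1; have k0 := ler0n R k.
  have p0 : 0 < k%:R + nu + 1 by rewrite -addrA ltr_wpDl.
  have s0 : (0 : R) < k.+1%:R by rewrite ltr0n.
  have -> : phi_coef nu k.+1 = (k.+1%:R * (k%:R + nu + 1))^-1 * phi_coef nu k.
    by rewrite e mulrA mulVf ?mul1r// gt_eqF// mulr_gt0.
  apply: (@le_trans _ _ ((k.+1%:R * m)^-1 * phi_coef nu k)).
    apply: ler_wpM2r; first exact: ltW (phi_coef_gt0 _ n1).
    rewrite lef_pV2 ?posrE ?mulr_gt0//.
    by apply: ler_wpM2l; [exact: ltW|rewrite -addrA lerDr].
  apply: le_trans (ler_wpM2l _ IH) _; first by rewrite invr_ge0 mulr_ge0 ?ltW.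
  rewrite factS natrM exprS.
  have f0 : (k`!%:R : R) != 0 by rewrite pnatr_eq0 -lt0n fact_gt0.
  rewrite le_eqVlt; apply/orP; left; apply/eqP.
  move: f0 s0; move: (k`!%:R) (k.+1%:R) => a b a0 b0.
  by rewrite !invfM; move: (a^-1) (b^-1) (m^-1) (_ ^+ k) => A B M E; ring.
apply: normed_cvg.
apply: (@series_le_cvg _ _ (fun k => phi_coef nu 0 * exp_coeff (`|x| / m) k)).
- by move=> k; exact: normr_ge0.
- move=> k; apply: mulr_ge0; first exact: ltW (phi_coef_gt0 _ n1).
  by rewrite /exp_coeff/= divr_ge0 ?exprn_ge0 ?divr_ge0 ?(ltW m0).
- move=> k /=; rewrite normrM normrX (gtr0_norm (phi_coef_gt0 k n1)).
  apply: le_trans (ler_wpM2r _ (le k)) _; first by rewrite exprn_ge0.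
  rewrite /exp_coeff/= expr_div_n exprVn.
  by rewrite le_eqVlt; apply/orP; left; apply/eqP; ring.
have -> : (fun k => phi_coef nu 0 * exp_coeff (`|x| / m) k) = phi_coef nu 0 *: exp_coeff (`|x| / m) by [].
by apply: is_cvg_seriesZ; exact: is_cvg_series_exp_coeff.
Qed.

Lemma is_derive_phi nu x : -1 < nu -> is_derive x 1 (phi nu) (phi (nu + 1) x).
Proof.
move=> n1; rewrite /phi -phi_coef_diffs.
have n2 : -1 < nu + 1 by lra.
have n3 : -1 < nu + 1 + 1 by lra.
apply: (@pseries_snd_diffs _ _ (`|x| + 1)).
- exact: cvg_phi.
- by rewrite phi_coef_diffs; exact: cvg_phi.
- by rewrite !phi_coef_diffs; exact: cvg_phi.
- by rewrite [ltRHS]ger0_norm ?ltrDl// addr_ge0.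
Qed.

Lemma lim_seriesMl (a : R) (u : R^nat) : cvgn (series u) ->
  limn (series (fun k => a * u k)) = a * limn (series u).
Proof.
move=> cu; have -> : (fun k => a * u k) = a *: u by [].
exact: lim_seriesZ.
Qed.

Lemma besselIE nu z : -1 < nu -> 0 < z ->
  besselI nu z = (z / 2) `^ nu * phi nu (z ^+ 2 / 4).
Proof.
move=> n1 z0; rewrite /besselI /phi -lim_seriesMl; last exact: cvg_phi.
have z2 : 0 < z / 2 by lra.
congr (limn (series _)); apply/funext => k.
rewrite powRD; last by rewrite (gt_eqF z2) implybT.
have -> : 2 * k%:R = (2 * k)%:R :> R by rewrite natrM.
rewrite powR_mulrn ?(ltW z2)// exprM.
have -> : (z / 2) ^+ 2 = z ^+ 2 / 4 by field.
by rewrite /phi_coef [X in X / _]mulrC -mulrA [X in _ = _ * X]mulrC.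
Qed.

Lemma phi_coef_shift nu k : phi_coef (nu + 1) k = k.+1%:R * phi_coef nu k.+1.
Proof. by rewrite -phi_coef_diffs. Qed.

Lemma phi_coef_rec nu k : -1 < nu ->
  phi_coef nu k.+1 = phi_coef (nu + 2) k + (nu + 1) * phi_coef (nu + 1) k.+1.
Proof.
move=> n1; have -> : nu + 2 = nu + 1 + 1 by ring.
rewrite !phi_coef_shift (phi_coefS k.+1 n1) -(@natr1 R k.+1) -(@natr1 R k).
by move: (phi_coef _ _) (k%:R) => c x; ring.
Qed.

Lemma phi_coef_rec0 nu : -1 < nu -> phi_coef nu 0 = (nu + 1) * phi_coef (nu + 1) 0.
Proof.
move=> n1; rewrite phi_coef_shift (phi_coefS 0 n1).
by move: (phi_coef _ _) => c; ring.
Qed.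

(** The index shift between the two sides comes from the factor [x]. *)
Lemma pseries_rec (a b c : R^nat) (m x : R) : c 0%N = m * b 0%N ->
  (forall k, c k.+1 = a k + m * b k.+1) ->
  forall k, x * pseries a x k + m * pseries b x k.+1 = pseries c x k.+1.
Proof.
move=> c0 cS k; rewrite /pseries /series/=; elim: k => [|k IH].
  by rewrite !big_nat1 big_geq// c0; ring.
rewrite big_nat_recr//= (big_nat_recr k.+1)//= (big_nat_recr k.+1)//= -IH.
by rewrite cS exprS; ring.
Qed.

(** Bessel's equation: by [is_derive_phi] the shifts of [nu] are derivatives. *)
Lemma phi_rec nu x : -1 < nu ->
  x * phi (nu + 2) x + (nu + 1) * phi (nu + 1) x = phi nu x.
Proof.
move=> n1.
have n2 : -1 < nu + 1 by lra.
have n3 : -1 < nu + 2 by lra.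
have h1 := @cvg_phi _ x n1; have h2 := @cvg_phi _ x n2; have h3 := @cvg_phi _ x n3.
have e k := pseries_rec x (phi_coef_rec0 n1) (fun k => phi_coef_rec k n1) k.
have cs u : cvgn u -> u k.+1 @[k --> \oo] --> (limn u : R).
  by move=> cu; rewrite (cvg_shiftS u).
have c1 := cs _ h1.
have c2 : (x * pseries (phi_coef (nu + 2)) x k +
    (nu + 1) * pseries (phi_coef (nu + 1)) x k.+1) @[k --> \oo] -->
    x * phi (nu + 2) x + (nu + 1) * phi (nu + 1) x.
  apply: cvgD; first exact: (cvgM (cvg_cst x) h3).
  exact: (cvgM (cvg_cst (nu + 1)) (cs _ h2)).
have ee : (fun k => x * pseries (phi_coef (nu + 2)) x k +
    (nu + 1) * pseries (phi_coef (nu + 1)) x k.+1) = (fun k => pseries (phi_coef nu) x k.+1).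
  by apply/funext => k; exact: e.
by move: c2; rewrite ee => c2; exact: cvg_unique c2 c1.
Qed.

End Bessel.

(** * Behaviour of the Bessel functions at infinity *)
Section BesselSymbol.
Context {R : realType}.
Implicit Types (nu z x : R) (f : R -> R).
(* The Bessel functions enter by their differentiation rule and by Bessel's
   equation. *)
Context (phi : R -> R -> R).
Hypothesis is_derive_phi : forall nu x, -1 < nu -> is_derive x 1 (phi nu) (phi (nu + 1) x).
Hypothesis phi_rec : forall nu x, -1 < nu ->
  x * phi (nu + 2) x + (nu + 1) * phi (nu + 1) x = phi nu x.

(** Up to a power of 2 this is [expR (- z) * z `^ - nu * I_nu z], free of the
    exponential growth. *)
Definition psi nu z : R := expR (- z) * phi nu (z ^+ 2 / 4).

Lemma der_psi nu z : -1 < nu -> is_derive z 1 (psi nu) (z / 2 * psi (nu + 1) z - psi nu z).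
Proof.
move=> n1; rewrite /psi.
have d2 : is_derive z 1 (fun x : R => x ^+ 2 / 4) (z / 2).
  have := derM (derM (der_id z) (der_id z)) (der_cst 4^-1 z).
  by move=> H; apply: is_derive_eq H _; field.
have := derM (der_exp (derN (der_id z))) (@der_comp _ (phi nu) (fun x => x ^+ 2 / 4) z _ _ (is_derive_phi (z ^+ 2 / 4) n1) d2).
by move=> H; apply: is_derive_eq H _; ring.
Qed.

(** All the derivatives of [psi nu] stay in this space, hence exist. *)
Inductive psi_span : (R -> R) -> Prop :=
| psi_span_psi nu : -1 < nu -> psi_span (psi nu)
| psi_span_X f : psi_span f -> psi_span (fun z => z * f z)
| psi_span_D f g : psi_span f -> psi_span g -> psi_span (fun z => f z + g z)
| psi_span_Z a f : psi_span f -> psi_span (fun z => a * f z).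

Lemma psi_span_derive f : psi_span f ->
  exists2 g, psi_span g & forall z, is_derive z 1 f (g z).
Proof.
elim=> {f} [nu n1|f sf [g sg dg]|f1 f2 s1 [g1 t1 d1] s2 [g2 t2 d2]|a f sf [g sg dg]].
- exists (fun z => z * (2^-1 * psi (nu + 1) z) + (-1) * psi nu z).
    have n2 : -1 < nu + 1 by lra.
    exact: psi_span_D (psi_span_X (psi_span_Z _ (psi_span_psi n2))) (psi_span_Z _ (psi_span_psi n1)).
  by move=> z; apply: is_derive_eq (der_psi z n1) _; ring.
- exists (fun z => f z + z * g z); first exact: psi_span_D sf (psi_span_X sg).
  by move=> z; apply: is_derive_eq (derM (der_id z) (dg z)) _; ring.
- exists (fun z => g1 z + g2 z); first exact: psi_span_D.
  by move=> z; exact: derD.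
- exists (fun z => a * g z); first exact: psi_span_Z.
  by move=> z; exact: der_cM.
Qed.

Definition psiD nu l : R -> R := derive1n l (psi nu).

Lemma der_psiD nu l z : -1 < nu -> is_derive z 1 (psiD nu l) (psiD nu l.+1 z).
Proof.
move=> n1; have : psi_span (psiD nu l).
  elim: l => [|l IH]; first exact: psi_span_psi.
  have [g sg dg] := psi_span_derive IH.
  rewrite /psiD derive1nS (_ : derive1 _ = g)//.
  by apply/funext => x; rewrite derive1E; have [_ ->] := dg x.
move=> /psi_span_derive [g _ dg]; have [h _] := dg z.
by rewrite /psiD derive1nS derive1E; exact: DeriveDef.
Qed.

(** Bessel's equation for [psi nu], differentiated [l] times. *)
Lemma psiD_ode nu l z : -1 < nu ->
  z * psiD nu l.+2 z + (2 * z + 2 * nu + 1 + l%:R) * psiD nu l.+1 z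
    + (2 * l%:R + 2 * nu + 1) * psiD nu l z = 0.
Proof.
move=> n1; elim: l z => [|l IH] z.
  have n2 : -1 < nu + 1 by lra.
  have e1 x : psiD nu 1 x = x / 2 * psi (nu + 1) x - psi nu x.
    exact: der_uniq (der_psiD 0 x n1) (der_psi x n1).
  have d1 := derB (derM (derM (der_id z) (der_cst 2^-1 z)) (der_psi z n2)) (der_psi z n1).
  have e2 := der_uniq (der_psiD 1 z n1).
  have e1f : psiD nu 1 = (fun x => x / 2 * psi (nu + 1) x - psi nu x) by apply/funext.
  rewrite e1f in e2; have -> := e2 _ d1.
  rewrite e1 -[psiD nu 0 z]/(psi nu z) /psi.
  have -> : nu + 1 + 1 = nu + 2 by ring.
  rewrite -(phi_rec (z ^+ 2 / 4) n1).
  move: (expR _) (phi (nu + 1) _) (phi (nu + 2) _) => e a b.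
  by field.
have d := derD (derD (derM (der_id z) (der_psiD l.+2 z n1))
   (derM (derD (derD (derD (der_cM 2 (der_id z)) (der_cst (2 * nu) z)) (der_cst 1 z)) (der_cst l%:R z))
      (der_psiD l.+1 z n1))) (der_cM (2 * l%:R + 2 * nu + 1) (der_psiD l z n1)).
have := der_uniq d; rewrite (_ : (fun x => _) = cst 0); last first.
  by apply/funext => x; rewrite IH.
move=> H; have {H} := H _ (der_cst 0 z) => <-.
rewrite -(@natr1 R l).
by move: (psiD _ _ _) (psiD _ _ _) (psiD _ _ _) (l%:R) => a b c m; ring.
Qed.

Lemma nonincreasing_after1 (f df : R -> R) :
  (forall z, 0 < z -> is_derive z 1 f (df z)) -> (forall z, 1 <= z -> df z <= 0) ->
  forall z, 1 <= z -> f z <= f 1.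
Proof.
move=> dF d0 z z1.
have [] := @MVT_segment R f df 1 z z1.
- by move=> x; rewrite in_itv/= => /andP[x1 _]; apply: dF; exact: lt_trans x1.
- apply: continuous_in_subspaceT => x; rewrite inE/= in_itv/= => /andP[x1 _].
  by apply: is_derive_continuous (dF x _); exact: lt_le_trans x1.
move=> c; rewrite in_itv/= => /andP[c1 _] e.
by rewrite -subr_le0 e mulr_le0_ge0 ?subr_ge0// d0.
Qed.

(** With [u z = z `^ a * psi nu z], [a = nu + 1/2], the equation reads
    [u'' + 2 u' = (nu ^ 2 - 1/4) u / z ^ 2], a perturbation of [u'' + 2 u' = 0]
    whose coefficient is integrable at infinity: the energy
    [(u + u' / 2) ^ 2 + u' ^ 2] stays bounded.  In the proof [u' = z `^ a * v]
    and [u + u' / 2 = z `^ a * P], so that the energy is [E]. *)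
Lemma psi_bounded nu : -1 < nu -> exists2 C, 0 < C &
  forall z, 1 <= z -> `|psi nu z| <= C * z `^ (- (nu + 2^-1)).
Proof.
move=> n1; pose a := nu + 2^-1; pose k := a ^+ 2 - a; pose M := 4 * `|k|.
pose v z := psiD nu 1 z + a / z * psi nu z.
pose P z := psi nu z + v z / 2.
pose E z := (z `^ a) ^+ 2 * (P z ^+ 2 + v z ^+ 2).
(* [E' <= M / z ^ 2 * E], and [- M / z ^ 2] is the derivative of [M / z]. *)
pose g z := expR (M / z) * E z.
have dinv z : 0 < z -> is_derive z 1 (fun x : R => x^-1) (- (1 / z ^+ 2)).
  by move=> z0; apply: derV (der_id z); rewrite gt_eqF.
have dv z : 0 < z -> is_derive z 1 v (- 2 * v z - a / z * v z + k * psi nu z / z ^+ 2).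
  move=> z0; have d := derD (der_psiD 1 z n1) (derM (der_cM a (dinv z z0)) (der_psiD 0 z n1)).
  apply: is_derive_eq d _; rewrite -[psiD nu 0]/(psi nu) /v /k.
  have := psiD_ode 0 z n1; rewrite -[psiD nu 0]/(psi nu) mulr0n.
  have -> : nu = a - 2^-1 by rewrite /a; ring.
  move: (psiD _ 2 z) (psiD _ 1 z) (psi _ z) => p2 p1 p0 H.
  have -> : p2 = - ((2 * z + 2 * a) * p1 + 2 * a * p0) / z.
    apply: (mulIf (lt0r_neq0 z0)); rewrite divfK ?gt_eqF//.
    by move: H => /eqP; rewrite -addrA addr_eq0 mulrC => /eqP ->; field.
  by field; rewrite gt_eqF.
have dpsi z : 0 < z -> is_derive z 1 (psi nu) (v z - a / z * psi nu z).
  by move=> z0; apply: is_derive_eq (der_psiD 0 z n1) _; rewrite /v addrK.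
have dP z : 0 < z -> is_derive z 1 P (- (a / z) * P z + k * psi nu z / (2 * z ^+ 2)).
  move=> z0; have d := derD (dpsi z z0) (derM (dv z z0) (der_cst 2^-1 z)).
  by apply: is_derive_eq d _; rewrite /P; field; rewrite gt_eqF.
have dE z : 0 < z -> is_derive z 1 E ((z `^ a) ^+ 2 *
    (k * P z * psi nu z / z ^+ 2 - 4 * v z ^+ 2 + 2 * k * v z * psi nu z / z ^+ 2)).
  move=> z0; have dp := der_powR a z0 (der_id z).
  have d := derM (derM dp dp) (derD (derM (dP z z0) (dP z z0)) (derM (dv z z0) (dv z z0))).
  by apply: is_derive_eq d _; rewrite /=; field; rewrite gt_eqF.
have dg z : 0 < z -> is_derive z 1 g (expR (M / z) * (z `^ a) ^+ 2 *
    (k * P z * psi nu z / z ^+ 2 - 4 * v z ^+ 2 + 2 * k * v z * psi nu z / z ^+ 2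
     - M / z ^+ 2 * (P z ^+ 2 + v z ^+ 2))).
  move=> z0; have d := derM (der_exp (der_cM M (dinv z z0))) (dE z z0).
  by apply: is_derive_eq d _; rewrite /E; field; rewrite gt_eqF.
have g_le z : 1 <= z -> g z <= g 1.
  apply: nonincreasing_after1 dg _ _ => {}z z1.
  have z0 : 0 < z by exact: lt_le_trans z1.
  apply: mulr_ge0_le0; first by rewrite mulr_ge0 ?expR_ge0// sqr_ge0.
  have -> : psi nu z = P z - v z / 2 by rewrite /P addrK.
  move: (P z) (v z) => p w; have i0 : 0 <= (z ^+ 2)^-1 by rewrite invr_ge0 sqr_ge0.
  have kM : k * p * (p - w / 2) + 2 * k * w * (p - w / 2) <= M * (p ^+ 2 + w ^+ 2).
    rewrite /M; have := ler_norm k; have := ler_norm (- k); rewrite normrN.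
    move: `|k| => K h1 h2.
    have -> : k * p * (p - w / 2) + 2 * k * w * (p - w / 2) =
      k * (p ^+ 2 + 3 / 2 * (p * w) - w ^+ 2) by field.
    have hq : p ^+ 2 + 3 / 2 * (p * w) - w ^+ 2 <= 4 * (p ^+ 2 + w ^+ 2).
      by have := sqr_ge0 (p - w); nra.
    have hq' : - (p ^+ 2 + 3 / 2 * (p * w) - w ^+ 2) <= 4 * (p ^+ 2 + w ^+ 2).
      by have := sqr_ge0 (p + w); nra.
    have hp : 0 <= p ^+ 2 + w ^+ 2 by rewrite addr_ge0 ?sqr_ge0.
    move: hq hq' hp; move: (p ^+ 2 + 3 / 2 * (p * w) - w ^+ 2) (p ^+ 2 + w ^+ 2) => q s h3 h4 h5.
    by nra.
  have := ler_wpM2r i0 kM; have := sqr_ge0 w; move: ((z ^+ 2)^-1) i0 => i i0 h1 h2.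
  by nra.
have gE z : 0 < z -> E z <= g z.
  move=> z0; rewrite ler_peMl//; first by rewrite mulr_ge0 ?addr_ge0 ?sqr_ge0.
  by rewrite -expR0 ler_expR divr_ge0 ?mulr_ge0 ?(ltW z0).
have g1 : 0 <= g 1 by apply: le_trans (gE 1 ltr01); rewrite mulr_ge0 ?addr_ge0 ?sqr_ge0.
exists (2 * g 1 + 1); first by lra.
move=> z z1; have z0 : 0 < z by exact: lt_le_trans z1.
rewrite powRN ler_pdivlMr ?powR_gt0// -/a.
have le1 : E z <= g 1 by apply: le_trans (gE z z0) (g_le z z1).
have p0 := powR_ge0 z a.
rewrite -[z `^ a]ger0_norm// -normrM.
have -> : psi nu z = P z - v z / 2 by rewrite /P addrK.
move: le1; rewrite /E; move: (P z) (v z) (z `^ a) (g 1) g1 p0 => p w y G G0 y0 H.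
have : ((p - w / 2) * y) ^+ 2 <= 2 * G.
  have h : (p - w / 2) ^+ 2 <= 2 * (p ^+ 2 + w ^+ 2).
    by have := sqr_ge0 (p + w / 2); have := sqr_ge0 w; nra.
  rewrite exprMn; have := ler_wpM2r (sqr_ge0 y) h; lra.
move: ((p - w / 2) * y) => q hq.
rewrite -ler_sqr ?nnegrE//; last by lra.
by rewrite real_normK ?num_real//; nra.
Qed.

Lemma powR_equiv (K e x y : R) : 0 < x -> 0 < y -> 1 <= K -> x <= K * y -> y <= K * x ->
  x `^ e <= K `^ `|e| * y `^ e.
Proof.
move=> x0 y0 K1 xy yx; have K0 : 0 < K by lra.
have := (ltW x0, ltW y0, ltW K0) => -[[x' y'] K'].
have [e0|e0] := leP 0 e.
  by rewrite (ger0_norm e0) -powRM// ge0_ler_powR ?nnegrE ?mulr_ge0.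
have a0 := powR_gt0 e x0; have b0 := powR_gt0 e y0.
have : y `^ (- e) <= (K * x) `^ (- e).
  by rewrite ge0_ler_powR ?nnegrE ?mulr_ge0 ?oppr_ge0 ?(ltW e0).
rewrite (ltr0_norm e0) powRM// (powRN y e) (powRN x e).
by rewrite ler_pdivlMr// mulrC ler_pdivrMr.
Qed.

(** The derivative of [F z = expR (2 z) * z `^ b * v z] is of size
    [expR (2 z) * z `^ (b - p)], hence dominated by that of
    [G z = expR (2 z) * (z + m) `^ (b - p)].  The shift by [m = |b - p|] keeps
    the derivative of [G] above [expR (2 z) * (z + m) `^ (b - p)] on the whole of
    [1 <= z]. *)
Lemma decay_ode (v dv : R -> R) (b p K : R) : 0 <= K ->
  (forall z, 0 < z -> is_derive z 1 v (dv z)) ->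
  (forall z, 1 <= z -> `|dv z + (2 + b / z) * v z| <= K * z `^ (- p)) ->
  exists2 C, 0 < C & forall z, 1 <= z -> `|v z| <= C * z `^ (- p).
Proof.
move=> K0 dV hK; pose q := b - p; pose m : R := `|q|.
have m0 : 0 <= m by exact: normr_ge0.
pose Q := (1 + m) `^ `|q|.
have Q1 : 1 <= Q by rewrite powR_ge1// lerDl.
pose F z := expR (2 * z) * z `^ b * v z.
pose G z := expR (2 * z) * (z + m) `^ q.
have dF z : 0 < z -> is_derive z 1 F (expR (2 * z) * z `^ b * (dv z + (2 + b / z) * v z)).
  move=> z0; have d := derM (derM (der_exp (der_cM 2 (der_id z))) (der_powR b z0 (der_id z))) (dV z z0).
  by apply: is_derive_eq d _; field; rewrite gt_eqF.
have dG z : 0 < z -> is_derive z 1 G (expR (2 * z) * (z + m) `^ q * (2 + q / (z + m))).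
  move=> z0; have zm : 0 < z + m by lra.
  have d := derM (der_exp (der_cM 2 (der_id z))) (@der_powR _ (fun x => x + m) q z _ zm (derD (der_id z) (der_cst m z))).
  by apply: is_derive_eq d _; field; rewrite gt_eqF.
have key (s : R) : `|s| = 1 -> forall z, 1 <= z -> s * F z - K * Q * G z <= s * F 1 - K * Q * G 1.
  move=> s1; pose dH z := s * (expR (2 * z) * z `^ b * (dv z + (2 + b / z) * v z))
    - K * Q * (expR (2 * z) * (z + m) `^ q * (2 + q / (z + m))).
  apply: (@nonincreasing_after1 (fun z => s * F z - K * Q * G z) dH).
    by move=> z z0; apply: derB; apply: der_cM; [exact: dF|exact: dG].
  move=> z z1; have z0 : 0 < z by lra.
  have e0 := expR_gt0 (2 * z).
  rewrite subr_le0; apply: (@le_trans _ _ (expR (2 * z) * z `^ b * (K * z `^ (- p)))).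
    rewrite mulrCA ler_wpM2l ?mulr_ge0 ?powR_ge0 ?(ltW e0)//.
    apply: le_trans (ler_norm _) _; rewrite normrM s1 mul1r; exact: hK.
  have -> : expR (2 * z) * z `^ b * (K * z `^ (- p)) = K * (expR (2 * z) * z `^ q).
    by rewrite powRD ?(gt_eqF z0) ?implybT//; ring.
  rewrite -mulrA ler_wpM2l//.
  apply: (@le_trans _ _ (Q * (expR (2 * z) * (z + m) `^ q))).
    rewrite mulrCA ler_wpM2l ?(ltW e0)//.
    by apply: powR_equiv => //; nra.
  rewrite ler_wpM2l ?(le_trans ler01)// ler_peMr ?mulr_ge0 ?powR_ge0 ?(ltW e0)//.
  have : `|q / (z + m)| <= 1.
    rewrite normrM normfV (ger0_norm (_ : 0 <= z + m)); last by lra.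
    by rewrite ler_pdivrMr ?mul1r -/m; lra.
  by rewrite ler_norml => /andP[h _]; lra.
have [D D0 hD] := @powR_expR_bounded R `|q| 2 (normr_ge0 _) ltac:(lra).
have G1 : 0 <= G 1 by rewrite mulr_ge0 ?expR_ge0 ?powR_ge0.
have Kq : 0 <= K * Q by rewrite mulr_ge0// (le_trans ler01).
exists (`|F 1| * D + K * Q * Q + 1).
  have : 0 <= `|F 1| * D by rewrite mulr_ge0 ?(ltW D0).
  have : 0 <= K * Q * Q by rewrite mulr_ge0// (le_trans ler01).
  by lra.
move=> z z1; have z0 : 0 < z by lra.
have e0 := expR_gt0 (2 * z); have b0 := powR_gt0 b z0.
have FG : `|F z| <= `|F 1| + K * Q * G z.
  have f1 := key 1 (normr1 _) z z1; have f2 := key (-1) (normrN1 _) z z1.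
  have := mulr_ge0 Kq G1.
  have := ler_norm (F 1); have := ler_norm (- F 1); rewrite normrN => h1 h2 h3.
  by rewrite ler_norml; apply/andP; split; lra.
have GQ : G z <= Q * (expR (2 * z) * z `^ q).
  rewrite /G mulrCA ler_wpM2l ?(ltW e0)//.
  by apply: powR_equiv => //; nra.
have F1D : 1 <= D * (expR (2 * z) * z `^ q).
  have zq : 1 <= (1 + z) `^ `|q| * z `^ q.
    rewrite -(opprK q) powRN normrN ler_pdivlMr ?powR_gt0// mul1r.
    apply: (@le_trans _ _ (z `^ `|(- q)|)); first by rewrite ler_powR ?ler_norm.
    by rewrite ge0_ler_powR ?nnegrE//; lra.
  apply: le_trans zq _; rewrite mulrA ler_wpM2r ?powR_ge0//.
  by have := hD z (ltW z0); rewrite expRN ler_pdivrMr.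
have zp : z `^ (- p) = z `^ q / z `^ b.
  by rewrite -powRB ?(gt_eqF z0) ?implybT//; congr (_ `^ _); rewrite /q; ring.
have -> : `|v z| = `|F z| / (expR (2 * z) * z `^ b).
  rewrite normrM ger0_norm ?mulr_ge0 ?(ltW e0) ?(ltW b0)// mulrAC mulfV ?mul1r//.
  by rewrite gt_eqF// mulr_gt0.
rewrite ler_pdivrMr ?mulr_gt0// zp.
have -> : (`|F 1| * D + K * Q * Q + 1) * (z `^ q / z `^ b) * (expR (2 * z) * z `^ b) =
   (`|F 1| * D + K * Q * Q + 1) * (expR (2 * z) * z `^ q) by field; rewrite gt_eqF.
apply: le_trans FG _.
have W0 : 0 <= expR (2 * z) * z `^ q by rewrite mulr_ge0 ?powR_ge0 ?(ltW e0).
move: F1D GQ W0; move: (expR (2 * z) * z `^ q) (G z) (`|F 1|) (normr_ge0 (F 1)) => W g f f0 h1 h2 W0.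
have h3 := ler_wpM2l Kq h2; have h4 := ler_wpM2l f0 h1; lra.
Qed.

Lemma continuous_bounded01 (f : R -> R) : (forall z, {for z, continuous f}) ->
  exists2 C, 0 < C & forall z, 0 <= z <= 1 -> `|f z| <= C.
Proof.
move=> cf.
have cn : {within `[0, 1], continuous (fun z => `|f z|)}.
  apply: continuous_in_subspaceT => x _.
  by apply: continuous_comp; [exact: cf|exact: norm_continuous].
have [c _ hc] := EVT_max ler01 cn.
exists (`|f c| + 1); first by rewrite ltr_wpDl.
by move=> z z01; apply: le_trans (hc z _) _; rewrite ?in_itv// lerDl.
Qed.

(** [psiD_ode] is a first-order equation for the derivative of order [l + 1],
    whose right-hand side is the derivative of order [l] divided by [z]: each
    derivative gains a factor [z^-1]. *)
Lemma psiD_decay nu l : -1 < nu -> exists2 C, 0 < C &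
  forall z, 1 <= z -> `|psiD nu l z| <= C * z `^ (- (nu + 2^-1 + l%:R)).
Proof.
move=> n1; elim: l => [|l [C C0 hC]]; first by rewrite addr0; exact: psi_bounded.
pose A := `|2 * l%:R + 2 * nu + 1|.
apply: (@decay_ode _ (psiD nu l.+2) (2 * nu + 1 + l%:R) _ (A * C)).
- by rewrite mulr_ge0 ?normr_ge0 ?(ltW C0).
- by move=> z _; exact: der_psiD.
move=> z z1; have z0 : 0 < z by lra.
have e := psiD_ode l z n1.
have -> : psiD nu l.+2 z + (2 + (2 * nu + 1 + l%:R) / z) * psiD nu l.+1 z =
   - ((2 * l%:R + 2 * nu + 1) * psiD nu l z) / z.
  apply: (mulIf (lt0r_neq0 z0)); rewrite divfK ?gt_eqF//.
  move: e; move: (psiD _ _ _) (psiD _ _ _) (psiD _ _ _) (l%:R) => a b c m e.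
  apply/eqP; rewrite -subr_eq0 -e; apply/eqP; field; rewrite gt_eqF//.
rewrite mulNr normrN normrM normrM -/A normfV (gtr0_norm z0).
have -> : - (nu + 2^-1 + l.+1%:R) = - (nu + 2^-1 + l%:R) - 1 :> R by rewrite -natr1; ring.
rewrite powRB ?(gt_eqF z0) ?implybT// powRr1 ?(ltW z0)// mulrA ler_wpM2r ?invr_ge0 ?(ltW z0)//.
by rewrite -mulrA ler_wpM2l ?hC// /A normr_ge0.
Qed.

(** That these functions are bounded says that each derivative of [psi nu] gains
    a factor [(1 + z)^-1]. *)
Definition beta nu l z : R := (1 + z) `^ (l%:R + nu + 2^-1) * psiD nu l z.

Lemma beta_bounded nu l : -1 < nu -> exists2 C, 0 < C & forall z, 0 <= z -> `|beta nu l z| <= C.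
Proof.
move=> n1; have [C C0 hC] := psiD_decay l n1; set e := l%:R + nu + 2^-1.
have [B B0 hB] : exists2 C, 0 < C & forall z, 0 <= z <= 1 -> `|psiD nu l z| <= C.
  by apply: continuous_bounded01 => z; exact: is_derive_continuous (der_psiD l z n1).
have Q0 : 0 < 2 `^ `|e| :> R by rewrite powR_gt0.
exists (2 `^ `|e| * (B + C)); first by rewrite mulr_gt0 ?addr_gt0.
move=> z z0; rewrite /beta normrM ger0_norm ?powR_ge0// -/e.
have [z1|z1] := leP 1 z; last first.
  have h : (1 + z) `^ e <= 2 `^ `|e|.
    have e1 : 1 `^ e = 1 :> R by rewrite powR1.
    by apply: le_trans (@powR_equiv 2 e (1 + z) 1 _ _ _ _ _) _; rewrite ?e1 ?mulr1//; lra.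
  apply: ler_pM => //; rewrite ?powR_ge0//.
  by apply: le_trans (hB z _) _; [rewrite z0 ltW|rewrite lerDl ltW].
have zz : 0 < z by lra.
have h : (1 + z) `^ e <= 2 `^ `|e| * z `^ e by apply: powR_equiv; lra.
have h2 := hC z z1; apply: (@le_trans _ _ (2 `^ `|e| * z `^ e * (C * z `^ (- e)))).
  by apply: ler_pM; rewrite ?powR_ge0//; apply: le_trans h2 _; rewrite /e [l%:R + _]addrC addrAC.
rewrite -mulrA ler_wpM2l ?(ltW Q0)// powRN mulrCA mulfV ?gt_eqF ?powR_gt0// mulr1.
by rewrite lerDr ltW.
Qed.

Lemma der_beta nu l z : -1 < nu -> 0 <= z -> is_derive z 1 (beta nu l)
  ((1 + z)^-1 * ((l%:R + nu + 2^-1) * beta nu l z + beta nu l.+1 z)).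
Proof.
move=> n1 z0; have p0 : 0 < 1 + z by lra.
have d := derM (@der_powR _ (fun x => 1 + x) (l%:R + nu + 2^-1) z _ p0 (derD (der_cst 1 z) (der_id z))) (der_psiD l z n1).
apply: is_derive_eq d _; rewrite /beta.
have -> : l.+1%:R + nu + 2^-1 = l%:R + nu + 2^-1 + 1 :> R by rewrite -natr1; ring.
rewrite [X in _ = _ * (_ + X * _)]powRD ?(gt_eqF p0) ?implybT// powRr1 ?(ltW p0)//.
by field; rewrite gt_eqF.
Qed.

End BesselSymbol.

Section BesselSymbolExists.
Context {R : realType}.

(** What the estimates of the kernels use of the Bessel functions.  The functions
    [b nu l] are the [beta nu l] formed with the power series [phi]. *)
Lemma bessel_symbol : exists b : R -> nat -> R -> R,
  [/\ forall (nu : R) l, -1 < nu -> exists2 C, 0 < C & forall z, 0 <= z -> `|b nu l z| <= C,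
      forall (nu : R) l (z : R), -1 < nu -> 0 <= z -> is_derive z 1 (b nu l)
        ((1 + z)^-1 * ((l%:R + nu + 2^-1) * b nu l z + b nu l.+1 z))
    & forall nu z : R, -1 < nu -> 0 < z -> besselI nu z =
        2 `^ (- nu) * z `^ nu * expR z * (1 + z) `^ (- (nu + 2^-1)) * b nu 0 z].
Proof.
exists (beta (@phi R)); split.
- by move=> nu l n1; apply: (beta_bounded (@is_derive_phi R) (@phi_rec R)).
- by move=> nu l z n1 z0; apply: (der_beta (@is_derive_phi R)).
move=> nu z n1 z0; rewrite besselIE// /beta add0r.
have p0 : 0 < (1 + z) `^ (nu + 2^-1) by rewrite powR_gt0//; lra.
have e0 := expR_gt0 z.
rewrite (powRN (1 + z)) /psiD /psi /= expRN powRM ?(ltW z0) ?invr_ge0//.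
have -> : (2^-1 : R) `^ nu = 2 `^ (- nu) by rewrite -powR_inv1// -powRrM mulN1r.
move: (phi _ _) (expR z) ((1 + z) `^ _) (2 `^ _) (z `^ _) e0 p0 => a e p c d e0 p0.
by field; rewrite !gt_eqF.
Qed.

End BesselSymbolExists.

(** * Hyperbolic functions of time *)
Section TimeVariable.
Context {R : realType}.
Implicit Types (t : R).

Definition tanh t : R := (1 - expR (- (2 * t))) / (1 + expR (- (2 * t))).
(** This is [1 / sinh (2 * t)] ([csch_sinh]), expressed by the quantity
    [tanh t] in which all the estimates are made. *)
Definition csch t : R := ((tanh t)^-1 - tanh t) / 2.

Lemma expRN2_itv t : 0 < t -> 0 < expR (- (2 * t)) < 1.
Proof. by move=> t0; rewrite expR_gt0 expR_lt1 oppr_lt0 mulr_gt0. Qed.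

Lemma tanh_itv t : 0 < t -> 0 < tanh t < 1.
Proof.
move=> /expRN2_itv; rewrite /tanh; move: (expR _) => q /andP[q0 q1].
by rewrite divr_gt0 ?subr_gt0 ?addr_gt0//= ltr_pdivrMr; lra.
Qed.

Lemma tanh_gt0 t : 0 < t -> 0 < tanh t. Proof. by move=> /tanh_itv/andP[]. Qed.
Lemma tanh_lt1 t : 0 < t -> tanh t < 1. Proof. by move=> /tanh_itv/andP[]. Qed.

Lemma csch_gt0 t : 0 < t -> 0 < csch t.
Proof.
move=> t0; rewrite divr_gt0// subr_gt0.
by apply: (@lt_trans _ _ 1); rewrite ?tanh_lt1// invf_gt1 ?tanh_gt0 ?tanh_lt1.
Qed.

Lemma csch_le t : 0 < t -> csch t <= (2 * tanh t)^-1.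
Proof.
move=> t0; have := tanh_gt0 t0; rewrite /csch.
by move: (tanh t) => T T0; rewrite invfM; move: (T^-1) => u; lra.
Qed.

(** The exponential factor is the source of the decay for large times. *)
Lemma csch_le_expR t : 0 < t -> csch t <= 2 * (expR (- (2 * t)) / tanh t).
Proof.
move=> t0; have := expRN2_itv t0; rewrite /csch /tanh; move: (expR _) => q /andP[q0 q1].
have -> : (((1 - q) / (1 + q))^-1 - (1 - q) / (1 + q)) / 2 = q / ((1 - q) / (1 + q)) * (2 / (1 + q) ^+ 2).
  by field; rewrite !gt_eqF//; lra.
rewrite mulrC ler_wpM2r ?divr_ge0//; try lra.
by rewrite ler_pdivrMr ?exprn_gt0; nra.
Qed.

Lemma csch_sinh t : 0 < t -> (sinh (2 * t))^-1 = csch t.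
Proof.
move=> t0; have e1 := expRxMexpNx_1 (2 * t); have := expRN2_itv t0.
rewrite /sinh /csch /tanh; move: (expR (2 * t)) (expR (- (2 * t))) e1 => p q e1 /andP[q0 q1].
have -> : p = q^-1 by rewrite -[LHS]mulr1 -(mulfV (lt0r_neq0 q0)) mulrA e1 mul1r.
field; rewrite !gt_eqF//; nra.
Qed.

Lemma coth_tanh t : 0 < t -> coth (2 * t) = tanh t + csch t.
Proof.
move=> t0; rewrite /coth (csch_sinh t0) /cosh; have e1 := expRxMexpNx_1 (2 * t); have := expRN2_itv t0.
rewrite /csch /tanh; move: (expR (2 * t)) (expR (- (2 * t))) e1 => p q e1 /andP[q0 q1].
have -> : p = q^-1 by rewrite -[LHS]mulr1 -(mulfV (lt0r_neq0 q0)) mulrA e1 mul1r.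
by field; rewrite !gt_eqF//; nra.
Qed.

Lemma tanh_le t : 0 < t -> tanh t <= 2 * t.
Proof.
move=> t0; have h := expR_ge1Dx (- (2 * t)); have := expRN2_itv t0; rewrite /tanh.
by move: (expR _) h => q h /andP[q0 q1]; rewrite ler_pdivrMr; nra.
Qed.

Lemma tanh_ge t : 0 < t -> t <= (1 + 2 * t) * tanh t.
Proof.
move=> t0; have h := expR_ge1Dx (2 * t); have := expRN2_itv t0; rewrite /tanh.
have := expRxMexpNx_1 (2 * t).
move: (expR (2 * t)) (expR (- (2 * t))) h => p q h e1 /andP[q0 q1].
rewrite mulrA ler_pdivlMr; last by lra.
have : (1 + 2 * t) * q <= 1 by rewrite -[leRHS]e1 ler_wpM2r ?(ltW q0).
by nra.
Qed.

Lemma der_tanh t : 0 < t -> is_derive t 1 tanh (1 - tanh t ^+ 2).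
Proof.
move=> t0; have := expRN2_itv t0 => /andP[q0 q1].
have dq := der_exp (derN (der_cM 2 (der_id t))).
have q2 : 1 + expR (- (2 * t)) != 0 by rewrite gt_eqF//; lra.
have d := derM (derB (der_cst 1 t) dq) (@derV _ (fun x => 1 + expR (- (2 * x))) t _ q2 (derD (der_cst 1 t) dq)).
apply: is_derive_eq d _; rewrite /tanh; move: (expR _) q2 => q q2.
by field.
Qed.

Lemma der_csch t : 0 < t -> is_derive t 1 csch (- (tanh t + (tanh t)^-1) * csch t).
Proof.
move=> t0; have T0 := tanh_gt0 t0; have dT := der_tanh t0.
have d := derM (derB (derV (lt0r_neq0 T0) dT) dT) (der_cst 2^-1 t).
by apply: is_derive_eq d _; rewrite /csch; field; rewrite gt_eqF.
Qed.

End TimeVariable.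

(** * An algebra of functions stable under differentiation *)
Section Symbols.
Context {R : realType} {d : nat} (alpha : 'I_d -> R) (b : R -> nat -> R -> R).
Hypothesis alpha_gt : forall i, -1 < alpha i.
Hypothesis der_b : forall (nu : R) l (z : R), -1 < nu -> 0 <= z -> is_derive z 1 (b nu l)
  ((1 + z)^-1 * ((l%:R + nu + 2^-1) * b nu l z + b nu l.+1 z)).
Implicit Types (t : R) (x y : 'rV[R]_d) (i j : 'I_d) (l : nat).

(** The quantities that occur when the kernel is differentiated, as syntax, so
    that differentiation becomes a computation on terms and the order a function
    of the term.  [SEta] and [SXi] are generators, not products, because
    [csch t * y i] is of order 1 only after multiplication by [rho]; likewise
    [SSqr] is of order 0 although it is the product of [SDiff] with a difference
    of quantities of order 1. *)
Inductive symbol :=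
| SCst of R
| STanh | SCoth
| SCsch
| SX of 'I_d | SY of 'I_d
| SRho of 'I_d | SEta of 'I_d | SXi of 'I_d
| SDiff of 'I_d | SSqr of 'I_d
| SBeta of 'I_d & nat
| SAdd of symbol & symbol
| SMul of symbol & symbol.

(** The argument of the Bessel functions in the kernel. *)
Definition zarg t x y i := csch t * (x 0 i * y 0 i).
Definition rho t x y i := (1 + zarg t x y i)^-1.

Fixpoint eval (e : symbol) t x y : R :=
  match e with
  | SCst c => c
  | STanh => tanh t
  | SCoth => (tanh t)^-1
  | SCsch => csch t
  | SX i => x 0 i
  | SY i => y 0 i
  | SRho i => rho t x y i
  | SEta i => csch t * y 0 i * rho t x y i
  | SXi i => csch t * x 0 i * rho t x y i
  | SDiff i => csch t * (x 0 i - y 0 i)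
  | SSqr i => csch t * (x 0 i - y 0 i) ^+ 2
  | SBeta i l => b (alpha i) l (zarg t x y i)
  | SAdd e f => eval e t x y + eval f t x y
  | SMul e f => eval e t x y * eval f t x y
  end.

(** The number of factors [(sqrt (tanh t))^-1] that the values of [e] may cost,
    see [eval_dominated]. *)
Fixpoint order (e : symbol) : nat :=
  match e with
  | SCst _ | STanh | SRho _ | SSqr _ | SBeta _ _ => 0
  | SX _ | SY _ | SEta _ | SXi _ | SDiff _ => 1
  | SCoth | SCsch => 2
  | SAdd e f => maxn (order e) (order f)
  | SMul e f => order e + order f
  end.

Definition SOpp e := SMul (SCst (-1)) e.
Definition STC := SAdd STanh SCoth.

Variant direction := DT | DX of 'I_d | DY of 'I_d.

Definition dorder (k : direction) : nat := if k is DT then 2 else 1.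

Definition only i j e := if i == j then e else SCst 0.

Definition dbeta i l := SAdd (SMul (SCst (l%:R + alpha i + 2^-1)) (SBeta i l)) (SBeta i l.+1).

Definition dX j (e : symbol) : symbol :=
  match e with
  | SX i => only i j (SCst 1)
  | SRho i => only i j (SOpp (SMul (SRho i) (SEta i)))
  | SEta i => only i j (SOpp (SMul (SEta i) (SEta i)))
  | SXi i => only i j (SMul SCsch (SMul (SRho i) (SRho i)))
  | SDiff i => only i j SCsch
  | SSqr i => only i j (SMul (SCst 2) (SDiff i))
  | SBeta i l => only i j (SMul (SEta i) (dbeta i l))
  | _ => SCst 0
  end.

Definition dY j (e : symbol) : symbol :=
  match e with
  | SY i => only i j (SCst 1)
  | SRho i => only i j (SOpp (SMul (SRho i) (SXi i)))
  | SEta i => only i j (SMul SCsch (SMul (SRho i) (SRho i)))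
  | SXi i => only i j (SOpp (SMul (SXi i) (SXi i)))
  | SDiff i => only i j (SOpp SCsch)
  | SSqr i => only i j (SMul (SCst (-2)) (SDiff i))
  | SBeta i l => only i j (SMul (SXi i) (dbeta i l))
  | _ => SCst 0
  end.

Definition S1Rho i := SAdd (SCst 1) (SOpp (SRho i)).

Definition dT (e : symbol) : symbol :=
  match e with
  | STanh => SAdd (SCst 1) (SOpp (SMul STanh STanh))
  | SCoth => SAdd (SCst 1) (SOpp (SMul SCoth SCoth))
  | SCsch => SOpp (SMul STC SCsch)
  | SRho i => SMul STC (SMul (SRho i) (S1Rho i))
  | SEta i => SOpp (SMul STC (SMul (SEta i) (SRho i)))
  | SXi i => SOpp (SMul STC (SMul (SXi i) (SRho i)))
  | SDiff i => SOpp (SMul STC (SDiff i))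
  | SSqr i => SOpp (SMul STC (SSqr i))
  | SBeta i l => SOpp (SMul STC (SMul (S1Rho i) (dbeta i l)))
  | _ => SCst 0
  end.

Fixpoint partial (k : direction) (e : symbol) : symbol :=
  match e with
  | SAdd e f => SAdd (partial k e) (partial k f)
  | SMul e f => SAdd (SMul (partial k e) f) (SMul e (partial k f))
  | _ => match k with DT => dT e | DX j => dX j e | DY j => dY j e end
  end.

Lemma order_partial k e : (order (partial k e) <= order e + dorder k)%N.
Proof.
elim: e => [c||||i|i|i|i|i|i|i|i l|e IHe f IHf|e IHe f IHf]; last first.
- by rewrite /= geq_max; apply/andP; split; lia.
- by rewrite /= geq_max; apply/andP; split; lia.
all: by case: k => [|j|j] //=; rewrite /only; try case: (i == j).
Qed.

(** The chain rule along a curve whose velocity is [c] in time, [v] in [x] and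
    [w] in [y]; the three kinds of derivatives and the mean value theorem are
    instances. *)
Definition curve_derivative (c : R) (v w : 'I_d -> R) (e : symbol) t x y : R :=
  c * eval (partial DT e) t x y +
  \sum_i (v i * eval (partial (DX i) e) t x y + w i * eval (partial (DY i) e) t x y).

Lemma sum_only v w i e f t x y :
  \sum_j (v j * eval (only i j e) t x y + w j * eval (only i j f) t x y) =
  v i * eval e t x y + w i * eval f t x y :> R.
Proof.
rewrite (bigD1 i)//= big1 ?addr0; last first.
  by move=> j ji; rewrite /only eq_sym (negbTE ji)/= !mulr0 addr0.
by rewrite /only eqxx.
Qed.

Lemma sum_only0 v w i f t x y :
  \sum_j (v j * 0 + w j * eval (only i j f) t x y) = w i * eval f t x y :> R.
Proof.
under eq_bigr do rewrite mulr0 -(mulr0 0).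
have := sum_only (fun=> 0) w i f f t x y; rewrite mul0r add0r => <-.
by apply: eq_bigr => j _; rewrite !mul0r.
Qed.

Lemma sum_only1 v w i f t x y :
  \sum_j (v j * eval (only i j f) t x y + w j * 0) = v i * eval f t x y :> R.
Proof.
have := sum_only v (fun=> 0) i f f t x y; rewrite mul0r addr0 => <-.
by apply: eq_bigr => j _; rewrite mulr0 mul0r.
Qed.

Lemma sum_none (v w : 'I_d -> R) : \sum_j (v j * 0 + w j * 0) = 0.
Proof. by rewrite big1// => j _; rewrite !mulr0 addr0. Qed.

Lemma der_eval (ts : R -> R) (xs ys : R -> 'rV[R]_d) (h c : R) (v w : 'I_d -> R) e :
  0 < ts h -> (forall i, 0 < xs h 0 i) -> (forall i, 0 < ys h 0 i) ->
  is_derive h 1 ts c ->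
  (forall i, is_derive h 1 (fun h => xs h 0 i) (v i)) ->
  (forall i, is_derive h 1 (fun h => ys h 0 i) (w i)) ->
  is_derive h 1 (fun h => eval e (ts h) (xs h) (ys h))
    (curve_derivative c v w e (ts h) (xs h) (ys h)).
Proof.
move=> t0 x0 y0 dt dx dy.
have T0 := tanh_gt0 t0.
have dTh := @der_comp _ tanh ts h _ _ (der_tanh t0) dt.
have dS := @der_comp _ csch ts h _ _ (der_csch t0) dt.
have z0 i : 0 <= zarg (ts h) (xs h) (ys h) i.
  exact: mulr_ge0 (ltW (csch_gt0 t0)) (mulr_ge0 (ltW (x0 i)) (ltW (y0 i))).
have p0 i : 0 < 1 + zarg (ts h) (xs h) (ys h) i by have := z0 i; lra.
have dz i : is_derive h 1 (fun h => zarg (ts h) (xs h) (ys h) i)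
   (- c * (tanh (ts h) + (tanh (ts h))^-1) * zarg (ts h) (xs h) (ys h) i
    + v i * csch (ts h) * ys h 0 i + w i * csch (ts h) * xs h 0 i).
  have D := derM dS (derM (dx i) (dy i)).
  by apply: is_derive_eq D _; rewrite /zarg; ring.
have drho i : is_derive h 1 (fun h => rho (ts h) (xs h) (ys h) i) _ :=
  @derV _ (fun h => 1 + zarg (ts h) (xs h) (ys h) i) h _ (lt0r_neq0 (p0 i)) (derD (der_cst 1 h) (dz i)).
rewrite /curve_derivative.
elim: e => [a||||i|i|i|i|i|i|i|i l|e IHe f IHf|e IHe f IHf] /=.
- by rewrite sum_none mulr0 addr0; exact: der_cst.
- by rewrite sum_none; apply: is_derive_eq dTh _; ring.
- rewrite sum_none; apply: is_derive_eq (@derV _ (fun h => tanh (ts h)) h _ (lt0r_neq0 T0) dTh) _.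
  by field; rewrite gt_eqF.
- by rewrite sum_none; apply: is_derive_eq dS _; ring.
- by rewrite sum_only1/= mulr0 mulr1 add0r; exact: dx.
- by rewrite sum_only0/= mulr0 mulr1 add0r; exact: dy.
- rewrite sum_only; apply: is_derive_eq (drho i) _ => /=.
  rewrite /rho; move: (p0 i); move: (zarg _ _ _ _) => z z1.
  by field; rewrite !gt_eqF.
- rewrite sum_only; apply: is_derive_eq (derM (derM dS (dy i)) (drho i)) _ => /=.
  rewrite /rho; have := p0 i; have : zarg (ts h) (xs h) (ys h) i = csch (ts h) * (xs h 0 i * ys h 0 i) by [].
  move: (zarg _ _ _ _) => z -> z1.
  by field; rewrite !gt_eqF.
- rewrite sum_only; apply: is_derive_eq (derM (derM dS (dx i)) (drho i)) _ => /=.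
  rewrite /rho; have := p0 i; have : zarg (ts h) (xs h) (ys h) i = csch (ts h) * (xs h 0 i * ys h 0 i) by [].
  move: (zarg _ _ _ _) => z -> z1.
  by field; rewrite !gt_eqF.
- rewrite sum_only; apply: is_derive_eq (derM dS (derB (dx i) (dy i))) _ => /=; ring.
- have D := derB (dx i) (dy i).
  rewrite sum_only; apply: is_derive_eq (derM dS (derM D D)) _ => /=; ring.
- rewrite sum_only.
  apply: is_derive_eq (@der_comp _ (b (alpha i) l) _ h _ _ (der_b l (alpha_gt i) (z0 i)) (dz i)) _ => /=.
  rewrite /rho; move: (b _ l _) (b _ l.+1 _) => b0 b1.
  have := p0 i; have e : zarg (ts h) (xs h) (ys h) i = csch (ts h) * (xs h 0 i * ys h 0 i) by [].
  move: e; move: (zarg _ _ _ _) => z -> z1.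
  by field; rewrite !gt_eqF.
- apply: is_derive_eq (derD IHe IHf) _.
  rewrite mulrDr addrACA -big_split/=; congr (_ + _); apply: eq_bigr => j _; ring.
- apply: is_derive_eq (derM IHe IHf) _.
  rewrite mulrDl mulrDr !mulr_suml !mulr_sumr addrACA -big_split/=; congr (_ + _); first by ring.
  by apply: eq_bigr => j _; ring.
Qed.

End Symbols.

(** * Derivatives of the heat kernel *)
Section ProductRule.
Context {R : realType}.

Lemma der_prod (I : Type) (r : seq I) (f : I -> R -> R) (a : I -> R) (h : R) :
  (forall i, is_derive h 1 (f i) (f i h * a i)) ->
  is_derive h 1 (fun x => \prod_(i <- r) f i x) (\prod_(i <- r) f i h * \sum_(i <- r) a i).
Proof.
move=> df; elim: r => [|i r IH].
  rewrite !big_nil mulr0; have -> : (fun x => \prod_(i <- [::]) f i x) = (fun _ : R => 1).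
    by apply/funext => x; rewrite big_nil.
  exact: der_cst.
rewrite !big_cons; have -> : (fun x => \prod_(j <- i :: r) f j x) = (fun x => f i x * \prod_(j <- r) f j x).
  by apply/funext => x; rewrite big_cons.
apply: is_derive_eq (derM (df i) IH) _; ring.
Qed.

(** A directional derivative is a derivative in one variable. *)
Lemma is_derive_line (V : normedModType R) (f : V -> R) (a v : V) (df : R) :
  is_derive (0 : R) 1 (fun h : R => f (a + h *: v)) df -> is_derive a v f df.
Proof.
have e : (fun h : R => h^-1 *: (((fun h : R => f (a + h *: v)) \o shift 0) (h *: (1 : R)) - f (a + (0 : R) *: v)))
       = (fun h : R => h^-1 *: ((f \o shift a) (h *: v) - f a)).
  apply/funext => h /=; rewrite scale0r !addr0; congr (_ *: (f _ - _)).
  by rewrite [h *: (1 : R)]mulr1 addrC.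
move=> [dl dv]; split; first by move: dl; rewrite /derivable e.
by move: dv; rewrite /derive e.
Qed.

End ProductRule.

Section Kernel.
Context {R : realType} {d : nat} (alpha : 'I_d -> R) (b : R -> nat -> R -> R).
Hypothesis alpha_gt : forall i, -1 < alpha i.
Hypothesis der_b : forall (nu : R) l (z : R), -1 < nu -> 0 <= z -> is_derive z 1 (b nu l)
  ((1 + z)^-1 * ((l%:R + nu + 2^-1) * b nu l z + b nu l.+1 z)).
Hypothesis besselI_b : forall nu z : R, -1 < nu -> 0 < z -> besselI nu z =
  2 `^ (- nu) * z `^ nu * expR z * (1 + z) `^ (- (nu + 2^-1)) * b nu 0 z.
Implicit Types (t : R) (x y : 'rV[R]_d) (i j : 'I_d) (l : nat).

Local Notation symbol := (@symbol R d).
Local Notation eval := (eval alpha b).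
Local Notation partial := (partial alpha).

(** One coordinate of the exponent of the kernel once the factor [expR z] of the
    Bessel function has been absorbed, that is
    [- coth (2 t) * (x ^ 2 + y ^ 2) / 2 + x * y / sinh (2 t)]. *)
Definition quad t x y i : R :=
  - (2^-1 * (tanh t * (x 0 i ^+ 2 + y 0 i ^+ 2))) - 2^-1 * (csch t * (x 0 i - y 0 i) ^+ 2).

Definition prefactor1 i t x y : R :=
  csch t `^ (1 + alpha i) * (1 + zarg t x y i) `^ (- (alpha i + 2^-1)) * expR (quad t x y i).

Definition prefactor t x y : R := \prod_i prefactor1 i t x y.

Definition kern (e : symbol) t x y : R := prefactor t x y * eval e t x y.

(** Logarithmic derivatives of [prefactor]. *)
Definition LX j : symbol := SAdd (SMul (SCst (- (alpha j + 2^-1))) (SEta j))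
  (SAdd (SOpp (SMul STanh (SX j))) (SOpp (SDiff j))).

Definition LY j : symbol := SAdd (SMul (SCst (- (alpha j + 2^-1))) (SXi j))
  (SAdd (SOpp (SMul STanh (SY j))) (SDiff j)).

Definition LTi i : symbol :=
  SAdd (SMul (SCst (- (1 + alpha i))) STC)
  (SAdd (SMul (SCst (alpha i + 2^-1)) (SMul STC (S1Rho i)))
  (SAdd (SMul (SCst (- 2^-1)) (SMul (SAdd (SCst 1) (SOpp (SMul STanh STanh)))
                                  (SAdd (SMul (SX i) (SX i)) (SMul (SY i) (SY i)))))
        (SMul (SCst 2^-1) (SMul STC (SSqr i))))).

Definition LT : symbol := \big[@SAdd R d/@SCst R d 0]_i LTi i.

Definition logder (k : @direction d) : symbol :=
  match k with DT => LT | DX j => LX j | DY j => LY j end.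

(** [kern (D k e)] is the derivative of [kern e] in the direction [k]
    ([der_kern]). *)
Definition D (k : @direction d) (e : symbol) : symbol :=
  SAdd (partial k e) (SMul e (logder k)).

Lemma order_D k e : (order (D k e) <= order e + dorder k)%N.
Proof.
have h := order_partial alpha k e; rewrite /= geq_max h/= leq_add2l.
case: k h => [_|j _|j _] //=.
by rewrite /LT; elim/big_ind: _ => //= a c ha hc; rewrite geq_max ha hc.
Qed.

Lemma eval_LT t x y : eval LT t x y = \sum_i eval (LTi i) t x y.
Proof. by rewrite /LT (big_morph (fun e => eval e t x y) (id1 := 0) (op1 := +%R)). Qed.

Section Curve.
Variables (ts : R -> R) (xs ys : R -> 'rV[R]_d) (h c : R) (v w : 'I_d -> R).
Hypotheses (ts0 : 0 < ts h) (xs0 : forall i, 0 < xs h 0 i) (ys0 : forall i, 0 < ys h 0 i).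
Hypotheses (dt : is_derive h 1 ts c)
  (dx : forall i, is_derive h 1 (fun h => xs h 0 i) (v i))
  (dy : forall i, is_derive h 1 (fun h => ys h 0 i) (w i)).

Lemma der_prefactor : is_derive h 1 (fun h => prefactor (ts h) (xs h) (ys h))
  (prefactor (ts h) (xs h) (ys h) *
   (c * eval LT (ts h) (xs h) (ys h) +
    \sum_i (v i * eval (LX i) (ts h) (xs h) (ys h) + w i * eval (LY i) (ts h) (xs h) (ys h)))).
Proof.
rewrite eval_LT mulr_sumr -big_split/=.
apply: (@der_prod _ _ _ (fun i h => prefactor1 i (ts h) (xs h) (ys h))) => i.
have T0 := tanh_gt0 ts0.
have dTh := @der_comp _ tanh ts h _ _ (der_tanh ts0) dt.
have S0 := csch_gt0 ts0.
have dS := @der_comp _ csch ts h _ _ (der_csch ts0) dt.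
have z0 : 0 <= zarg (ts h) (xs h) (ys h) i.
  exact: mulr_ge0 (ltW S0) (mulr_ge0 (ltW (xs0 i)) (ltW (ys0 i))).
have p0 : 0 < 1 + zarg (ts h) (xs h) (ys h) i by lra.
have dz := derD (der_cst 1 h) (derM dS (derM (dx i) (dy i))).
have d1 := @der_powR _ (fun h => csch (ts h)) (1 + alpha i) h _ S0 dS.
have d2 := @der_powR _ (fun h => 1 + zarg (ts h) (xs h) (ys h) i) (- (alpha i + 2^-1)) h _ p0 dz.
have dX2 := derM (dx i) (dx i); have dY2 := derM (dy i) (dy i).
have dB := derB (dx i) (dy i); have dB2 := derM dB dB.
have d3 := der_exp (derB (derN (der_cM 2^-1 (derM dTh (derD dX2 dY2)))) (der_cM 2^-1 (derM dS dB2))).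
apply: is_derive_eq (derM (derM d1 d2) d3) _.
rewrite /prefactor1 /quad /= /rho /zarg !expr2.
move: p0; rewrite /zarg.
move: (csch (ts h)) S0 (tanh (ts h)) T0 (xs h 0 i) (ys h 0 i) (expR _) => s s0 T T0 X Y E p0.
move: (_ `^ (1 + alpha i)) (_ `^ (- _)) => P1 P2.
by field; rewrite !gt_eqF.
Qed.

Lemma der_kern e : is_derive h 1 (fun h => kern e (ts h) (xs h) (ys h))
  (c * kern (D (DT) e) (ts h) (xs h) (ys h) +
   \sum_i (v i * kern (D (DX i) e) (ts h) (xs h) (ys h)
           + w i * kern (D (DY i) e) (ts h) (xs h) (ys h))).
Proof.
have := derM der_prefactor (der_eval alpha_gt der_b e ts0 xs0 ys0 dt dx dy).
move=> H; apply: is_derive_eq H _; rewrite /curve_derivative /kern /=.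
move: (prefactor _ _ _) => P; rewrite mulrDr mulr_sumr [in LHS]mulrDr mulrDl.
rewrite [P * \sum_i _]mulr_sumr mulr_suml addrACA -big_split/=; congr (_ + _); first by ring.
by apply: eq_bigr => i _; ring.
Qed.

End Curve.

Definition heat_symbol : symbol :=
  SMul (SCst (\prod_i 2 `^ (- alpha i))) (\big[@SMul R d/@SCst R d 1]_i SBeta i 0).

Lemma heat_kernel_kern t x y : 0 < t -> orthant x -> orthant y ->
  heat_kernel alpha t x y = kern heat_symbol t x y.
Proof.
move=> t0 x0 y0; rewrite /heat_kernel /kern /= /prefactor.
rewrite (big_morph (fun e => eval e t x y) (id1 := 1) (op1 := *%R))//=.
have en (u : 'rV[R]_d) : enorm u ^+ 2 = \sum_i u 0 i ^+ 2.
  by rewrite sqr_sqrtr// sumr_ge0// => i _; exact: sqr_ge0.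
rewrite !en -big_split/= mulr_sumr expR_sum.
have -> : sinh (2 * t) ^- d = \prod_(i < d) csch t.
  by rewrite prodr_const card_ord -csch_sinh// exprVn.
rewrite -!big_split/=; apply: eq_bigr => i _.
have S0 := csch_gt0 t0; have X0 := x0 i; have Y0 := y0 i.
have P0 : 0 < x 0 i * y 0 i by rewrite mulr_gt0.
rewrite csch_sinh// besselI_b//; last by rewrite mulr_gt0.
rewrite coth_tanh// /prefactor1 /quad /zarg [x 0 i * y 0 i * csch t]mulrC.
rewrite (powRM _ (ltW S0) (ltW P0)) powRD; last by rewrite (gt_eqF S0) implybT.
rewrite powRr1 ?(ltW S0)// [(x 0 i * y 0 i) `^ (- _)]powRN.
have W0 := powR_gt0 (alpha i) P0.
have -> : - (2^-1 * (tanh t * (x 0 i ^+ 2 + y 0 i ^+ 2))) -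
   2^-1 * (csch t * (x 0 i - y 0 i) ^+ 2) =
  - 2^-1 * (tanh t + csch t) * (x 0 i ^+ 2 + y 0 i ^+ 2) + csch t * (x 0 i * y 0 i).
  by field.
rewrite expRD.
move: (expR (- 2^-1 * _ * _)) (expR (csch t * _)) ((1 + _) `^ _) (2 `^ _) (b _ _ _).
move=> E1 E2 A B C; move: (csch t `^ alpha i) ((x 0 i * y 0 i) `^ alpha i) W0 => F G G0.
by field; rewrite gt_eqF.
Qed.

Definition deltaS j (e : symbol) : symbol := SAdd (D (DX j) e) (SMul (SX j) e).

Lemma order_deltaS j e : (order (deltaS j e) <= (order e).+1)%N.
Proof.
rewrite -[order (deltaS j e)]/(maxn (order (D (DX j) e)) (1 + order e)) geq_max add1n leqnn andbT.
by rewrite -addn1; exact: order_D (DX j) e.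
Qed.

(** The points near [x] on the line through [x] in the direction [j] stay in the
    orthant, where [f] is known. *)
Lemma delta_kern j (f : 'rV[R]_d -> R) e t y : 0 < t -> orthant y ->
  (forall x, orthant x -> f x = kern e t x y) ->
  forall x, orthant x -> delta j f x = kern (deltaS j e) t x y.
Proof.
move=> t0 y0 fe x x0; rewrite /delta.
pose u := delta_mx 0 j : 'rV[R]_d.
have coord i h : (x + h *: u) 0 i = x 0 i + h * (i == j)%:R by rewrite !mxE eqxx.
have xl h : `|h| < x 0 j -> orthant (x + h *: u).
  move=> hj i; rewrite coord; have [->|_] := eqVneq i j; last by rewrite mulr0 addr0; exact: x0.
  by rewrite mulr1; move: hj; rewrite ltr_norml => /andP[h1 h2]; lra.
have dl : is_derive (0 : R) 1 (fun h : R => kern e t (x + h *: u) y) (kern (D (DX j) e) t x y).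
  have dx i : is_derive (0 : R) 1 (fun h : R => (x + h *: u) 0 i) (i == j)%:R.
    have -> : (fun h : R => (x + h *: u) 0 i) = (fun h => x 0 i + h * (i == j)%:R).
      by apply/funext => h; rewrite coord.
    apply: is_derive_eq (derD (der_cst _ _) (derM (der_id 0) (der_cst _ 0))) _.
    by rewrite mulr0 addr0 mul1r add0r.
  have x0' i : 0 < (x + (0 : R) *: u) 0 i by rewrite scale0r addr0; exact: x0.
  have := @der_kern (fun=> t) (fun h => x + h *: u) (fun=> y) 0 0 (fun i => (i == j)%:R) (fun=> 0)
     t0 x0' y0 (der_cst t 0) dx (fun i => der_cst (y 0 i) 0) e.
  move=> H; apply: is_derive_eq H _; rewrite mul0r add0r scale0r addr0.
  rewrite (bigD1 j)//= eqxx mul1r mul0r addr0 big1 ?addr0// => i /negbTE ->.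
  by rewrite !mul0r addr0.
have df : is_derive x u f (kern (D (DX j) e) t x y).
  apply: is_derive_line; apply: near_eq_is_derive dl.
  have N := @nbhs0_lt R R (x 0 j) (x0 j).
  by apply: filterS N => h hj; rewrite fe//; exact: xl.
have [_ ->] := df; rewrite fe// /kern /deltaS /=; ring.
Qed.

Definition deltanS (n : 'I_d -> nat) (e : symbol) : symbol :=
  foldr (fun i g => iter (n i) (deltaS i) g) e (enum 'I_d).

Lemma order_deltanS n e : (order (deltanS n e) <= order e + \sum_i n i)%N.
Proof.
rewrite /deltanS -(big_enum _ _ predT)/= .
elim: (enum 'I_d) => [|i s IH] /=; first by rewrite big_nil addn0.
rewrite big_cons addnCA; apply: leq_trans (_ : _ <= n i + order (foldr (fun i g => iter (n i) (deltaS i) g) e s))%N _.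
  elim: (n i) => //= k IHk; apply: leq_trans (order_deltaS _ _) _; rewrite addSn ltnS; exact: IHk.
by rewrite leq_add2l.
Qed.

Lemma deltan_kern n (f : 'rV[R]_d -> R) e t y : 0 < t -> orthant y ->
  (forall x, orthant x -> f x = kern e t x y) ->
  forall x, orthant x -> deltan n f x = kern (deltanS n e) t x y.
Proof.
move=> t0 y0 fe; rewrite /deltan /deltanS; elim: (enum 'I_d) => [|i s IH] //=.
by elim: (n i) => [|k IHk] //= x; exact: (delta_kern i t0 y0 IHk).
Qed.

Lemma is_derive_kern_t e t x y : 0 < t -> orthant x -> orthant y ->
  is_derive t 1 (fun s => kern e s x y) (kern (D (DT) e) t x y).
Proof.
move=> t0 x0 y0.
have := @der_kern id (fun=> x) (fun=> y) t 1 (fun=> 0) (fun=> 0) t0 x0 y0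
  (der_id t) (fun i => der_cst (x 0 i) t) (fun i => der_cst (y 0 i) t) e.
move=> H; apply: is_derive_eq H _; rewrite mul1r big1 ?addr0// => i _.
by rewrite !mul0r addr0.
Qed.

Lemma derive1n_kern (f : R -> R) m e x y : orthant x -> orthant y ->
  (forall t, 0 < t -> f t = kern e t x y) ->
  forall t, 0 < t -> derive1n m f t = kern (iter m (D DT) e) t x y.
Proof.
move=> x0 y0 fe; elim: m => [|m IH] //= t t0.
rewrite -/(derive1n m f) derive1E.
have dk := is_derive_kern_t (iter m (D DT) e) t0 x0 y0.
have [] // : is_derive t 1 (derive1n m f) (kern (D (DT) (iter m (D DT) e)) t x y).
apply: near_eq_is_derive dk; near=> s; rewrite IH//.
by near: s; exact: lt_nbhsr.
Unshelve. all: by end_near. Qed.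

Lemma order_iter_DT m e : (order (iter m (D DT) e) <= order e + m.*2)%N.
Proof.
elim: m => [|m IH]; first by rewrite addn0.
have h := order_D DT (iter m (D DT) e); rewrite -[dorder _]/2%N in h.
by apply: leq_trans h _; rewrite doubleS !addnS addn0 !ltnS.
Qed.

Lemma order_heat_symbol : order heat_symbol = 0%N.
Proof. by rewrite /= add0n; elim/big_ind: _ => //= e f -> ->. Qed.

Definition dt_delta_symbol n m : symbol := iter m (D DT) (deltanS n heat_symbol).

Lemma order_dt_delta_symbol n m : (order (dt_delta_symbol n m) <= \sum_i n i + m.*2)%N.
Proof.
apply: leq_trans (order_iter_DT _ _) _; rewrite leq_add2r.
by apply: leq_trans (order_deltanS _ _) _; rewrite order_heat_symbol.
Qed.

Lemma delta_heat_kern n t x y : 0 < t -> orthant x -> orthant y ->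
  delta_heat alpha n t x y = kern (deltanS n heat_symbol) t x y.
Proof.
by move=> t0 x0 y0; apply: deltan_kern => // z z0; exact: heat_kernel_kern.
Qed.

Lemma dt_delta_heat_kern n m t x y : 0 < t -> orthant x -> orthant y ->
  dt_delta_heat alpha n m t x y = kern (dt_delta_symbol n m) t x y.
Proof.
by move=> t0 x0 y0; apply: derive1n_kern => // s s0; exact: delta_heat_kern.
Qed.

Lemma dt_heat_kern t x y : 0 < t -> orthant x -> orthant y ->
  dt_heat alpha t x y = kern (iter 1 (D DT) heat_symbol) t x y.
Proof.
move=> t0 x0 y0.
exact: (derive1n_kern 1 x0 y0 (fun s hs => heat_kernel_kern hs x0 y0) t0).
Qed.

End Kernel.

(** * Size of the symbols *)

(** In this section [s] stands for [sqrt (tanh t)], [u] for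
    [1 / sinh (2 * t)], and [W] bounds both [((x - y) / s) ^ 2] and the squares
    of [s * x] and [s * y]. *)
Section OneCoordinate.
Context {R : realFieldType}.
Variables (s u x y W : R).
Hypotheses (s_gt0 : 0 < s) (s_lt1 : s < 1) (u_gt0 : 0 < u) (x_gt0 : 0 < x) (y_gt0 : 0 < y).
Hypotheses (uE : 2 * u * s ^+ 2 = 1 - s ^+ 4) (W_ge1 : 1 <= W).
Hypotheses (hD : (x - y) ^+ 2 <= W * s ^+ 2) (hx : s ^+ 2 * x ^+ 2 <= W) (hy : s ^+ 2 * y ^+ 2 <= W).

Local Ltac coordinate_facts :=
  have s0 := s_gt0; have s1 := s_lt1; have u0 := u_gt0; have x0 := x_gt0;
  have y0 := y_gt0; have W1 := W_ge1; have dD := hD; have dx := hx; have dy := hy.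

Lemma one_us : 2 * u * s ^+ 2 <= 1.
Proof. by rewrite uE; have := exprn_ge0 4 (ltW s_gt0); lra. Qed.

Lemma le_Ws (a : R) : a ^+ 2 <= W * s ^+ 2 -> `|a| <= W * s.
Proof.
coordinate_facts; move=> h; have W0 : 0 <= W by lra.
have Ws : 0 <= W * s by rewrite mulr_ge0// ltW.
rewrite -ler_sqr ?nnegrE// real_normK ?num_real//; apply: le_trans h _.
by rewrite exprMn ler_wpM2r ?sqr_ge0// expr2 ler_peMl.
Qed.

Lemma coord_le (a : R) : 0 < a -> s ^+ 2 * a ^+ 2 <= W -> a <= W / s.
Proof.
move=> a0 h; have s0 := s_gt0; have W1 := W_ge1; have W0 : 0 <= W by lra.
rewrite ler_pdivlMr// -ler_sqr ?nnegrE ?mulr_ge0 ?(ltW a0) ?(ltW s_gt0)//.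
by rewrite exprMn mulrC; apply: le_trans h _; rewrite expr2 ler_peMl.
Qed.

Lemma diff_le : `|u * (x - y)| <= W / s.
Proof.
coordinate_facts; have h := le_Ws hD; rewrite normrM gtr0_norm// ler_pdivlMr//.
have := one_us; have := normr_ge0 (x - y); move: `|x - y| h => D h D0 h1.
have h2 : u * D * s <= u * (W * s) * s by rewrite ler_wpM2r ?ler_wpM2l// ltW.
by nra.
Qed.

Lemma sqr_diff_le : u * (x - y) ^+ 2 <= W.
Proof.
coordinate_facts; apply: le_trans (ler_wpM2l (ltW u_gt0) hD) _.
by have := one_us; nra.
Qed.

(** Either [y <= s]; or [y <= 2 * x], and the denominator absorbs [u * x * y];
    or [y] is at most twice [|x - y|]. *)
Lemma eta_le : u * y * (1 + u * (x * y))^-1 <= 2 * W / s.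
Proof.
coordinate_facts; have us := one_us; have p0 : 0 < u * (x * y) by rewrite !mulr_gt0.
rewrite ler_pdivrMr; last by lra.
rewrite mulrAC ler_pdivlMr//.
have [ys|ys] := leP y s.
  have : u * y * s <= u * s * s by rewrite ler_wpM2r ?ler_wpM2l// ltW.
  by nra.
have [yx|yx] := leP y (2 * x).
  have h1 : u * y * s <= u * y * y by rewrite ler_wpM2l ?mulr_ge0// ltW.
  have h2 : u * y * y <= u * y * (2 * x) by rewrite ler_wpM2l ?mulr_ge0// ltW.
  by nra.
have yD : y <= 2 * (W * s).
  by have := le_Ws hD; rewrite ler_norml => /andP[h1 h2]; lra.
have : u * y * s <= u * (2 * (W * s)) * s by rewrite ler_wpM2r ?ler_wpM2l// ltW.
by nra.
Qed.

(** With [zarg_ge]: [1 + z] is comparable with [((x + s) / s) ^ 2], which turns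
    the power of [1 + z] in the kernel into a ratio of densities of [mu_alpha] at
    distance [s] from [x]. *)
Lemma zarg_le : 1 + u * (x * y) <= 12 * W * ((x + s) / s) ^+ 2.
Proof.
coordinate_facts; have us := one_us.
have yx : y <= x + W * s.
  by have := le_Ws hD; rewrite ler_norml => /andP[h1 h2]; lra.
have e : ((x + s) / s) ^+ 2 = (1 + x / s) ^+ 2 by field; rewrite gt_eqF.
rewrite e; set a := x / s; have a0 : 0 < a by rewrite divr_gt0.
have xE : x = a * s by rewrite /a divfK// gt_eqF.
have h1 : u * (x * y) <= u * (x * (x + W * s)) by rewrite !ler_wpM2l// ltW.
have h2 : u * (x * (x + W * s)) = (u * s ^+ 2) * (a * (a + W)) by rewrite xE; ring.
have h3 : (u * s ^+ 2) * (a * (a + W)) <= 1 * (a * (a + W)).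
  by rewrite ler_wpM2r; nra.
have h4 : 1 * (a * (a + W)) <= W * (a * (a + 1)) by nra.
have h5 : 0 < W * a by nra.
have h6 : 0 < W * a ^+ 2 by rewrite mulr_gt0 ?exprn_gt0//; lra.
have -> : 12 * W * (1 + a) ^+ 2 = 12 * W + 24 * (W * a) + 12 * (W * a ^+ 2) by ring.
have e2 : W * (a * (a + 1)) = W * a ^+ 2 + W * a by ring.
lra.
Qed.

Lemma zarg_ge : ((x + s) / s) ^+ 2 <= 12 * W * (1 + u * (x * y)).
Proof.
coordinate_facts; have us := one_us; have p0 : 0 < u * (x * y) by rewrite !mulr_gt0.
have e : ((x + s) / s) ^+ 2 = (1 + x / s) ^+ 2 by field; rewrite gt_eqF.
have xs : (x / s) ^+ 2 = 2 * u * x ^+ 2 + s ^+ 2 * x ^+ 2.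
  have -> : 2 * u = (1 - s ^+ 4) / s ^+ 2 by rewrite -uE mulfK// gt_eqF// exprn_gt0.
  by field; rewrite gt_eqF.
have h : u * x ^+ 2 <= 2 * (u * (x * y)) + 2 * W.
  have [xy|xy] := leP x (2 * y).
    have : u * x * x <= u * x * (2 * y) by rewrite ler_wpM2l ?mulr_ge0// ltW.
    by nra.
  have x4 : x ^+ 2 <= 4 * (x - y) ^+ 2 by nra.
  have : u * x ^+ 2 <= u * (4 * (x - y) ^+ 2) by rewrite ler_wpM2l// ltW.
  by have := sqr_diff_le; nra.
have h2 : (x / s) ^+ 2 <= 5 * W + 4 * (u * (x * y)).
  by rewrite xs; lra.
have h3 : (1 + x / s) ^+ 2 <= 2 + 2 * (x / s) ^+ 2 by have := sqr_ge0 (1 - x / s); nra.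
by rewrite e; nra.
Qed.

End OneCoordinate.

Section Bounds.
Context {R : realType} {d : nat} (alpha : 'I_d -> R) (b : R -> nat -> R -> R).
Hypothesis alpha_gt : forall i, -1 < alpha i.
Hypothesis b_bounded : forall (nu : R) l, -1 < nu ->
  exists2 C, 0 < C & forall z, 0 <= z -> `|b nu l z| <= C.
Implicit Types (t : R) (x y : 'rV[R]_d) (i j : 'I_d) (l : nat).

Local Notation symbol := (@symbol R d).
Local Notation eval := (eval alpha b).

Definition root t : R := Num.sqrt (tanh t).

Lemma root_gt0 t : 0 < t -> 0 < root t.
Proof. by move=> t0; rewrite sqrtr_gt0 tanh_gt0. Qed.

Lemma sqr_root t : 0 < t -> root t ^+ 2 = tanh t.
Proof. by move=> t0; rewrite sqr_sqrtr// ltW// tanh_gt0. Qed.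

Lemma root_lt1 t : 0 < t -> root t < 1.
Proof. by move=> t0; have := root_gt0 t0; have := tanh_lt1 t0; rewrite -sqr_root//; nra. Qed.

(** The Gaussian factor of the kernel is at most a constant times
    [expR (- weight t x y / 8)] ([quad_le]), so that powers of the weight are
    harmless. *)
Definition weight t x y : R :=
  1 + \sum_i ((x 0 i - y 0 i) ^+ 2 / tanh t + tanh t * (x 0 i ^+ 2 + y 0 i ^+ 2)).

Lemma weight_term t x y i : 0 < t ->
  (x 0 i - y 0 i) ^+ 2 / tanh t + tanh t * (x 0 i ^+ 2 + y 0 i ^+ 2) <= weight t x y - 1.
Proof.
move=> t0; have T0 := tanh_gt0 t0; rewrite /weight [1 + _]addrC addrK (bigD1 i)//= lerDl.
apply: sumr_ge0 => j _.
exact: addr_ge0 (divr_ge0 (sqr_ge0 _) (ltW T0)) (mulr_ge0 (ltW T0) (addr_ge0 (sqr_ge0 _) (sqr_ge0 _))).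
Qed.

Lemma weight_ge1 t x y : 0 < t -> 1 <= weight t x y.
Proof.
move=> t0; have T0 := tanh_gt0 t0; rewrite lerDl.
apply: sumr_ge0 => j _.
exact: addr_ge0 (divr_ge0 (sqr_ge0 _) (ltW T0)) (mulr_ge0 (ltW T0) (addr_ge0 (sqr_ge0 _) (sqr_ge0 _))).
Qed.

Lemma csch_root t : 0 < t -> 2 * csch t * root t ^+ 2 = 1 - root t ^+ 4.
Proof.
move=> t0; have T0 := tanh_gt0 t0.
rewrite (_ : 4 = 2 * 2)%N// exprM sqr_root// /csch; field; rewrite gt_eqF//.
Qed.

Lemma weight_coord t x y i : 0 < t ->
  [/\ (x 0 i - y 0 i) ^+ 2 <= weight t x y * root t ^+ 2,
      root t ^+ 2 * x 0 i ^+ 2 <= weight t x y & root t ^+ 2 * y 0 i ^+ 2 <= weight t x y].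
Proof.
move=> t0; have := weight_term x y i t0; have T0 := tanh_gt0 t0; rewrite sqr_root//.
move: (weight _ _ _) => W h.
have D0 : 0 <= (x 0 i - y 0 i) ^+ 2 / tanh t by rewrite divr_ge0 ?sqr_ge0 ?ltW.
have X0 : 0 <= tanh t * x 0 i ^+ 2 by rewrite mulr_ge0 ?sqr_ge0 ?ltW.
have Y0 : 0 <= tanh t * y 0 i ^+ 2 by rewrite mulr_ge0 ?sqr_ge0 ?ltW.
split; [|lra|lra].
by rewrite -ler_pdivrMr//; lra.
Qed.

Definition dominated (e : symbol) (N w : nat) (C : R) :=
  forall t x y, 0 < t -> orthant x -> orthant y ->
    `|eval e t x y| <= C * weight t x y ^+ N * (root t)^-1 ^+ w.

Lemma dominatedW (e : symbol) N N' w w' C C' : 0 <= C -> C <= C' -> (N <= N')%N -> (w <= w')%N ->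
  dominated e N w C -> dominated e N' w' C'.
Proof.
move=> C0 CC NN ww h t x y t0 x0 y0; apply: le_trans (h t x y t0 x0 y0) _.
have W1 := weight_ge1 x y t0; have W0 : 0 <= weight t x y by rewrite (le_trans ler01).
have s0 := root_gt0 t0; have s1 := root_lt1 t0.
have r1 : 1 <= (root t)^-1 by rewrite invf_ge1// ltW.
apply: ler_pM; rewrite ?mulr_ge0 ?exprn_ge0 ?invr_ge0 ?(ltW s0)//.
  by apply: ler_pM; rewrite ?exprn_ge0 ?ler_weXn2l.
exact: ler_weXn2l.
Qed.

(** The generators are estimated by the inequalities in one coordinate; sums and
    products follow, since [weight] and [(root t)^-1] are at least 1. *)
Lemma eval_dominated (e : symbol) : exists2 C, 0 < C & exists N, dominated e N (order e) C.
Proof.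
have core (e' : symbol) w (C : R) : 0 < C ->
    (forall t x y, 0 < t -> orthant x -> orthant y ->
       `|eval e' t x y| <= C * (weight t x y * (root t)^-1 ^+ w)) ->
    exists2 C, 0 < C & exists N, dominated e' N w C.
  move=> C0 h; exists C => //; exists 1%N => t x y t0 x0 y0.
  by rewrite expr1 -mulrA; exact: h.
have pz t x y i : 0 < t -> orthant x -> orthant y -> 0 < csch t * (x 0 i * y 0 i).
  by move=> t0 x0 y0; exact: mulr_gt0 (csch_gt0 t0) (mulr_gt0 (x0 i) (y0 i)).
have rho_itv t x y i : 0 < t -> orthant x -> orthant y -> 0 < rho t x y i <= 1.
  move=> t0 x0 y0; have := pz t x y i t0 x0 y0 => z0.
  rewrite /rho /zarg invr_gt0 invf_le1; last by lra.
  by apply/andP; split; lra.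
elim: e => [c||||i|i|i|i|i|i|i|i l|e [C1 p1 [N1 h1]] f [C2 p2 [N2 h2]]|e [C1 p1 [N1 h1]] f [C2 p2 [N2 h2]]].
- apply: (core _ _ (`|c| + 1)); first by rewrite ltr_wpDl.
  move=> t x y t0 x0 y0 /=; rewrite expr0 mulr1; have := weight_ge1 x y t0.
  by have := normr_ge0 c; nra.
- apply: (core _ _ 1) => // t x y t0 x0 y0 /=; rewrite expr0 mul1r mulr1.
  rewrite gtr0_norm ?tanh_gt0//; have := weight_ge1 x y t0; have := tanh_lt1 t0; lra.
- apply: (core _ _ 1) => // t x y t0 x0 y0 /=; have T0 := tanh_gt0 t0.
  rewrite exprVn sqr_root// mul1r gtr0_norm ?invr_gt0// ler_peMl ?invr_ge0 ?(ltW T0)//.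
  exact: weight_ge1.
- apply: (core _ _ 1) => // t x y t0 x0 y0 /=; have T0 := tanh_gt0 t0.
  rewrite exprVn sqr_root// mul1r gtr0_norm ?csch_gt0//; apply: le_trans (csch_le t0) _.
  have := weight_ge1 x y t0; rewrite invfM.
  have : 0 < (tanh t)^-1 by rewrite invr_gt0.
  by move: (_^-1) => u; nra.
- apply: (core _ _ 1) => // t x y t0 x0 y0 /=; rewrite expr1 mul1r gtr0_norm//.
  have [_ h _] := weight_coord x y i t0.
  exact: (coord_le (root_gt0 t0) (weight_ge1 x y t0) (x0 i) h).
- apply: (core _ _ 1) => // t x y t0 x0 y0 /=; rewrite expr1 mul1r gtr0_norm//.
  have [_ _ h] := weight_coord x y i t0.
  exact: (coord_le (root_gt0 t0) (weight_ge1 x y t0) (y0 i) h).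
- apply: (core _ _ 1) => // t x y t0 x0 y0 /=; rewrite expr0 mulr1 mul1r.
  have /andP[r0 r1] := rho_itv t x y i t0 x0 y0; rewrite gtr0_norm//.
  exact: le_trans r1 (weight_ge1 x y t0).
- apply: (core _ _ 2) => // t x y t0 x0 y0 /=; rewrite expr1.
  have [hD hx hy] := weight_coord x y i t0.
  have /andP[r0 _] := rho_itv t x y i t0 x0 y0; have S0 := csch_gt0 t0.
  rewrite gtr0_norm; last exact: mulr_gt0 (mulr_gt0 S0 (y0 i)) r0.
  rewrite mulrA; apply: eta_le => //; [exact: root_gt0|exact: root_lt1|exact: csch_root|exact: weight_ge1].
- apply: (core _ _ 2) => // t x y t0 x0 y0 /=; rewrite expr1.
  have [hD hx hy] := weight_coord x y i t0.
  have /andP[r0 _] := rho_itv t x y i t0 x0 y0; have S0 := csch_gt0 t0.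
  rewrite gtr0_norm; last exact: mulr_gt0 (mulr_gt0 S0 (x0 i)) r0.
  rewrite mulrA /rho /zarg [x 0 i * y 0 i]mulrC.
  have hD' : (y 0 i - x 0 i) ^+ 2 <= weight t x y * root t ^+ 2 by rewrite -sqrrN opprB.
  by apply: eta_le => //; [exact: root_gt0|exact: root_lt1|exact: csch_root|exact: weight_ge1].
- apply: (core _ _ 1) => // t x y t0 x0 y0 /=; rewrite expr1 mul1r.
  have [hD hx hy] := weight_coord x y i t0.
  apply: (@diff_le _ (root t) _ (x 0 i) (y 0 i)) => //; [exact: root_gt0|exact: root_lt1|exact: csch_gt0|exact: csch_root|exact: weight_ge1].
- apply: (core _ _ 1) => // t x y t0 x0 y0 /=; rewrite expr0 mulr1 mul1r.
  have [hD hx hy] := weight_coord x y i t0.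
  rewrite ger0_norm; last exact: mulr_ge0 (ltW (csch_gt0 t0)) (sqr_ge0 _).
  apply: (@sqr_diff_le _ (root t) _ (x 0 i) (y 0 i)) => //; [exact: root_gt0|exact: root_lt1|exact: csch_gt0|exact: csch_root|exact: weight_ge1].
- have [C C0 hC] := b_bounded l (alpha_gt i).
  apply: (core _ _ C) => // t x y t0 x0 y0 /=; rewrite expr0 mulr1.
  apply: le_trans (hC _ _) _; first exact: ltW (pz t x y i t0 x0 y0).
  by rewrite ler_peMr ?(ltW C0)// weight_ge1.
- exists (C1 + C2); first exact: addr_gt0.
  exists (N1 + N2)%N => t x y t0 x0 y0 /=; apply: le_trans (ler_normD _ _) _.
  rewrite -mulrA mulrDl; apply: lerD; rewrite mulrA.
    by apply: (dominatedW _ _ _ _ h1) => //; rewrite ?(ltW p1) ?leq_addr ?leq_maxl.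
  by apply: (dominatedW _ _ _ _ h2) => //; rewrite ?(ltW p2) ?leq_addl ?leq_maxr.
- exists (C1 * C2); first exact: mulr_gt0.
  exists (N1 + N2)%N => t x y t0 x0 y0 /=; rewrite normrM.
  apply: le_trans (ler_pM _ _ (h1 t x y t0 x0 y0) (h2 t x y t0 x0 y0)) _ => //.
  by rewrite !exprD le_eqVlt; apply/orP; left; apply/eqP; ring.
Qed.

(** The size of [mu_alpha (oball x r)], see [mu_alpha_ball_le]. *)
Definition vol (x : 'rV[R]_d) (r : R) : R := \prod_i (r * (x 0 i + r) `^ (2 * alpha i + 1)).

Lemma vol_gt0 x r : orthant x -> 0 < r -> 0 < vol x r.
Proof.
move=> x0 r0; apply: prodr_gt0 => i _; rewrite mulr_gt0// powR_gt0// addr_gt0//; exact: x0.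
Qed.

Definition decay t : R := expR (- t * (2 * d%:R + 2 * \sum_i alpha i)).

Lemma decayE t : decay t = \prod_i expR (- (2 * t) * (1 + alpha i)).
Proof.
rewrite /decay -expR_sum -mulr_sumr big_split/= sumr_const card_ord.
by congr expR; ring.
Qed.

(** Part of the Gaussian decay in [x - y] is set aside, another part controls the
    weight. *)
Lemma quad_le t x y : 0 < t -> \sum_i quad t x y i <=
  - (enorm (x - y) ^+ 2 / (16 * tanh t)) - (weight t x y - 1) / 8.
Proof.
move=> t0; rewrite /enorm sqr_sqrtr ?sumr_ge0// => [|i _]; last exact: sqr_ge0.
rewrite /weight [1 + _]addrC addrK !mulr_suml -!sumrN -big_split/=.
apply: ler_sum => i _; rewrite !mxE /quad /csch.
have := tanh_gt0 t0; have := tanh_lt1 t0.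
move: (tanh t) (x 0 i) (y 0 i) => T X Y T1 T0.
have h : (X - Y) ^+ 2 <= 2 * (X ^+ 2 + Y ^+ 2) by have := sqr_ge0 (X + Y); nra.
have -> : - ((X - Y) ^+ 2 / (16 * T)) = - (X - Y) ^+ 2 * T^-1 / 16 by field; rewrite gt_eqF.
have V1 : 1 <= T^-1 by rewrite invf_ge1// ltW.
have D0 := sqr_ge0 (X - Y).
move: ((X - Y) ^+ 2) (X ^+ 2 + Y ^+ 2) (T^-1) h V1 D0 => D S V h V1 D0.
have h1 : T * D <= T * (2 * S) by rewrite ler_wpM2l// ltW.
have h2 : D * T <= D * V by rewrite ler_wpM2l//; lra.
lra.
Qed.

(** The power of [csch t] provides [expR (- 2 t (1 + alpha i))] and
    [s `^ - (2 + 2 alpha i)], the power of [1 + z] provides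
    [((x + s) / s) `^ - (2 alpha i + 1)]: together, the inverse of one factor of
    [vol x s], where [s = root t]. *)
Lemma prefactor1_le i : exists2 C, 0 < C & forall t x y, 0 < t -> orthant x -> orthant y ->
  prefactor1 alpha i t x y <= C * weight t x y `^ `|alpha i + 2^-1|
    * expR (- (2 * t) * (1 + alpha i))
    * (root t * (x 0 i + root t) `^ (2 * alpha i + 1))^-1 * expR (quad t x y i).
Proof.
set e := - (alpha i + 2^-1); pose a := 1 + alpha i.
have a0 : 0 <= a by rewrite /a; have := alpha_gt i; lra.
exists (2 `^ a * 12 `^ `|e|); first by rewrite mulr_gt0 ?powR_gt0.
move=> t x y t0 x0 y0; rewrite /prefactor1 -/e -/a; apply: ler_wpM2r; first exact: expR_ge0.
have s0 := root_gt0 t0; have s1 := root_lt1 t0; have W1 := weight_ge1 x y t0.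
have [hD hx hy] := weight_coord x y i t0; have S0 := csch_gt0 t0; have E := csch_root t0.
have X0 := x0 i; have Y0 := y0 i.
have W0 : 0 < weight t x y by lra.
have q0 : 0 < (x 0 i + root t) / root t by rewrite divr_gt0// addr_gt0.
have z0 : 0 < csch t * (x 0 i * y 0 i) by exact: mulr_gt0 S0 (mulr_gt0 X0 Y0).
have h1 : csch t `^ a <= 2 `^ a * expR (- (2 * t) * a) * (root t `^ (2 * a))^-1.
  have T0 := tanh_gt0 t0.
  have q1 : 0 <= expR (- (2 * t)) / tanh t by rewrite divr_ge0 ?expR_ge0 ?(ltW T0).
  apply: (@le_trans _ _ ((2 * (expR (- (2 * t)) / tanh t)) `^ a)).
    by rewrite ge0_ler_powR ?nnegrE ?(ltW S0) ?csch_le_expR// mulr_ge0.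
  rewrite powRM// powRM ?expR_ge0 ?invr_ge0 ?(ltW T0)//.
  rewrite -expRM -sqr_root// -powR_mulrn ?(ltW s0)// -powR_inv1 ?powR_ge0// -!powRrM -mulrA.
  by rewrite [2 * (-1 * a)]mulrCA mulN1r powRN.
have h2 : (1 + zarg t x y i) `^ e <= 12 `^ `|e| * weight t x y `^ `|e| *
    ((x 0 i + root t) / root t) `^ (2 * e).
  have -> : ((x 0 i + root t) / root t) `^ (2 * e) = (((x 0 i + root t) / root t) ^+ 2) `^ e.
    by rewrite powRrM powR_mulrn// ltW.
  rewrite -powRM ?(ltW W0)//; apply: powR_equiv.
  - by rewrite /zarg; lra.
  - by rewrite exprn_gt0.
  - by lra.
  - exact: zarg_le.
  - exact: zarg_ge.
rewrite -[`|alpha i + 2^-1|]normrN -/e.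
apply: le_trans (ler_pM _ _ h1 h2) _; rewrite ?powR_ge0//.
have -> : ((x 0 i + root t) / root t) `^ (2 * e) = root t `^ (2 * alpha i + 1) / (x 0 i + root t) `^ (2 * alpha i + 1).
  have -> : 2 * e = - (2 * alpha i + 1) by rewrite /e; field.
  rewrite powRM ?invr_ge0 ?addr_ge0 ?(ltW s0) ?(ltW X0)// -powR_inv1 ?(ltW s0)// -powRrM mulrNN mul1r.
  by rewrite powRN mulrC.
have -> : root t `^ (2 * a) = root t `^ (2 * alpha i + 1) * root t.
  rewrite -{3}[root t](powRr1 (ltW s0)) -powRD ?(gt_eqF s0) ?implybT//.
  by congr (_ `^ _); rewrite /a; ring.
have r0 := powR_gt0 (2 * alpha i + 1) s0; have v0 := powR_gt0 (2 * alpha i + 1) (addr_gt0 X0 s0).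
move: (weight t x y `^ _) (2 `^ a) (12 `^ _) (expR _) => A B C F.
move: (root t `^ _) ((x 0 i + root t) `^ _) r0 v0 => G H r0 v0.
by rewrite le_eqVlt; apply/orP; left; apply/eqP; field; rewrite !gt_eqF.
Qed.

End Bounds.

(** * The Euclidean norm *)
Section Norm.
Context {R : realType} {d : nat}.
Implicit Types (u v : 'rV[R]_d).

Lemma sqr_enorm u : enorm u ^+ 2 = \sum_i u 0 i ^+ 2.
Proof. by rewrite sqr_sqrtr// sumr_ge0// => i _; exact: sqr_ge0. Qed.

Lemma enorm_ge0 u : 0 <= enorm u. Proof. exact: sqrtr_ge0. Qed.

Lemma coord_le_enorm u i : `|u 0 i| <= enorm u.
Proof.
rewrite -ler_sqr ?nnegrE ?enorm_ge0// sqr_enorm real_normK ?num_real//.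
by rewrite (bigD1 i)//= lerDl sumr_ge0// => j _; exact: sqr_ge0.
Qed.

Lemma enormN u : enorm (- u) = enorm u.
Proof. by rewrite /enorm; congr Num.sqrt; apply: eq_bigr => i _; rewrite mxE sqrrN. Qed.

Lemma enormB u v : enorm (u - v) = enorm (v - u).
Proof. by rewrite -enormN opprB. Qed.

Lemma enorm0 : enorm (0 : 'rV[R]_d) = 0.
Proof. by rewrite /enorm big1 ?sqrtr0// => i _; rewrite mxE expr0n. Qed.

Lemma enorm_gt0 u v : u != v -> 0 < enorm (u - v).
Proof.
move=> uv; rewrite lt_neqAle enorm_ge0 andbT; apply/negP => /eqP e.
move/negP: uv; apply; apply/eqP/rowP => i.
have := coord_le_enorm (u - v) i; rewrite -e normr_le0 !mxE subr_eq0.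
by move=> /eqP.
Qed.

(** This keeps a segment of pairs of points away from the diagonal. *)
Lemma enorm_segment u v (h : R) : 0 <= h <= 1 -> 2 * enorm v <= enorm u ->
  enorm u / 2 <= enorm (u + h *: v) <= 2 * enorm u.
Proof.
move=> /andP[h0 h1] vu; have u0 := enorm_ge0 u; have v0 := enorm_ge0 v.
have w0 := enorm_ge0 (u + h *: v).
have v2 : enorm v ^+ 2 <= enorm u ^+ 2 / 4 by nra.
have hh : h ^+ 2 <= 1 by nra.
have lo : enorm u ^+ 2 / 2 - enorm v ^+ 2 <= enorm (u + h *: v) ^+ 2.
  rewrite !sqr_enorm mulr_suml -sumrB; apply: ler_sum => i _; rewrite !mxE.
  have := sqr_ge0 (v 0 i); have := sqr_ge0 (u 0 i + 2 * (h * v 0 i)).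
  by move: (u 0 i) (v 0 i) => a c; nra.
have hi : enorm (u + h *: v) ^+ 2 <= 2 * enorm u ^+ 2 + 2 * enorm v ^+ 2.
  rewrite !sqr_enorm !mulr_sumr -big_split/=; apply: ler_sum => i _; rewrite !mxE.
  have := sqr_ge0 (v 0 i); have := sqr_ge0 (u 0 i - h * v 0 i).
  by move: (u 0 i) (v 0 i) => a c; nra.
move: (enorm u) (enorm v) (enorm (u + h *: v)) u0 v0 w0 v2 lo hi {vu} => a c e *.
by apply/andP; split; rewrite -ler_sqr ?nnegrE; nra.
Qed.

End Norm.

(** * Change of scale *)
Section Absorption.
Context {R : realType}.

Lemma gauss_bounded (a k : R) : 0 <= a -> 0 < k ->
  exists2 C, 0 < C & forall l, 0 <= l -> (1 + l) `^ a * expR (- (k * l ^+ 2)) <= C.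
Proof.
move=> a0 k0; have [C C0 hC] := powR_expR_bounded a0 k0.
exists (2 `^ a * C); first by rewrite mulr_gt0 ?powR_gt0.
move=> l l0; have h := hC (l ^+ 2) (sqr_ge0 _).
apply: le_trans _ (ler_wpM2l (powR_ge0 2 a) h); rewrite [leRHS]mulrA ler_wpM2r ?expR_ge0//.
have l2 := sqr_ge0 l; rewrite -powRM//; last by lra.
rewrite ge0_ler_powR ?nnegrE; [by []|by []|by lra|by lra|].
by have := sqr_ge0 (l - 2^-1); nra.
Qed.

(** One coordinate of [vol_transfer].  For [a < 0] the density decreases, and the
    exponent [a + 1] is what it leaves of the linear factor [r]. *)
Lemma coord_transfer (a x r s : R) : -1 < a -> 0 < x -> 0 < r -> 0 < s ->
  r * (x + r) `^ a <= s * (x + s) `^ a * ((r / s) `^ Num.min 1 (a + 1) * (1 + r / s) `^ `|a|).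
Proof.
move=> a1 x0 r0 s0; set l := r / s; have l0 : 0 < l by rewrite divr_gt0.
have rE : r = l * s by rewrite /l divfK// gt_eqF.
have xs0 : 0 < x + s by lra.
have xr0 : 0 < x + r by lra.
have l1 : 0 < 1 + l by lra.
have [a0|a0] := leP 0 a.
  rewrite min_l; last by lra.
  rewrite powRr1 ?(ltW l0)// (ger0_norm a0).
  have h : (x + r) `^ a <= (1 + l) `^ a * (x + s) `^ a.
    rewrite -powRM ?(ltW l1) ?(ltW xs0)// ge0_ler_powR ?nnegrE ?(ltW xr0) ?mulr_ge0 ?(ltW l1) ?(ltW xs0)//.
    by rewrite rE; nra.
  apply: le_trans (ler_wpM2l (ltW r0) h) _.
  by rewrite [X in X * _ <= _]rE le_eqVlt; apply/orP; left; apply/eqP; ring.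
rewrite min_r; last by lra.
have q0 : 0 < (x + s) * l / (1 + l) by exact: divr_gt0 (mulr_gt0 xs0 l0) l1.
have h : (x + r) `^ a <= ((x + s) * l / (1 + l)) `^ a.
  rewrite -[a]opprK (powRN (x + r)) (powRN (_ / _)) lef_pV2 ?posrE ?powR_gt0//.
  rewrite ge0_ler_powR ?nnegrE ?oppr_ge0 ?(ltW a0) ?(ltW xr0) ?(ltW q0)//.
  by rewrite ler_pdivrMr// rE; nra.
apply: le_trans (ler_wpM2l (ltW r0) h) _.
have il : 0 <= (1 + l)^-1 by rewrite invr_ge0 ltW.
rewrite (powRM _ (ltW (mulr_gt0 xs0 l0)) il) (powRM _ (ltW xs0) (ltW l0)).
rewrite -powR_inv1 ?(ltW l1)// -powRrM mulN1r (ltr0_norm a0) powRD; last by rewrite (gt_eqF l0) implybT.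
rewrite (powRr1 (ltW l0)) [X in X * _ <= _]rE.
by rewrite le_eqVlt; apply/orP; left; apply/eqP; ring.
Qed.

Lemma prodr_powR (I : finType) (a : R) (e : I -> R) : 0 < a ->
  \prod_i a `^ e i = a `^ (\sum_i e i).
Proof.
move=> a0; rewrite (big_morph (fun e => a `^ e) (id1 := 1) (op1 := *%R))//.
- by move=> u v; rewrite powRD// (gt_eqF a0) implybT.
- by rewrite powRr0.
Qed.

End Absorption.

(** * Growth and smoothness at a fixed time *)
Section KernelBounds.
Context {R : realType} {d : nat} (alpha : 'I_d -> R) (b : R -> nat -> R -> R).
Hypothesis alpha_gt : forall i, -1 < alpha i.
Hypothesis b_bounded : forall (nu : R) l, -1 < nu ->
  exists2 C, 0 < C & forall z, 0 <= z -> `|b nu l z| <= C.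
Hypothesis der_b : forall (nu : R) l (z : R), -1 < nu -> 0 <= z -> is_derive z 1 (b nu l)
  ((1 + z)^-1 * ((l%:R + nu + 2^-1) * b nu l z + b nu l.+1 z)).
Implicit Types (t r : R) (x y : 'rV[R]_d) (i j : 'I_d) (l : nat).

Local Notation symbol := (@symbol R d).
Local Notation kern := (kern alpha b).
Local Notation vol := (vol alpha).
Local Notation decay := (decay alpha).

(** The Gaussian absorbs all the powers of the weight at once: those of the
    prefactor and those of the symbol. *)
Lemma kern_bound (e : symbol) : exists2 C, 0 < C & forall t x y,
  0 < t -> orthant x -> orthant y ->
  `|kern e t x y| <= C * decay t * (root t)^-1 ^+ order e * (vol x (root t))^-1
     * expR (- ((enorm (x - y) / root t) ^+ 2 / 16)).
Proof.
have [C C0 [N hN]] := eval_dominated alpha_gt b_bounded e.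
have /choice [A hA] : forall i, exists A, 0 < A /\ forall t x y, 0 < t -> orthant x -> orthant y ->
    prefactor1 alpha i t x y <= A * weight t x y `^ `|alpha i + 2^-1|
    * expR (- (2 * t) * (1 + alpha i))
    * (root t * (x 0 i + root t) `^ (2 * alpha i + 1))^-1 * expR (quad t x y i).
  by move=> i; have [A A0 h] := prefactor1_le alpha_gt i; exists A.
pose M := \sum_i `|alpha i + 2^-1|.
have M0 : 0 <= M by apply: sumr_ge0 => i _; exact: normr_ge0.
have [B B0 hB] := @powR_expR_bounded R (M + N%:R) 8^-1 ltac:(by rewrite addr_ge0) ltac:(by rewrite invr_gt0).
exists (C * \prod_i A i * B).
  by rewrite !mulr_gt0// prodr_gt0// => i _; have [] := hA i.
move=> t x y t0 x0 y0; rewrite -[kern _ _ _ _]/(prefactor alpha t x y * eval alpha b e t x y) normrM.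
have s0 := root_gt0 t0; have W1 := weight_ge1 x y t0.
have W0 : 0 < weight t x y by exact: lt_le_trans W1.
have V0 := vol_gt0 alpha x0 s0.
have pre0 i : 0 <= prefactor1 alpha i t x y.
  by rewrite !mulr_ge0 ?powR_ge0 ?expR_ge0.
have hP : prefactor alpha t x y <= \prod_i A i * weight t x y `^ M * decay t * (vol x (root t))^-1 *
   (expR (- ((enorm (x - y) / root t) ^+ 2 / 16)) * expR (- (8^-1 * (weight t x y - 1)))).
  apply: (@le_trans _ _ (\prod_i A i * weight t x y `^ M * decay t * (vol x (root t))^-1 *
      expR (\sum_i quad t x y i))).
    rewrite -prodr_powR// decayE -[vol _ _]/(\prod_i (root t * (x 0 i + root t) `^ (2 * alpha i + 1))) -prodfV expR_sum -!big_split/=.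
    apply: ler_prod => i _; rewrite pre0/=; have [_ h] := hA i; exact: h.
  apply: ler_wpM2l.
    rewrite !mulr_ge0 ?powR_ge0 ?expR_ge0 ?invr_ge0 ?(ltW V0)//.
    by apply: prodr_ge0 => i _; have [/ltW] := hA i.
  rewrite -expRD ler_expR; apply: le_trans (quad_le x y t0) _.
  rewrite expr_div_n sqr_root// le_eqVlt; apply/orP; left; apply/eqP.
  by field; rewrite gt_eqF// tanh_gt0.
have pp : 0 <= prefactor alpha t x y by apply: prodr_ge0.
rewrite (ger0_norm pp).
apply: le_trans (ler_pM pp (normr_ge0 _) hP (hN t x y t0 x0 y0)) _.
have hW : weight t x y `^ M * weight t x y ^+ N * expR (- (8^-1 * (weight t x y - 1))) <= B.
  have := hB (weight t x y - 1); rewrite subr_ge0 => /(_ W1).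
  rewrite addrCA subrr addr0 powRD ?powR_mulrn ?(ltW W0)//.
  by rewrite (gt_eqF W0) implybT.
have A0 : 0 <= \prod_i A i by apply: prodr_ge0 => i _; have [/ltW] := hA i.
have D0 : 0 <= decay t by exact: expR_ge0.
have r0 : 0 <= (root t)^-1 ^+ order e by rewrite exprn_ge0// invr_ge0 ltW.
have v0 : 0 <= (vol x (root t))^-1 by rewrite invr_ge0 ltW.
have g0 := expR_ge0 (- ((enorm (x - y) / root t) ^+ 2 / 16)).
move: hW A0 D0 r0 v0 g0.
move: (weight t x y `^ M) (weight t x y ^+ N) (expR (- (8^-1 * _))) => P Q E hW.
move: (\prod_i A i) (decay t) ((root t)^-1 ^+ _) ((vol x _)^-1) (expR _) => a D0 r v g a0 d0 r0 v0 g0.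
have -> : a * P * D0 * v * (g * E) * (C * Q * r) = (C * a * D0 * r * v * g) * (P * Q * E) by ring.
have -> : C * a * B * D0 * r * v * g = (C * a * D0 * r * v * g) * B by ring.
by apply: ler_wpM2l => //; rewrite !mulr_ge0 ?(ltW C0).
Qed.

(** The balls grow at least like this power of the radius; it is positive because
    [-1 < alpha i]. *)
Definition gain : R := \sum_i Num.min 1 (2 * alpha i + 1 + 1).

Lemma gain_gt0 : (0 < d)%N -> 0 < gain.
Proof.
move=> d0; rewrite /gain (bigD1 (Ordinal d0))//= ltr_wpDr//.
  apply: sumr_ge0 => i _; rewrite le_min ler01/=; have := alpha_gt i; lra.
by rewrite lt_min ltr01/=; have := alpha_gt (Ordinal d0); lra.
Qed.

(** The power [gain] of the ratio makes the integrals over the times [t] beyond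
    [r ^ 2] converge. *)
Lemma vol_transfer x r s : orthant x -> 0 < r -> 0 < s ->
  (vol x s)^-1 <= (vol x r)^-1 * ((r / s) `^ gain * (1 + r / s) `^ (\sum_i `|2 * alpha i + 1|)).
Proof.
move=> x0 r0 s0; have v0 := vol_gt0 alpha x0 r0; have w0 := vol_gt0 alpha x0 s0.
have l0 : 0 < r / s by rewrite divr_gt0.
rewrite mulrC ler_pdivlMr// mulrC ler_pdivrMr// mulrC.
rewrite -!prodr_powR//; last by rewrite addr_gt0.
rewrite -!big_split/=; apply: ler_prod => i _; rewrite mulr_ge0 ?powR_ge0 ?(ltW r0)//=.
by apply: coord_transfer => //; have := alpha_gt i; lra.
Qed.

(** At time [t], every kernel of order [w] is bounded by a multiple of
    [majorant k w t r / vol x r], where [r = |x - y|]. *)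
Definition majorant (k : R) (w : nat) t r : R :=
  decay t * (root t)^-1 ^+ w * ((r / root t) `^ gain * expR (- (k * (r / root t) ^+ 2))).

Lemma majorant_ge0 k w t r : 0 < t -> 0 <= majorant k w t r.
Proof.
move=> t0; rewrite !mulr_ge0 ?expR_ge0 ?powR_ge0// exprn_ge0// invr_ge0.
exact: ltW (root_gt0 t0).
Qed.

Lemma majorantW k k' w w' t r : 0 < t -> k' <= k -> (w <= w')%N ->
  majorant k w t r <= majorant k' w' t r.
Proof.
move=> t0 kk ww; have s0 := root_gt0 t0; have s1 := root_lt1 t0.
have i1 : 1 <= (root t)^-1 by rewrite invf_ge1// ltW.
have i0 : 0 <= (root t)^-1 by rewrite (le_trans ler01).
apply: ler_pM; rewrite ?mulr_ge0 ?expR_ge0 ?powR_ge0 ?exprn_ge0//.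
  by rewrite ler_wpM2l ?expR_ge0// ler_weXn2l.
by rewrite ler_wpM2l ?powR_ge0// ler_expR lerN2 ler_wpM2r// sqr_ge0.
Qed.

(** The volume is moved from the scale [root t] to the scale [|x - y|]; half of
    the Gaussian pays for it. *)
Lemma kern_growth (e : symbol) : exists2 C, 0 < C & forall t x y,
  0 < t -> orthant x -> orthant y -> x != y ->
  `|kern e t x y| <= C * (majorant 32^-1 (order e) t (enorm (x - y)) / vol x (enorm (x - y))).
Proof.
have [C C0 hC] := kern_bound e.
have K0 : 0 <= \sum_i `|2 * alpha i + 1| by apply: sumr_ge0 => i _; exact: normr_ge0.
have k0 : 0 < 32^-1 :> R by rewrite invr_gt0 ltr0n.
have [B B0 hB] := gauss_bounded K0 k0.
exists (C * B); first exact: mulr_gt0.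
move=> t x y t0 x0 y0 xy; apply: le_trans (hC t x y t0 x0 y0) _.
have s0 := root_gt0 t0; have r0 := enorm_gt0 xy.
have h := vol_transfer x0 r0 s0; rewrite /majorant.
set r := enorm _ in r0 h *.
have l0 : 0 <= r / root t by rewrite divr_ge0 ?ltW.
have hb := hB _ l0.
have D0 : 0 <= decay t by exact: expR_ge0.
have i0 : 0 <= (root t)^-1 ^+ order e by rewrite exprn_ge0// invr_ge0 ltW.
have v0 : 0 <= (vol x r)^-1 by rewrite invr_ge0 ltW// vol_gt0.
have g0 := powR_ge0 (r / root t) gain.
have E : expR (- ((r / root t) ^+ 2 / 16)) = expR (- (32^-1 * (r / root t) ^+ 2)) * expR (- (32^-1 * (r / root t) ^+ 2)).
  by rewrite -expRD; congr expR; move: (r / root t) => m; field.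
rewrite E; have e0 := expR_ge0 (- (32^-1 * (r / root t) ^+ 2)).
move: h hb D0 i0 v0 g0 e0.
move: ((vol x (root t))^-1) ((vol x r)^-1) ((1 + _) `^ _) ((r / root t) `^ gain) (expR (- (32^-1 * _))) (decay t) ((root t)^-1 ^+ _).
move=> v v' P g G D0 s h hb d0 i0 v0 g0 G0.
apply: (@le_trans _ _ (C * D0 * s * (v' * (g * P)) * (G * G))).
  by apply: ler_wpM2r; rewrite ?mulr_ge0//; apply: ler_wpM2l => //; rewrite !mulr_ge0 ?(ltW C0).
have -> : C * D0 * s * (v' * (g * P)) * (G * G) = (C * D0 * s * v' * g * G) * (P * G) by ring.
have -> : C * B * (D0 * s * (g * G) * v') = (C * D0 * s * v' * g * G) * B by ring.
by apply: ler_wpM2l => //; rewrite !mulr_ge0 ?(ltW C0).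
Qed.

(** [(root t)^-1 = r^-1 * (r / root t)], and the Gaussian absorbs
    [r / root t]. *)
Lemma majorant_shift : exists2 C, 0 < C & forall w t r r', 0 < t -> 0 < r ->
  r / 2 <= r' <= 2 * r ->
  majorant 32^-1 w.+1 t r' <= C * (r^-1 * majorant 256^-1 w t r).
Proof.
have k0 : 0 < 256^-1 :> R by rewrite invr_gt0 ltr0n.
have [B B0 hB] := gauss_bounded ler01 k0.
exists (2 `^ `|gain| * B); first by rewrite mulr_gt0 ?powR_gt0.
move=> w t r r' t0 r0 /andP[r1 r2]; have s0 := root_gt0 t0.
have r'0 : 0 < r' by lra.
rewrite /majorant; set l := r / root t; have l0 : 0 < l by rewrite divr_gt0.
have g1 : (r' / root t) `^ gain <= 2 `^ `|gain| * l `^ gain.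
  apply: powR_equiv; rewrite ?divr_gt0//; first by lra.
  - by rewrite /l mulrA ler_pM2r ?invr_gt0.
  - by rewrite /l mulrA ler_pM2r ?invr_gt0//; lra.
have e1 : expR (- (32^-1 * (r' / root t) ^+ 2)) <= expR (- (128^-1 * l ^+ 2)).
  rewrite ler_expR lerN2.
  have : l / 2 <= r' / root t by rewrite /l mulrAC ler_pM2r ?invr_gt0.
  by move: (r' / root t) => m; nra.
have e2 : (root t)^-1 * expR (- (128^-1 * l ^+ 2)) <= r^-1 * (B * expR (- (256^-1 * l ^+ 2))).
  have -> : (root t)^-1 = r^-1 * l by rewrite /l; field; rewrite !gt_eqF.
  rewrite -mulrA ler_wpM2l ?invr_ge0 ?(ltW r0)//.
  have -> : - (128^-1 * l ^+ 2) = - (256^-1 * l ^+ 2) + - (256^-1 * l ^+ 2) by field.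
  rewrite expRD mulrA ler_wpM2r ?expR_ge0//.
  apply: le_trans _ (hB l (ltW l0)); rewrite powRr1; last by lra.
  by rewrite ler_wpM2r ?expR_ge0//; lra.
have D0 : 0 <= decay t by exact: expR_ge0.
have i0 : 0 <= (root t)^-1 ^+ w by rewrite exprn_ge0// invr_ge0 ltW.
rewrite exprS; have sV : 0 <= (root t)^-1 by rewrite invr_ge0 ltW.
have G0 := powR_ge0 l gain; have Q0 := powR_ge0 (2 : R) `|gain|.
have E0 := expR_ge0 (- (32^-1 * (r' / root t) ^+ 2)).
have h := ler_pM (powR_ge0 _ _) E0 g1 e1.
apply: (@le_trans _ _ (decay t * ((root t)^-1 * (root t)^-1 ^+ w) *
    (2 `^ `|gain| * l `^ gain * expR (- (128^-1 * l ^+ 2))))).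
  by apply: ler_wpM2l h; rewrite !mulr_ge0.
move: e2 D0 i0 G0 Q0.
move: ((root t)^-1) (l `^ gain) (2 `^ _) (decay t) (expR (- (128^-1 * _))) (expR (- (256^-1 * _))) (r^-1).
move=> s G Q D0 e f ir e2 d0 S0 G0 Q0; set S := s ^+ w in S0 *.
have -> : D0 * (s * S) * (Q * G * e) = (D0 * S * Q * G) * (s * e) by ring.
have -> : Q * B * (ir * (D0 * S * (G * f))) = (D0 * S * Q * G) * (ir * (B * f)) by ring.
by apply: ler_wpM2l => //; rewrite !mulr_ge0.
Qed.

Lemma vol_shift : exists2 C, 0 < C & forall x x' r r', orthant x -> orthant x' -> 0 < r ->
  r / 2 <= r' <= 2 * r -> (forall i, `|x' 0 i - x 0 i| <= r / 2) ->
  (vol x' r')^-1 <= C * (vol x r)^-1.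
Proof.
exists (\prod_i (2 * 3 `^ `|2 * alpha i + 1|)).
  by apply: prodr_gt0 => i _; rewrite mulr_gt0 ?powR_gt0.
move=> x x' r r' x0 x'0 r0 /andP[r1 r2] hx; have r'0 : 0 < r' by lra.
have v0 := vol_gt0 alpha x0 r0; have v'0 := vol_gt0 alpha x'0 r'0.
rewrite ler_pdivlMr// mulrC ler_pdivrMr// -big_split/=.
apply: ler_prod => i _; rewrite mulr_ge0 ?powR_ge0 ?(ltW r0)//=.
have := x0 i; have := x'0 i; have := hx i; rewrite ler_norml => /andP[h1 h2] p0 q0.
have -> : 2 * 3 `^ `|2 * alpha i + 1| * (r' * (x' 0 i + r') `^ (2 * alpha i + 1)) =
  (2 * r') * (3 `^ `|2 * alpha i + 1| * (x' 0 i + r') `^ (2 * alpha i + 1)) by ring.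
apply: ler_pM; rewrite ?powR_ge0 ?(ltW r0)//; first by lra.
by apply: powR_equiv; lra.
Qed.

(** Smoothness in [x] and in [y] at once, by the mean value theorem along the
    segment from [(x, y)] to [(x', y')].  Each derivative costs one order, hence a
    factor [(root t)^-1], which is traded for [|x - y|^-1]. *)
Lemma kern_smooth (e : symbol) : exists2 C, 0 < C & forall t x y x' y' (p : R),
  0 < t -> orthant x -> orthant y -> orthant x' -> orthant y' ->
  (forall i, `|x' 0 i - x 0 i| <= p) -> (forall i, `|y' 0 i - y 0 i| <= p) ->
  enorm ((x' - x) - (y' - y)) <= p -> 2 * p < enorm (x - y) ->
  `|kern e t x y - kern e t x' y'| <=
    C * (p / enorm (x - y)) * (majorant 256^-1 (order e) t (enorm (x - y)) / vol x (enorm (x - y))).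
Proof.
have /choice [A hA] : forall k : @direction d, exists A, 0 < A /\ forall t x y, 0 < t -> orthant x -> orthant y ->
    x != y -> `|kern (D alpha k e) t x y| <=
      A * (majorant 32^-1 (order (D alpha k e)) t (enorm (x - y)) / vol x (enorm (x - y))).
  by move=> k; have [A A0 h] := kern_growth (D alpha k e); exists A.
have [B B0 hB] := majorant_shift; have [G G0 hG] := vol_shift.
have S0 : 0 <= \sum_i (A (DX i) + A (DY i)).
  by apply: sumr_ge0 => i _; rewrite addr_ge0// ltW//; [have [] := hA (DX i)|have [] := hA (DY i)].
exists ((\sum_i (A (DX i) + A (DY i)) + 1) * B * G).
  by rewrite !mulr_gt0// ltr_wpDl.
move=> t x y x' y' p t0 x0 y0 x'0 y'0 hx hy hp pr.
set r := enorm (x - y) in pr *.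
have p0 : 0 <= p by exact: le_trans (enorm_ge0 _) hp.
have r0 : 0 < r by lra.
pose xs (h : R) := x + h *: (x' - x); pose ys (h : R) := y + h *: (y' - y).
have seg (u u' : 'rV[R]_d) (h : R) : 0 <= h <= 1 -> orthant u -> orthant u' -> orthant (u + h *: (u' - u)).
  move=> /andP[h0 h1] u0 u'0 i; rewrite !mxE.
  have := u0 i; have := u'0 i; move: (u 0 i) (u' 0 i) => a c c0 a0.
  have [->|hne] := eqVneq h 0; first by rewrite mul0r addr0.
  have hh : 0 < h by rewrite lt_neqAle eq_sym hne.
  by nra.
have dseg (u u' : 'rV[R]_d) (h : R) i : is_derive h 1 (fun h : R => (u + h *: (u' - u)) 0 i) (u' 0 i - u 0 i).
  have -> : (fun h : R => (u + h *: (u' - u)) 0 i) = (fun h => u 0 i + h * (u' 0 i - u 0 i)).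
    by apply/funext => k; rewrite !mxE.
  apply: is_derive_eq (derD (der_cst _ _) (derM (der_id h) (der_cst _ h))) _; ring.
pose f h := kern e t (xs h) (ys h).
pose df h := \sum_i ((x' 0 i - x 0 i) * kern (D alpha (DX i) e) t (xs h) (ys h)
           + (y' 0 i - y 0 i) * kern (D alpha (DY i) e) t (xs h) (ys h)).
have dF (h : R) : 0 <= h <= 1 -> is_derive h 1 f (df h).
  move=> h01; have := @der_kern _ _ alpha b alpha_gt der_b (fun=> t) xs ys h 0 (fun i => x' 0 i - x 0 i) (fun i => y' 0 i - y 0 i)
     t0 (seg x x' h h01 x0 x'0) (seg y y' h h01 y0 y'0) (der_cst t h) (dseg x x' h) (dseg y y' h) e.
  by move=> H; apply: is_derive_eq H _; rewrite mul0r add0r.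
have [] := @MVT_segment R f df 0 1 ler01.
- by move=> h; rewrite in_itv/= => /andP[h0 h1]; apply: dF; rewrite !ltW.
- apply: continuous_in_subspaceT => h; rewrite inE/= in_itv/= => h01.
  exact: is_derive_continuous (dF h h01).
move=> c; rewrite in_itv/= => c01 e1.
have -> : kern e t x y - kern e t x' y' = - df c.
  move: e1; rewrite subr0 mulr1 => <-; rewrite opprB /f /xs /ys !scale0r !scale1r !addr0.
  by rewrite ![_ + (_ - _)]addrC !subrK.
rewrite normrN; set r' := enorm (xs c - ys c).
have rr : r / 2 <= r' <= 2 * r.
  have -> : r' = enorm ((x - y) + c *: ((x' - x) - (y' - y))).
    by rewrite /r' /xs /ys opprD addrACA -scalerBr.
  by apply: enorm_segment => //; apply: le_trans (_ : 2 * p <= _); [rewrite ler_wpM2l|exact: ltW].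
have r'0 : 0 < r' by move: rr => /andP[]; lra.
have xsc := seg x x' c c01 x0 x'0; have ysc := seg y y' c c01 y0 y'0.
have xy' : xs c != ys c.
  by apply/negP => /eqP E; move: r'0; rewrite /r' E subrr enorm0 ltxx.
have hv : (vol (xs c) r')^-1 <= G * (vol x r)^-1.
  apply: hG => // i; rewrite !mxE [_ - x 0 i](_ : _ = c * (x' 0 i - x 0 i)) ?normrM; last by ring.
  have /andP[c0 c1] := c01; rewrite (ger0_norm c0).
  apply: (@le_trans _ _ (1 * p)); last by lra.
  exact: ler_pM.
have hk k : (dorder k <= 1)%N -> `|kern (D alpha k e) t (xs c) (ys c)| <=
    A k * (B * G * (r^-1 * (majorant 256^-1 (order e) t r / vol x r))).
  move=> k1; have [A0 h] := hA k; apply: le_trans (h t _ _ t0 xsc ysc xy') _.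
  rewrite ler_wpM2l ?(ltW A0)//.
  have -> : B * G * (r^-1 * (majorant 256^-1 (order e) t r / vol x r)) =
     (B * (r^-1 * majorant 256^-1 (order e) t r)) * (G * (vol x r)^-1) by ring.
  apply: ler_pM; rewrite ?majorant_ge0 ?invr_ge0 ?(ltW (vol_gt0 _ _ _))//.
  apply: le_trans _ (hB (order e) t r r' t0 r0 rr); apply: majorantW => //.
  apply: leq_trans (order_D alpha k e) _; rewrite -addn1 leq_add2l//.
have Z0 : 0 <= B * G * (r^-1 * (majorant 256^-1 (order e) t r / vol x r)).
  have M0 := majorant_ge0 256^-1 (order e) r t0; have V0 := vol_gt0 alpha x0 r0.
  apply: mulr_ge0; first exact: ltW (mulr_gt0 B0 G0).
  by apply: mulr_ge0; [rewrite invr_ge0 ltW|exact: divr_ge0 M0 (ltW V0)].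
apply: (@le_trans _ _ (\sum_i (A (DX i) + A (DY i)) * (p * (B * G * (r^-1 * (majorant 256^-1 (order e) t r / vol x r)))))).
  apply: le_trans (ler_norm_sum _ _ _) _; apply: ler_sum => i _.
  apply: le_trans (ler_normD _ _) _; rewrite !normrM mulrDl !(mulrCA _ p).
  by apply: lerD; apply: ler_pM => //; rewrite -normrM; exact: hk.
have -> : (\sum_i (A (DX i) + A (DY i)) + 1) * B * G * (p / r) * (majorant 256^-1 (order e) t r / vol x r) =
  (\sum_i (A (DX i) + A (DY i)) + 1) * (p * (B * G * (r^-1 * (majorant 256^-1 (order e) t r / vol x r)))) by ring.
by rewrite -mulr_suml; apply: ler_wpM2r; [exact: mulr_ge0 p0 Z0|rewrite lerDl].
Qed.

End KernelBounds.

(** * Time integrals of the majorant *)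
Section TimeIntegrals.
Context {R : realType} {d : nat} (alpha : 'I_d -> R).
Hypothesis d_gt0 : (0 < d)%N.
Hypothesis alpha_gt : forall i, -1 < alpha i.
Implicit Types (t r : R).
Local Notation mu := (@lebesgue_measure R).
Local Notation pos := (`]0, +oo[%classic : set R).
Local Notation decay := (decay alpha).
Local Notation gain := (gain alpha).
Local Notation majorant := (majorant alpha).

Lemma decay_rate_gt0 : 0 < 2 * d%:R + 2 * \sum_i alpha i.
Proof.
have -> : 2 * d%:R + 2 * \sum_i alpha i = \sum_(i < d) (2 * (1 + alpha i)).
  by rewrite -mulr_sumr big_split/= sumr_const card_ord mulrDr.
rewrite (bigD1 (Ordinal d_gt0))//= ltr_wpDr//.
  by apply: sumr_ge0 => i _; have := alpha_gt i; lra.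
by have := alpha_gt (Ordinal d_gt0); lra.
Qed.

Lemma decay_le1 t : 0 < t -> decay t <= 1.
Proof.
move=> t0; rewrite -[decay t]/(expR _) expR_le1 mulNr oppr_le0 mulr_ge0 ?(ltW t0)//.
exact: ltW decay_rate_gt0.
Qed.

Lemma majorant_decay (k : R) : 0 < k -> exists2 C, 0 < C & forall t r, 0 < t -> 0 < r ->
  majorant k 0 t r <= C * decay t.
Proof.
move=> k0; have [C C0 hC] := gauss_bounded (ltW (gain_gt0 alpha_gt d_gt0)) k0.
exists C => // t r t0 r0; rewrite -[majorant _ _ _ _]/(_ * _ * _) expr0 mulr1 mulrC ler_wpM2r ?expR_ge0//.
have l0 : 0 < r / root t by rewrite divr_gt0// root_gt0.
apply: le_trans (hC _ (ltW l0)); rewrite ler_wpM2r ?expR_ge0// ge0_ler_powR ?nnegrE//.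
- exact: ltW (gain_gt0 alpha_gt d_gt0).
- exact: ltW.
- by rewrite addr_ge0// ltW.
- by rewrite lerDr.
Qed.

(** Integrability with respect to [dt / t].  Replacing [tanh t] by [t] costs powers
    of [1 + t], absorbed by [decay].  In the variable [v = r ^ 2 / t] there remains
    [v `^ (gain / 2) * expR (- k * v / 2)], small at both ends. *)
Lemma majorant_bump (k : R) (w : nat) : 0 < k -> exists2 C, 0 < C & forall t r, 0 < t -> 0 < r ->
  t `^ (w%:R / 2) * majorant k w t r <= C * (t * bump (gain / 2) (r ^+ 2) t).
Proof.
move=> k0; have g0 := gain_gt0 alpha_gt d_gt0; pose s := gain / 2.
have s0 : 0 < s by rewrite divr_gt0.
have c0 := decay_rate_gt0.
pose p := w%:R / 2 + s; have p0 : 0 <= p.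
  exact: addr_ge0 (divr_ge0 (ler0n _ _) (ler0n _ 2)) (ltW s0).
have [C C0 hC] := powR_expR_bounded p0 c0.
have [B B0 hB] := @powR_expR_bounded R (s + s) (k / 2) ltac:(lra) ltac:(by rewrite divr_gt0).
exists (2 `^ p * C * (4 * B)); first by rewrite !mulr_gt0 ?powR_gt0.
move=> t r t0 r0; have T0 := tanh_gt0 t0; have S0 := root_gt0 t0.
have Tt : t / tanh t <= 2 * (1 + t).
  rewrite ler_pdivrMr//; apply: le_trans (tanh_ge t0) _.
  by apply: ler_wpM2r; [exact: ltW|lra].
have tT := tanh_le t0.
pose v := r ^+ 2 / t; have v0 : 0 < v by rewrite divr_gt0 ?exprn_gt0.
have tt0 : 0 < t / tanh t by rewrite divr_gt0.
have e1 : t `^ (w%:R / 2) * (root t)^-1 ^+ w = (t / tanh t) `^ (w%:R / 2).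
  rewrite powRM ?invr_ge0 ?(ltW t0) ?(ltW T0)//; congr (_ * _).
  have i0 : 0 <= (root t)^-1 by rewrite invr_ge0 ltW.
  transitivity ((root t)^-1 `^ w%:R); first by rewrite powR_mulrn.
  have -> : (tanh t)^-1 = (root t)^-1 `^ 2%:R by rewrite powR_mulrn// exprVn sqr_root.
  by rewrite -powRrM; congr (_ `^ _); field.
have e2 : (r / root t) `^ gain = v `^ s * (t / tanh t) `^ s.
  rewrite -powRM ?(ltW v0) ?(ltW tt0)//.
  have -> : v * (t / tanh t) = (r / root t) ^+ 2.
    by rewrite expr_div_n sqr_root// /v; field; rewrite !gt_eqF.
  rewrite -powR_mulrn ?divr_ge0 ?(ltW r0) ?(ltW S0)// -powRrM; congr (_ `^ _).
  by rewrite /s; field.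
have e3 : expR (- (k * (r / root t) ^+ 2)) <= expR (- (k / 2 * v)).
  rewrite ler_expR lerN2 expr_div_n sqr_root// -mulrA ler_wpM2l ?(ltW k0)//.
  have -> : 2^-1 * v = r ^+ 2 / (2 * t) by rewrite /v invfM; ring.
  by rewrite ler_wpM2l ?sqr_ge0// lef_pV2 ?posrE// mulr_gt0.
have h1 : (t / tanh t) `^ (w%:R / 2) * (t / tanh t) `^ s * decay t <= 2 `^ p * C.
  rewrite -powRD; last by rewrite (gt_eqF tt0) implybT.
  have h := hC t (ltW t0); rewrite -/p.
  have : (t / tanh t) `^ p <= 2 `^ p * (1 + t) `^ p.
    have t10 : 0 <= 1 + t by lra.
    by rewrite -powRM// ge0_ler_powR ?nnegrE ?(ltW tt0) ?mulr_ge0.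
  move=> h2; apply: (@le_trans _ _ (2 `^ p * (1 + t) `^ p * decay t)).
    by rewrite ler_wpM2r ?expR_ge0.
  rewrite -mulrA ler_wpM2l ?powR_ge0//; apply: le_trans h; rewrite -[decay t]/(expR _).
  by rewrite mulNr [t * _]mulrC.
pose u := (t / r ^+ 2) `^ s; have u0 : 0 < u by rewrite powR_gt0// divr_gt0 ?exprn_gt0.
have uE : v `^ s = u^-1.
  rewrite /u -powRN -[- s]mulN1r [RHS]powRrM powR_inv1; last by rewrite divr_ge0 ?(ltW t0) ?sqr_ge0.
  by rewrite invf_div.
have h2 : (1 + u^-1) ^+ 2 * expR (- (k / 2 * v)) <= 4 * B.
  have v1 : 0 <= 1 + v by lra.
  have hu : 1 + u^-1 <= 2 * (1 + v) `^ s.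
    have a1 : 1 <= (1 + v) `^ s by rewrite powR_ge1 ?lerDl ?(ltW v0) ?(ltW s0).
    have a2 : v `^ s <= (1 + v) `^ s by rewrite ge0_ler_powR ?nnegrE ?(ltW s0) ?(ltW v0) ?lerDr.
    by rewrite -uE; lra.
  have hu2 : (1 + u^-1) ^+ 2 <= 4 * (1 + v) `^ (s + s).
    rewrite powRD; last by rewrite (gt_eqF (_ : 0 < 1 + v)) ?implybT//; lra.
    have u1 : 0 <= 1 + u^-1 by rewrite addr_ge0 ?invr_ge0 ?(ltW u0).
    by nra.
  apply: le_trans (ler_wpM2r (expR_ge0 _) hu2) _; rewrite -[leLHS]mulrA ler_wpM2l//.
  exact: hB (ltW v0).
have -> : t * bump (gain / 2) (r ^+ 2) t = u / (1 + u) ^+ 2.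
  by rewrite /bump -/s -/u mulrA mulfV ?mul1r ?gt_eqF.
rewrite -[majorant _ _ _ _]/(_ * _ * _) e2.
have -> : t `^ (w%:R / 2) * (decay t * (root t)^-1 ^+ w * (v `^ s * (t / tanh t) `^ s * expR (- (k * (r / root t) ^+ 2))))
  = (t `^ (w%:R / 2) * (root t)^-1 ^+ w) * (t / tanh t) `^ s * decay t * (v `^ s * expR (- (k * (r / root t) ^+ 2))).
  move: (t `^ _) (decay t) ((root t)^-1 ^+ w) (v `^ s) ((t / tanh t) `^ s) (expR _) => *; ring.
rewrite e1 -mulrA.
have -> : 2 `^ p * C * (4 * B) * (u / (1 + u) ^+ 2) = 2 `^ p * C * (u^-1 * ((4 * B) / (1 + u^-1) ^+ 2)).
  by field; rewrite !gt_eqF//; lra.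
rewrite mulrA; apply: ler_pM => //.
- by rewrite !mulr_ge0 ?powR_ge0 ?expR_ge0.
- by rewrite mulr_ge0 ?powR_ge0 ?expR_ge0.
rewrite uE ler_wpM2l ?invr_ge0 ?(ltW u0)//; apply: le_trans e3 _.
by rewrite ler_pdivlMr 1?mulrC// exprn_gt0// addr_gt0// invr_gt0.
Qed.

Lemma bump_le1 (s r t : R) : 0 < t -> t * bump s r t <= 1.
Proof.
move=> t0; rewrite /bump mulrA mulfV ?gt_eqF// mul1r.
have := powR_ge0 (t / r) s; move: (_ `^ s) => u u0.
by rewrite ler_pdivrMr ?exprn_gt0; nra.
Qed.

(** One of the two factors [t * bump] in the square is bounded by 1. *)
Lemma majorant_bump_sqr (k : R) (w : nat) : 0 < k -> exists2 C, 0 < C & forall t r, 0 < t -> 0 < r ->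
  majorant k w t r ^+ 2 * t `^ (w%:R - 1) <= C ^+ 2 * bump (gain / 2) (r ^+ 2) t.
Proof.
move=> k0; have [C C0 hC] := majorant_bump w k0; exists C => // t r t0 r0.
have h := hC t r t0 r0; have b1 := bump_le1 (gain / 2) (r ^+ 2) t0.
have m0 := majorant_ge0 alpha k w r t0; have p0 := powR_ge0 t (w%:R / 2).
have -> : t `^ (w%:R - 1) = (t `^ (w%:R / 2)) ^+ 2 / t.
  rewrite -powR_mulrn ?powR_ge0// -powRrM powRB ?(gt_eqF t0) ?implybT// powRr1 ?(ltW t0)//.
  by congr (_ `^ _ / _); field.
have B0 := bump_ge0 (gain / 2) (r ^+ 2) t0.
move: (majorant _ _ _ _) (t `^ _) (bump _ _ _) h b1 m0 p0 B0 => m q b h b1 m0 q0 b0.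
rewrite mulrA ler_pdivrMr//.
have : (q * m) ^+ 2 <= (C * (t * b)) ^+ 2 by rewrite ler_sqr ?nnegrE ?mulr_ge0 ?(ltW C0) ?(ltW t0).
have h3 : (t * b) ^+ 2 <= t * b 
  by have := mulr_ge0 (ltW t0) b0; move: (t * b) b1 => z; nra.
have h4 := ler_wpM2l (sqr_ge0 C) h3.
rewrite [X in _ <= X]exprMn => h5.
by rewrite -exprMn [m * q]mulrC -[leRHS]mulrA [b * t]mulrC; exact: le_trans h5 h4.
Qed.

End TimeIntegrals.

(** * Measures of balls *)
Section BallMeasure.
Context {R : realType}.
Implicit Types (t r x : R).
Local Notation mu := (@lebesgue_measure R).
Local Notation pos := (`]0, +oo[%classic : set R).

(** The integral of a nonnegative function is a supremum over the simple functions
    below it, hence monotone without any measurability. *)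
Lemma ge0_integral_mono dsp (T : measurableType dsp) (m : {measure set T -> \bar R}) (f g : T -> \bar R) :
  (forall z, 0 <= f z)%E -> (forall z, f z <= g z)%E ->
  (\int[m]_x f x <= \int[m]_x g x)%E.
Proof.
move=> f0 fg; have g0 z : (0 <= g z)%E by exact: le_trans (f0 z) (fg z).
rewrite !ge0_integralTE//; apply: le_ereal_sup => _ [h hf <-]; exists h => // z.
exact: le_trans (hf z) (fg z).
Qed.

Lemma iter_integral_ge0 d (f : 'rV[R]_d -> \bar R) :
  (forall v, 0 <= f v)%E -> (0 <= iter_integral f)%E.
Proof.
by elim: d f => [|d IH] f f0 //=; apply: integral_ge0 => t _; exact: IH.
Qed.

Lemma iter_integral_mono d (f g : 'rV[R]_d -> \bar R) :
  (forall v, 0 <= f v)%E -> (forall v, f v <= g v)%E ->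
  (iter_integral f <= iter_integral g)%E.
Proof.
elim: d f g => [|d IH] f g f0 fg //=; apply: ge0_integral_mono => t.
  by apply: iter_integral_ge0 => v; exact: f0.
by apply: IH => v; [exact: f0|exact: fg].
Qed.

Lemma iter_integral_prod d (g : 'I_d -> R -> R) (c : 'I_d -> R) (k : R) : 0 <= k ->
  (forall i t, 0 <= g i t) -> (forall i, measurable_fun setT (g i)) ->
  (forall i, \int[mu]_t (g i t)%:E <= (c i)%:E)%E -> (forall i, 0 <= c i) ->
  (iter_integral (fun v : 'rV[R]_d => (k * \prod_i g i (v 0 i))%:E) <= (k * \prod_i c i)%:E)%E.
Proof.
elim: d g c k => [|d IH] g c k k0 g0 mg hc c0 /=; first by rewrite !big_ord0.
pose g' i := g (lift ord0 i); pose c' i := c (lift ord0 i).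
have P0 : 0 <= \prod_i c' i by apply: prodr_ge0 => i _; exact: c0.
apply: (@le_trans _ _ (\int[mu]_t ((g ord0 t)%:E * (k * \prod_i c' i)%:E))%E).
  apply: ge0_integral_mono => t.
    by apply: iter_integral_ge0 => v; rewrite lee_fin mulr_ge0// prodr_ge0// => i _; exact: g0.
  have := IH g' c' (g ord0 t * k) (mulr_ge0 (g0 _ _) k0) (fun i => g0 _) (fun i => mg _) (fun i => hc _) (fun i => c0 _).
  rewrite -EFinM mulrA; apply: le_trans; rewrite le_eqVlt; apply/orP; left; apply/eqP.
  congr iter_integral; apply/funext => v; congr EFin.
  rewrite big_ord_recl mulrCA mulrA; congr (_ * _).
    congr (g ord0 _ * k); rewrite (_ : ord0 = lshift d (ord0 : 'I_1)); last exact: val_inj.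
    by rewrite (row_mxEl (t%:M : 'rV[R]_1) v) !mxE eqxx mulr1n.
  apply: eq_bigr => i _; rewrite /g' (_ : lift ord0 i = rshift 1 i); last exact: val_inj.
  by rewrite (row_mxEr (t%:M : 'rV[R]_1) v).
rewrite ge0_integralZr//; last 3 first.
- by apply/measurable_EFinP; exact: mg.
- by move=> t _; rewrite lee_fin.
- by rewrite lee_fin mulr_ge0.
rewrite big_ord_recl mulrCA [X in (_ <= X)%E]EFinM lee_wpmul2r// ?lee_fin ?mulr_ge0//.
Qed.

(** The density of a one-dimensional ball in [mu_alpha], with [a = 2 * alpha + 1]. *)
Definition ball1 (a x r t : R) : R := \1_(`]x - r, x + r[ `&` pos) t * t `^ a.

Lemma ball1_ge0 a x r t : 0 <= ball1 a x r t.
Proof. by rewrite mulr_ge0// ?powR_ge0. Qed.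

Lemma measurable_ball1 a x r : measurable_fun setT (ball1 a x r).
Proof.
apply: measurable_funM; last exact: measurable_powR.
by apply: measurable_indic; apply: measurableI; exact: measurable_itv.
Qed.

(** Away from the origin the density is nearly constant.  Near the origin it is
    dominated by a [bump] of exponent [a + 1] at the scale [x + r]. *)
Lemma integral_ball1_le (a : R) : -1 < a -> exists2 C, 0 < C & forall x r, 0 < x -> 0 < r ->
  (\int[mu]_t (ball1 a x r t)%:E <= (C * (r * (x + r) `^ a))%:E)%E.
Proof.
move=> a1; pose A := 3 `^ `|a| : R; have A0 : 0 < A by rewrite powR_gt0.
have b0 : 0 < a + 1 by lra.
pose B := 12 / (a + 1); have B0 : 0 < B by rewrite divr_gt0.
exists (2 * A + B) => [|x r x0 r0]; first exact: addr_gt0 (mulr_gt0 (ltr0n _ 2) A0) B0.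
have xr : 0 < x + r by lra.
have p0 := powR_gt0 a xr.
have [x2r|x2r] := leP (2 * r) x.
  apply: (@le_trans _ _ (\int[mu]_(t in `](x - r)%R, (x + r)%R[) (A * (x + r) `^ a)%R%:E)%E).
    rewrite [leRHS]integral_mkcond/=; apply: ge0_integral_mono => t; first by rewrite lee_fin ball1_ge0.
    rewrite patchE/= /ball1 indicE in_setI; case: ifPn => [tA|_]; last by rewrite mul0r.
    have := tA; rewrite inE/= in_itv/= => /andP[t1 t2].
    rewrite lee_fin; apply: (@le_trans _ _ (1 * t `^ a)).
      by rewrite ler_wpM2r ?powR_ge0//; case: (_ \in _).
    by rewrite mul1r; apply: powR_equiv; lra.
  rewrite integral_cst//= lebesgue_measure_itv/= lte_fin ifT; last by lra.
  rewrite -EFinD -EFinM lee_fin.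
  have -> : x + r - (x - r) = 2 * r by ring.
  have -> : (2 * A + B) * (r * (x + r) `^ a) = A * (x + r) `^ a * (2 * r) + B * (r * (x + r) `^ a) by ring.
  by rewrite lerDl; exact: ltW (mulr_gt0 B0 (mulr_gt0 r0 p0)).
pose D := 4 * (x + r) `^ (a + 1); have D0 : 0 < D by rewrite mulr_gt0 ?powR_gt0.
have mb : measurable_fun pos (EFin \o bump (a + 1) (x + r)).
  by apply/measurable_EFinP; apply: continuous_pos_measurable => t; exact: continuous_bump.
apply: (@le_trans _ _ (\int[mu]_(t in pos) (D%:E * (bump (a + 1) (x + r) t)%:E))%E).
  rewrite [leRHS]integral_mkcond/=; apply: ge0_integral_mono => t; first by rewrite lee_fin ball1_ge0.
  rewrite patchE/= /ball1 indicE in_setI andbC; case: ifPn => [tp|_] /=; last by rewrite mul0r.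
  have := tp; rewrite inE/= in_itv/= andbT => t0.
  have bp := bump_ge0 (a + 1) (x + r) t0.
  rewrite -EFinM lee_fin; case: (boolP (_ \in _)) => [tA|_]; last by rewrite mul0r mulr_ge0// ltW.
  have := tA; rewrite inE/= in_itv/= => /andP[_ t2].
  rewrite mul1r /bump /D.
  have u0 := powR_ge0 (t / (x + r)) (a + 1).
  have u1 : (t / (x + r)) `^ (a + 1) <= 1.
    by apply: powR_le1; [rewrite divr_gt0//= ler_pdivrMr ?mul1r//|]; exact: ltW.
  have -> : t `^ a = (x + r) `^ (a + 1) * (t^-1 * (t / (x + r)) `^ (a + 1)).
    rewrite mulrCA -powRM ?divr_ge0 ?(ltW xr) ?(ltW t0)//.
    rewrite mulrCA mulfV ?gt_eqF// mulr1 powRD ?(gt_eqF t0) ?implybT// powRr1 ?(ltW t0)//.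
    by field; rewrite gt_eqF.
  have -> : 4 * (x + r) `^ (a + 1) * (t^-1 * ((t / (x + r)) `^ (a + 1) / (1 + (t / (x + r)) `^ (a + 1)) ^+ 2)) =
    (x + r) `^ (a + 1) * (t^-1 * (t / (x + r)) `^ (a + 1)) * (4 / (1 + (t / (x + r)) `^ (a + 1)) ^+ 2) by ring.
  rewrite ler_peMr ?mulr_ge0 ?powR_ge0 ?invr_ge0 ?(ltW t0)//.
  move: (_ `^ _) u0 u1 => u u0 u1.
  by rewrite ler_pdivlMr ?exprn_gt0 ?mul1r; nra.
rewrite ge0_integralZl_EFin//; last 2 first.
- by move=> t; rewrite /= in_itv/= andbT => t0; rewrite lee_fin bump_ge0.
- exact: ltW.
apply: le_trans (lee_wpmul2l _ (integral_bump_le b0 xr)) _; first by rewrite lee_fin ltW.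
rewrite -EFinM lee_fin /D powRD ?(gt_eqF xr) ?implybT// powRr1 ?(ltW xr)//.
have h : 4 * ((x + r) `^ a * (x + r)) / (a + 1) <= B * (r * (x + r) `^ a).
  have -> : B * (r * (x + r) `^ a) = 4 * ((x + r) `^ a * (3 * r)) / (a + 1).
    by rewrite /B; field; rewrite gt_eqF.
  rewrite ler_pM2r ?invr_gt0// ler_pM2l// ler_pM2l//; lra.
apply: le_trans h _; rewrite mulrDl lerDr.
exact: ltW (mulr_gt0 (mulr_gt0 (ltr0n _ 2) A0) (mulr_gt0 r0 p0)).
Qed.

(** The ball lies in a product of intervals. *)
Lemma mu_alpha_ball_le d (alpha : 'I_d -> R) : (forall i, -1 < alpha i) ->
  exists2 C, 0 < C & forall (x : 'rV[R]_d) r, orthant x -> 0 < r ->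
    (mu_alpha alpha (oball x r) <= (C * vol alpha x r)%:E)%E.
Proof.
move=> alpha_gt.
have /choice [A hA] : forall i, exists C, 0 < C /\ forall x r, 0 < x -> 0 < r ->
    (\int[mu]_t (ball1 (2 * alpha i + 1) x r t)%:E <= (C * (r * (x + r) `^ (2 * alpha i + 1)))%:E)%E.
  move=> i; have [|C C0 h] := @integral_ball1_le (2 * alpha i + 1); last by exists C.
  by have := alpha_gt i; lra.
exists (\prod_i A i); first by apply: prodr_gt0 => i _; have [] := hA i.
move=> x r x0 r0; rewrite /mu_alpha /vol -big_split/=.
pose c i := A i * (r * (x 0 i + r) `^ (2 * alpha i + 1)).
pose g i := ball1 (2 * alpha i + 1) (x 0 i) r.
apply: (@le_trans _ _ (iter_integral (fun v : 'rV[R]_d => (1 * \prod_i g i (v 0 i))%:E))).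
  apply: iter_integral_mono => v; rewrite lee_fin.
    by rewrite mulr_ge0// prodr_ge0// => i _; exact: powR_ge0.
  rewrite mul1r indicE; case: (boolP (v \in _)) => [|_]; last first.
    by rewrite mul0r prodr_ge0// => i _; exact: ball1_ge0.
  rewrite inE => -[[v0 vr] _]; rewrite mul1r; apply: ler_prod => i _; rewrite powR_ge0/=.
  rewrite /g /ball1 indicE mem_set ?mul1r//; split; last by rewrite /= in_itv/= andbT; exact: v0.
  have := le_lt_trans (coord_le_enorm (x - v) i) vr.
  by rewrite !mxE ltr_norml /= in_itv/= => /andP[h1 h2]; apply/andP; split; lra.
have := @iter_integral_prod d g c 1 ler01; rewrite mul1r; apply.
- by move=> i t; exact: ball1_ge0.
- by move=> i; exact: measurable_ball1.
- by move=> i; have [_ h] := hA i; apply: h.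
- by move=> i; have [A0 _] := hA i; rewrite !mulr_ge0 ?powR_ge0 ?(ltW A0) ?(ltW r0).
Qed.

Lemma mu_alpha_ge0 d (alpha : 'I_d -> R) A : (0 <= mu_alpha alpha A)%E.
Proof.
apply: iter_integral_ge0 => v; rewrite lee_fin mulr_ge0// prodr_ge0// => i _.
exact: powR_ge0.
Qed.

(** Estimates by [vol] imply those by the measure of the ball.  If this measure
    were 0, the quotient would be [+oo], or 0 for a numerator 0. *)
Lemma le_ediv_mu_alpha d (alpha : 'I_d -> R) (x : 'rV[R]_d) (r C K : R) (N : \bar R) :
  orthant x -> 0 < r -> 0 < C -> 0 <= K ->
  (mu_alpha alpha (oball x r) <= (C * vol alpha x r)%:E)%E ->
  (N <= (K / vol alpha x r)%:E)%E ->
  (N <= (C * K)%:E / mu_alpha alpha (oball x r))%E.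
Proof.
move=> x0 r0 C0 K0 hm hN; apply: le_trans hN _; have v0 := vol_gt0 alpha x0 r0.
have := mu_alpha_ge0 alpha (oball x r); move: (mu_alpha _ _) hm => [m| |]//.
rewrite !lee_fin => mC m0; rewrite inver; case: eqP => [_|/eqP m1].
  have [->|K1] := eqVneq K 0; first by rewrite mul0r mulr0 mul0e.
  by rewrite gt0_muley ?leey// lte_fin mulr_gt0// lt_neqAle eq_sym K1.
rewrite -EFinM lee_fin ler_pdivlMr; last by rewrite lt_neqAle eq_sym m1.
rewrite mulrAC ler_pdivrMr//.
have -> : C * K * vol alpha x r = K * (C * vol alpha x r) by ring.
by rewrite ler_wpM2l.
Qed.

End BallMeasure.

(** * From bounds at a fixed time to the standard estimates *)
Section StandardEstimates.
Context {R : realType} {d : nat} (alpha : 'I_d -> R) (b : R -> nat -> R -> R).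
Hypothesis alpha_gt : forall i, -1 < alpha i.
Hypothesis b_bounded : forall (nu : R) l, -1 < nu ->
  exists2 C, 0 < C & forall z, 0 <= z -> `|b nu l z| <= C.
Hypothesis der_b : forall (nu : R) l (z : R), -1 < nu -> 0 <= z -> is_derive z 1 (b nu l)
  ((1 + z)^-1 * ((l%:R + nu + 2^-1) * b nu l z + b nu l.+1 z)).
Implicit Types (t r : R) (x y : 'rV[R]_d) (i j : 'I_d) (l : nat).

Local Notation symbol := (@symbol R d).
Local Notation kern := (kern alpha b).
Local Notation vol := (vol alpha).
Local Notation majorant := (majorant alpha 256^-1).

(** All three estimates follow from pointwise bounds in time, provided that the
    norm of a function of time is controlled by its best constant with respect to
    the majorant, in the single values and in the differences of [K]. *)
Lemma standard_estimates_kern (e : symbol) (w : nat) (V : zmodType) (N : V -> \bar R)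
    (K : 'rV[R]_d -> 'rV[R]_d -> V) (B : R) : (order e <= w)%N -> 0 < B ->
  (forall x y A r, orthant x -> orthant y -> 0 <= A -> 0 < r ->
     (forall t, 0 < t -> `|kern e t x y| <= A * majorant w t r) ->
     (N (K x y) <= (B * A)%:E)%E) ->
  (forall x y x' y' A r, orthant x -> orthant y -> x != y ->
     orthant x' -> orthant y' -> x' != y' -> 0 <= A -> 0 < r ->
     (forall t, 0 < t -> `|kern e t x y - kern e t x' y'| <= A * majorant w t r) ->
     (N (K x y - K x' y')%R <= (B * A)%:E)%E) ->
  standard_estimates alpha N K.
Proof.
move=> ew B0 h1 h2.
have [C1 C10 g] := kern_growth alpha_gt b_bounded e.
have [C2 C20 s] := kern_smooth alpha_gt b_bounded der_b e.
have [M M0 hM] := mu_alpha_ball_le alpha_gt.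
have mw t r : 0 < t -> majorant (order e) t r <= majorant w t r.
  by move=> t0; apply: majorantW.
pose C := M * B * (C1 + C2); have C0 : 0 < C by rewrite !mulr_gt0 ?addr_gt0.
have key x y x' y' p : orthant x -> orthant y -> x != y -> orthant x' -> orthant y' ->
    0 <= p -> (forall i, `|x' 0 i - x 0 i| <= p) -> (forall i, `|y' 0 i - y 0 i| <= p) ->
    enorm ((x' - x) - (y' - y)) <= p -> 2 * p < enorm (x - y) ->
    (N (K x y - K x' y')%R <= (C * (p / enorm (x - y)))%:E / mu_alpha alpha (oball x (enorm (x - y))))%E.
  move=> x0 y0 xy x'0 y'0 p0 hx hy hp pr.
  have r0 := enorm_gt0 xy; set r := enorm (x - y) in pr r0 *.
  have v0 := vol_gt0 alpha x0 r0.
  have xy' : x' != y'.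
    apply/negP => /eqP E; move: hp; rewrite E.
    have -> : y' - x - (y' - y) = y - x by rewrite opprB addrC addrA subrK.
    by rewrite enormB -/r => hp; move: pr r0 hp; lra.
  have -> : C * (p / r) = M * (B * (C1 + C2) * (p / r)) by rewrite /C; ring.
  apply: le_ediv_mu_alpha => //; [|exact: hM|].
    by rewrite !mulr_ge0 ?invr_ge0 ?(ltW r0) ?(ltW B0)// ltW// addr_gt0.
  have -> : B * (C1 + C2) * (p / r) / vol x r = B * ((C1 + C2) * (p / r) / vol x r) by ring.
  apply: (h2 x y x' y' _ r) => //.
    by rewrite !mulr_ge0 ?invr_ge0 ?(ltW r0) ?(ltW v0)// ltW// addr_gt0.
  move=> t t0; apply: le_trans (s t x y x' y' p t0 x0 y0 x'0 y'0 hx hy hp pr) _; rewrite -/r.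
  have -> : (C1 + C2) * (p / r) / vol x r * majorant w t r = (C1 + C2) * (p / r) * (majorant w t r / vol x r) by ring.
  have pr0 : 0 <= p / r by rewrite divr_ge0// ltW.
  have m0 := majorant_ge0 alpha 256^-1 (order e) r t0.
  apply: ler_pM (mulr_ge0 (ltW C20) pr0) (divr_ge0 m0 (ltW v0)) _ _.
    by apply: ler_wpM2r => //; rewrite lerDr ltW.
  by apply: ler_wpM2r; [rewrite invr_ge0 ltW|exact: mw].
exists C => //; split.
- move=> x y x0 y0 xy; have r0 := enorm_gt0 xy; set r := enorm (x - y) in r0 *.
  have v0 := vol_gt0 alpha x0 r0.
  have -> : C = M * (B * (C1 + C2)) by rewrite /C mulrA.
  apply: le_ediv_mu_alpha => //; [|exact: hM|].
    by rewrite mulr_ge0 ?(ltW B0)// ltW// addr_gt0.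
  have -> : B * (C1 + C2) / vol x r = B * ((C1 + C2) / vol x r) by ring.
  apply: (h1 x y _ r) => //; first by rewrite divr_ge0 ?(ltW v0)// ltW// addr_gt0.
  move=> t t0; apply: le_trans (g t x y t0 x0 y0 xy) _; rewrite -/r.
  have -> : (C1 + C2) / vol x r * majorant w t r = (C1 + C2) * (majorant w t r / vol x r) by ring.
  have m0 := majorant_ge0 alpha 32^-1 (order e) r t0.
  apply: ler_pM (ltW C10) (divr_ge0 m0 (ltW v0)) _ _; first by rewrite lerDl ltW.
  apply: ler_wpM2r; first by rewrite invr_ge0 ltW.
  apply: majorantW => //.
  by rewrite lef_pV2 ?posrE ?ltr0n// ler_nat.
- move=> x x' y x0 x'0 y0 h.
  have xy : x != y.
    by apply/negP => /eqP E; move: h; rewrite E subrr enorm0; have := enorm_ge0 (y - x'); lra.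
  apply: key => //; first exact: enorm_ge0.
  + by move=> i; rewrite enormB; have := coord_le_enorm (x' - x) i; rewrite !mxE.
  + by move=> i; rewrite subrr normr0; exact: enorm_ge0.
  + by rewrite subrr subr0 enormB.
- move=> x y y' x0 y0 y'0 h.
  have xy : x != y.
    by apply/negP => /eqP E; move: h; rewrite E subrr enorm0; have := enorm_ge0 (y - y'); lra.
  apply: key => //; first exact: enorm_ge0.
  + by move=> i; rewrite subrr normr0; exact: enorm_ge0.
  + by move=> i; rewrite enormB; have := coord_le_enorm (y' - y) i; rewrite !mxE.
  + by rewrite subrr sub0r opprB.
Qed.

End StandardEstimates.

(** * Norms of functions of time *)
Section NormsInTime.
Context {R : realType}.
Implicit Types (f g : R -> R) (s r t : R).
Local Notation mu := (@lebesgue_measure R).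
Local Notation pos := (`]0, +oo[%classic : set R).

Lemma Linfty_norm_le f (M : R) : 0 <= M -> (forall t, `|f t| <= M) ->
  (Lp_norm (pow_measure (0 : R)) +oo%E f <= M%:E)%E.
Proof.
move=> M0 fM; rewrite /Lp_norm unlock /=; case: ifPn => [_|_]; last by rewrite lee_fin.
by apply/ess_supP; apply: nearW => t /=; rewrite lee_fin.
Qed.

(** One half of the change of density [pow_measure a = t `^ a dt], by comparing
    simple functions. *)
Lemma integral_pow_measure_le (a : R) (f : R -> \bar R) :
  measurable_fun setT f -> (forall t, 0 <= f t)%E ->
  (\int[pow_measure a]_t f t <= \int[mu]_(t in pos) (f t * (t `^ a)%:E))%E.
Proof.
move=> mf f0; rewrite ge0_integralTE//; apply: ge_ereal_sup => _ [h hf <-].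
have mp : measurable_fun pos (fun t : R => (t `^ a)%:E).
  by apply/measurable_EFinP; apply: measurable_funS (@measurable_powR R a).
have ind x : measurable_fun pos (fun t => (x * \1_(h @^-1` [set x]) t * t `^ a)%:E).
  apply/measurable_EFinP; apply: measurable_funM; last by apply/measurable_EFinP.
  by apply: measurable_funM => //; apply: measurable_funTS; apply: measurable_indic.
rewrite sintegralE.
have termE x : x \in range h -> (x%:E * pow_measure a (h @^-1` [set x]) =
    \int[mu]_(t in pos) (x * \1_(h @^-1` [set x]) t * t `^ a)%:E)%E.
  rewrite inE => -[t _ <-]; rewrite /pow_measure integral_mkcondl.
  rewrite -ge0_integralZl_EFin//=.
  - apply: eq_integral => u _; rewrite patchE; case: ifPn => uh.
      by rewrite indicE uh mulr1.
    by rewrite indicE (negbTE uh) mulr0 mul0r mule0.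
  - by move=> u _; rewrite patchE; case: ifPn => // _; rewrite lee_fin powR_ge0.
  - apply/measurable_restrict => //.
    + by rewrite -[X in measurable X]setTI; exact: (measurable_funP h).
    + by apply: measurable_funS mp => //; exact: subIsetl.
rewrite (eq_fsbigr _ _ termE) -ge0_integral_fsum//=; last first.
  move=> x t _; rewrite lee_fin mulr_ge0 ?powR_ge0//.
  have [xr|xr] := boolP (0 <= x); first by rewrite mulr_ge0.
  rewrite indicE; case: (boolP (t \in _)) => [|_]; last by rewrite mulr0.
  by rewrite inE/= => E; move: xr; rewrite -E fun_ge0.
have sumE t : (\sum_(x \in range h) (x * \1_(h @^-1` [set x]) t * t `^ a)%:E = (h t * t `^ a)%:E)%E.
  rewrite fsumEFin// -mulr_fsuml; congr (_ * _)%:E.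
  by rewrite [RHS]fimfunE.
under eq_integral do rewrite sumE.
apply: ge0_le_integral => //.
- by move=> t _; rewrite lee_fin mulr_ge0// powR_ge0.
- by apply/measurable_EFinP; apply: measurable_funM; [apply: (measurable_funTS (measurable_funP h))|apply/measurable_EFinP; exact: mp].
- by apply: emeasurable_funM => //; exact: measurable_funTS.
- by move=> t _; rewrite EFinM lee_wpmul2r// lee_fin powR_ge0.
Qed.

Lemma mem_Lfun (m : {measure set R -> \bar R}) (p : \bar R) f :
  measurable_fun setT f -> (Lp_norm m p f < +oo)%E -> f \in Lfun m p.
Proof. by move=> mf Nf; rewrite inE/=; apply/andP; split; rewrite inE. Qed.

Lemma measurable_restrict_pos f : measurable_fun pos f -> measurable_fun setT (f \_ pos).
Proof. by move=> mf; apply/measurable_restrict => //; rewrite setTI. Qed.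

Lemma L2_norm_le (a s r M : R) f : 0 < s -> 0 < r -> 0 <= M -> measurable_fun pos f ->
  (forall t, 0 < t -> `|f t| ^+ 2 * t `^ a <= M ^+ 2 * bump s r t) ->
  (Lp_norm (pow_measure a) 2%:E (f \_ pos) <= (M * Num.sqrt s^-1)%:E)%E.
Proof.
move=> s0 r0 M0 mf hf; have mF := measurable_restrict_pos mf.
have mb : measurable_fun pos (EFin \o bump s r).
  by apply/measurable_EFinP; apply: continuous_pos_measurable => t; exact: continuous_bump.
pose g t := (`|(f \_ pos) t| ^+ 2)%:E.
have mg : measurable_fun setT g.
  by apply/measurable_EFinP; apply: measurable_funX; exact: measurableT_comp.
rewrite /Lp_norm unlock /=.
have -> : (\int[pow_measure a]_x (`|((f \_ pos) x)%:E| `^ 2) = \int[pow_measure a]_x g x)%E.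
  by apply: eq_integral => t _; rewrite /g poweR_EFin powR_mulrn.
have h : (\int[pow_measure a]_x g x <= (M ^+ 2 * s^-1)%:E)%E.
  have hh := (@integral_pow_measure_le a g mg); apply: le_trans (hh _) _; first by move=> t; rewrite lee_fin sqr_ge0.
  apply: (@le_trans _ _ (\int[mu]_(t in pos) ((M ^+ 2)%:E * (bump s r t)%:E))%E).
    apply: ge0_le_integral => //.
    - by move=> t _; rewrite mule_ge0// lee_fin ?sqr_ge0 ?powR_ge0.
    - apply: emeasurable_funM; first exact: measurable_funTS.
      by apply/measurable_EFinP; apply: measurable_funS (@measurable_powR R a).
    - exact: emeasurable_funM.
    - move=> t tp; rewrite /g patchE mem_set// -EFinM -EFinM lee_fin; apply: hf.
      by move: tp; rewrite /= in_itv/= andbT.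
  rewrite ge0_integralZl_EFin//; last 2 first.
  - by move=> t; rewrite /= in_itv/= andbT => t0; rewrite lee_fin bump_ge0.
  - exact: sqr_ge0.
  by rewrite [leRHS]EFinM lee_wpmul2l ?lee_fin ?sqr_ge0// integral_bump_le.
have -> : M * Num.sqrt s^-1 = (M ^+ 2 * s^-1) `^ 2^-1.
  by rewrite powRM ?sqr_ge0 ?invr_ge0 ?(ltW s0)// !powR12_sqrt ?sqr_ge0 ?invr_ge0 ?(ltW s0)// sqrtr_sqr ger0_norm.
rewrite -poweR_EFin; apply: gt0_ler_poweR h => //.
- by rewrite in_itv/= leey andbT; apply: integral_ge0 => t _; rewrite lee_fin sqr_ge0.
- by rewrite in_itv/= leey andbT lee_fin mulr_ge0 ?sqr_ge0 ?invr_ge0 ?(ltW s0).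
Qed.

Lemma dominated_Rintegral dsp (T : measurableType dsp) (m : {measure set T -> \bar R})
  (D : set T) (A I : R) (f g : T -> R) : 0 <= A -> measurable D ->
  measurable_fun D f -> measurable_fun D g -> (forall z, D z -> 0 <= g z) ->
  {ae m, forall z, D z -> `|f z| <= A * g z} ->
  (\int[m]_(z in D) (g z)%:E <= I%:E)%E ->
  m.-integrable D (EFin \o f) /\ `|\int[m]_(z in D) f z| <= A * I.
Proof.
move=> A0 mD mf mg g0 fg gI; have meg : measurable_fun D (EFin \o g) by exact/measurable_EFinP.
have h : (\int[m]_(z in D) `|(f z)%:E| <= (A * I)%:E)%E.
  apply: (@le_trans _ _ (\int[m]_(z in D) (A%:E * (g z)%:E))%E).
    apply: ae_ge0_le_integral => //.
    - exact/measurable_EFinP/measurableT_comp.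
    - by move=> z zD; rewrite -EFinM lee_fin mulr_ge0// g0.
    - exact: emeasurable_funM.
  by rewrite ge0_integralZl_EFin// [leRHS]EFinM lee_wpmul2l ?lee_fin.
have fi : m.-integrable D (EFin \o f).
  apply/integrableP; split; first exact/measurable_EFinP.
  exact: le_lt_trans h (ltry _).
split=> //; apply: le_trans (le_normr_Rintegral _ fi) _ => //.
rewrite -lee_fin fineK//; apply/fin_numPlt/andP; split.
  by apply: lt_le_trans (integral_ge0 _ _) => // z _; rewrite lee_fin.
exact: le_lt_trans h (ltry _).
Qed.

Lemma bump_dominated (s r M : R) f : 0 < s -> 0 < r -> 0 <= M -> measurable_fun pos f ->
  {ae mu, forall t, pos t -> `|f t| <= M * bump s r t} ->
  mu.-integrable pos (EFin \o f) /\ `|\int[mu]_(t in pos) f t| <= M / s.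
Proof.
move=> s0 r0 M0 mf hf; apply: (@dominated_Rintegral _ _ mu pos M s^-1 f (bump s r) M0 _ mf _ _ hf (integral_bump_le s0 r0)) => //.
  by apply: continuous_pos_measurable => t; exact: continuous_bump.
by move=> t; rewrite /= in_itv/= andbT; exact: bump_ge0.
Qed.

End NormsInTime.

(** * Complex values *)
Section Complex.
Context {R : realType}.
Implicit Types (a b : R) (z : R[i]) (psi : R -> R[i]).
Local Notation mu := (@lebesgue_measure R).
Local Notation pos := (`]0, +oo[%classic : set R).
Local Open Scope complex_scope.

Lemma cnorm_le a b : (cnorm (a +i* b) <= (`|a| + `|b|)%:E)%E.
Proof.
rewrite lee_fin /=; have a0 := normr_ge0 a; have b0 := normr_ge0 b.
rewrite -(ler_pXn2r (n := 2))// ?nnegrE ?sqrtr_ge0 ?addr_ge0//.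
rewrite sqr_sqrtr ?addr_ge0 ?sqr_ge0// -(real_normK (num_real a)) -(real_normK (num_real b)).
by nra.
Qed.

Lemma cnorm_real a : cnorm (a%:C) = `|a|%:E.
Proof. by rewrite /cnorm /= expr0n addr0 sqrtr_sqr. Qed.

Lemma Re_mul_real z a : complex.Re (z * a%:C) = complex.Re z * a.
Proof. by case: z => p q /=; rewrite mulr0 subr0. Qed.

Lemma Im_mul_real z a : complex.Im (z * a%:C) = complex.Im z * a.
Proof. by case: z => p q /=; rewrite mulr0 add0r. Qed.

Lemma cnorm_oppB_le a b a' b' (p q : R) : `|a - a'| <= p -> `|b - b'| <= q ->
  (cnorm (- (a +i* b) - - (a' +i* b'))%R <= (p + q)%:E)%E.
Proof.
move=> hp hq; have -> : - (a +i* b) - - (a' +i* b') = (- (a - a')) +i* (- (b - b')).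
  by apply/eqP; rewrite eq_complex /= !opprD !eqxx.
by apply: le_trans (cnorm_le _ _) _; rewrite lee_fin !normrN lerD.
Qed.

(** The norm refers to the measure [t `^ 0 dt], whose null sets are those of the
    Lebesgue measure on the half-line. *)
Lemma cLinfty_bounded psi : cLinfty psi -> exists2 M : R, 0 <= M &
  {ae mu, forall t, pos t -> `|complex.Re (psi t)| <= M /\ `|complex.Im (psi t)| <= M}.
Proof.
move=> [_ _]; rewrite unlock /=; case: ifPn => [_|]; last first.
  rewrite -leNgt /pow_measure setTI.
  under eq_integral do rewrite powRr0.
  by rewrite integral_cst//= lebesgue_measure_itv/= ltry mul1e leye_eq.
set s := ess_sup _ _ => sy.
have [M M0 sM] : exists2 M : R, 0 <= M & (s <= M%:E)%E.
  move: (s) sy => [a| |]// _; last by exists 0; rewrite ?leNye.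
  by exists `|a|; rewrite ?lee_fin ?ler_norm.
exists M => //; move/ess_supP: sM => -[N [mN N0 hN]].
exists (N `&` pos); split.
- exact: measurableI.
- have : (\int[mu]_(t in N `&` pos) (1 : R)%:E = 0)%E.
    rewrite -N0 /pow_measure; apply: eq_integral => t _; by rewrite powRr0.
  by rewrite integral_cst//= ?mul1e//; exact: measurableI.
- move=> t /= /not_implyP[tp hM]; split => //; apply: hN => /=; apply: contra_not hM.
  rewrite lee_fin; case: (psi t) => p q /=; rewrite ger0_norm ?sqrtr_ge0// => h.
  have hs (a c : R) : `|a| <= Num.sqrt (a ^+ 2 + c ^+ 2).
    by rewrite -sqrtr_sqr ler_wsqrtr// lerDl sqr_ge0.
  split; first exact: le_trans (hs _ _) h.
  by apply: le_trans h; rewrite addrC; exact: hs.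
Qed.

End Complex.

(** * Maximal, Riesz, square function and Laplace transform type kernels *)
Section FourKernels.
Context {R : realType} {d : nat} (alpha : 'I_d -> R) (b : R -> nat -> R -> R).
Hypothesis d_gt0 : (0 < d)%N.
Hypothesis alpha_gt : forall i, -1 < alpha i.
Hypothesis b_bounded : forall (nu : R) l, -1 < nu ->
  exists2 C, 0 < C & forall z, 0 <= z -> `|b nu l z| <= C.
Hypothesis der_b : forall (nu : R) l (z : R), -1 < nu -> 0 <= z -> is_derive z 1 (b nu l)
  ((1 + z)^-1 * ((l%:R + nu + 2^-1) * b nu l z + b nu l.+1 z)).
Hypothesis besselI_b : forall nu z : R, -1 < nu -> 0 < z -> besselI nu z =
  2 `^ (- nu) * z `^ nu * expR z * (1 + z) `^ (- (nu + 2^-1)) * b nu 0 z.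
Implicit Types (t r A : R) (x y : 'rV[R]_d) (n : 'I_d -> nat) (f g : R -> R).
Local Notation mu := (@lebesgue_measure R).
Local Notation pos := (`]0, +oo[%classic : set R).
Local Notation kern := (kern alpha b).
Local Notation majorant := (majorant alpha 256^-1).
Local Notation heat_symbol := (heat_symbol alpha).

Let k0 : 0 < 256^-1 :> R. Proof. by rewrite invr_gt0 ltr0n. Qed.
Let s0 : 0 < gain alpha / 2. Proof. by rewrite divr_gt0 ?gain_gt0. Qed.

Lemma posP t : pos t -> 0 < t.
Proof. by rewrite /= in_itv/= andbT. Qed.

Lemma measurable_kern e x y : orthant x -> orthant y -> measurable_fun pos (fun t => kern e t x y).
Proof.
move=> x0 y0; apply: continuous_pos_measurable => t t0.
exact: is_derive_continuous (is_derive_kern_t alpha_gt der_b e t0 x0 y0).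
Qed.

Lemma measurable_family (F : R -> 'rV[R]_d -> 'rV[R]_d -> R) e x y :
  (forall t x y, 0 < t -> orthant x -> orthant y -> F t x y = kern e t x y) ->
  orthant x -> orthant y -> measurable_fun pos (fun t => F t x y).
Proof.
move=> FE x0 y0; apply: eq_measurable_fun (measurable_kern e x0 y0) => t.
by rewrite inE => /posP t0; rewrite FE.
Qed.

Lemma kern_majorant e w x y : (order e <= w)%N -> orthant x -> orthant y -> x != y ->
  exists2 A, 0 <= A & forall t, 0 < t -> `|kern e t x y| <= A * majorant w t (enorm (x - y)).
Proof.
move=> ew x0 y0 xy; have [C C0 hC] := kern_growth alpha_gt b_bounded e.
have r0 := enorm_gt0 xy; have v0 := vol_gt0 alpha x0 r0.
exists (C / vol alpha x (enorm (x - y))); first by rewrite divr_ge0 ?ltW.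
move=> t t0; apply: le_trans (hC t x y t0 x0 y0 xy) _.
rewrite -[leRHS]mulrA ler_pM2l// mulrC ler_pM2l ?invr_gt0//.
by apply: majorantW => //; rewrite lef_pV2 ?posrE ?ltr0n// ler_nat.
Qed.

Lemma restrict_posB f g : f \_ pos - g \_ pos = (fun t => f t - g t) \_ pos.
Proof.
apply/funext => t; rewrite !fctE !patchE.
by case: ifPn => // _; rewrite subr0.
Qed.

Lemma maximal_estimates :
  off_diagonal (fun x y => maximal_kernel alpha x y \in Lfun (pow_measure (0 : R)) +oo%E) /\
  standard_estimates alpha (Lp_norm (pow_measure (0 : R)) +oo%E) (maximal_kernel alpha).
Proof.
have hk t x y : 0 < t -> orthant x -> orthant y -> heat_kernel alpha t x y = kern heat_symbol t x y.
  by move=> t0 x0 y0; exact: heat_kernel_kern.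
have [C C0 hC] := majorant_decay d_gt0 alpha_gt k0.
have bnd f A r : 0 <= A -> 0 < r -> (forall t, 0 < t -> `|f t| <= A * majorant 0 t r) ->
    (Lp_norm (pow_measure (0 : R)) +oo%E (f \_ pos) <= (C * A)%:E)%E.
  move=> A0 r0 hf; apply: Linfty_norm_le => [|t]; first by rewrite mulr_ge0 ?(ltW C0).
  rewrite patchE; case: ifPn => [|_]; last by rewrite normr0 mulr_ge0 ?(ltW C0).
  rewrite inE => /posP t0; apply: le_trans (hf t t0) _; rewrite mulrC ler_wpM2r//.
  apply: le_trans (hC t r t0 r0) _; rewrite ler_piMr ?(ltW C0)//.
  exact: decay_le1.
split.
- move=> x y x0 y0 xy; apply: mem_Lfun.
    by apply: measurable_restrict_pos; exact: measurable_family hk x0 y0.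
  have [|A A0 hA] := @kern_majorant heat_symbol 0 x y _ x0 y0 xy; first by rewrite order_heat_symbol.
  apply: le_lt_trans (ltry _); apply: bnd A0 (enorm_gt0 xy) _ => t t0.
  by rewrite hk//; exact: hA.
- apply: (standard_estimates_kern alpha_gt b_bounded der_b (e := heat_symbol) (w := 0) (B := C)) => //.
  + by rewrite order_heat_symbol.
  + by move=> x y A r x0 y0 A0 r0 h; apply: bnd A0 r0 _ => t t0; rewrite hk//; exact: h.
  + move=> x y x' y' A r x0 y0 _ x'0 y'0 _ A0 r0 h; rewrite restrict_posB.
    by apply: bnd A0 r0 _ => t t0; rewrite !hk//; exact: h.
Qed.

Lemma square_estimates n m :
  let nrm := pow_measure ((\sum_i n i + m.*2)%:R - 1 : R) in
  off_diagonal (fun x y => square_kernel alpha n m x y \in Lfun nrm 2%:E) /\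
  standard_estimates alpha (Lp_norm nrm 2%:E) (square_kernel alpha n m).
Proof.
move=> nrm; set w := (\sum_i n i + m.*2)%N in nrm *; pose e := dt_delta_symbol alpha n m.
have ew : (order e <= w)%N by exact: order_dt_delta_symbol.
have hk t x y : 0 < t -> orthant x -> orthant y -> dt_delta_heat alpha n m t x y = kern e t x y.
  by move=> t0 x0 y0; exact: dt_delta_heat_kern.
have [C C0 hC] := majorant_bump_sqr d_gt0 alpha_gt w k0.
pose B := C * Num.sqrt (gain alpha / 2)^-1.
have B0 : 0 < B by rewrite mulr_gt0// sqrtr_gt0 invr_gt0.
have bnd f A r : 0 <= A -> 0 < r -> measurable_fun pos f ->
    (forall t, 0 < t -> `|f t| <= A * majorant w t r) ->
    (Lp_norm nrm 2%:E (f \_ pos) <= (B * A)%:E)%E.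
  move=> A0 r0 mf hf; have -> : B * A = A * C * Num.sqrt (gain alpha / 2)^-1 by rewrite /B; ring.
  apply: (@L2_norm_le _ _ _ (r ^+ 2)) => //; first exact: exprn_gt0.
    by rewrite mulr_ge0 ?(ltW C0).
  move=> t t0; have h : `|f t| ^+ 2 <= (A * majorant w t r) ^+ 2.
    rewrite ler_sqr ?nnegrE//; first exact: hf.
    by rewrite mulr_ge0// majorant_ge0.
  apply: le_trans (ler_wpM2r (powR_ge0 _ _) h) _.
  rewrite [X in X * _ <= _]exprMn [X in _ <= X * _]exprMn -[leLHS]mulrA -[leRHS]mulrA ler_wpM2l ?sqr_ge0//.
  exact: hC.
split.
- move=> x y x0 y0 xy; have mF := measurable_family hk x0 y0; apply: mem_Lfun.
    exact: measurable_restrict_pos.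
  have [A A0 hA] := kern_majorant ew x0 y0 xy.
  apply: le_lt_trans (ltry _); apply: bnd A0 (enorm_gt0 xy) mF _ => t t0.
  by rewrite /= hk//; exact: hA.
- apply: (standard_estimates_kern alpha_gt b_bounded der_b (e := e) (w := w) (B := B)) => //.
  + move=> x y A r x0 y0 A0 r0 h; apply: bnd A0 r0 (measurable_family hk x0 y0) _ => t t0.
    by rewrite /= hk//; exact: h.
  + move=> x y x' y' A r x0 y0 _ x'0 y'0 _ A0 r0 h; rewrite restrict_posB.
    have mF := measurable_funB (measurable_family hk x0 y0) (measurable_family hk x'0 y'0).
    by apply: bnd A0 r0 mF _ => t t0; rewrite /= !hk//; exact: h.
Qed.

(** Integration in time against a multiplier of size [t `^ (w / 2 - 1)], which
    compensates exactly the order [w].  The multiplier is [t `^ (w / 2 - 1)] itself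
    for the Riesz kernels; for [psi] it is bounded, and [w = 2]. *)
Lemma multiplier_bound (w : nat) (h : R -> R) (M : R) : measurable_fun pos h -> 0 <= M ->
  {ae mu, forall t, pos t -> `|h t| <= M * t `^ (w%:R / 2 - 1)} ->
  exists2 B, 0 < B & forall g A r, 0 <= A -> 0 < r -> measurable_fun pos g ->
    (forall t, 0 < t -> `|g t| <= A * majorant w t r) ->
    mu.-integrable pos (EFin \o (fun t => h t * g t)) /\
    `|\int[mu]_(t in pos) (h t * g t)| <= B * A.
Proof.
move=> mh M0 hM; have [C C0 hC] := majorant_bump d_gt0 alpha_gt w k0.
have q0 : 0 <= M * C / (gain alpha / 2) by rewrite !mulr_ge0 ?invr_ge0 ?(ltW C0) ?(ltW s0).
exists (M * C / (gain alpha / 2) + 1); first exact: ltr_wpDl.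
move=> g A r A0 r0 mg hg.
have hb : {ae mu, forall t, pos t -> `|h t * g t| <= M * C * A * bump (gain alpha / 2) (r ^+ 2) t}.
  move: hM; apply: filterS; [exact: (ae_filter_ringOfSetsType mu)|move=> t h1 tp].
  have t0 := posP tp; rewrite normrM.
  apply: le_trans (ler_pM (normr_ge0 _) (normr_ge0 _) (h1 tp) (hg t t0)) _.
  have := hC t r t0 r0; rewrite powRB ?(gt_eqF t0) ?implybT// powRr1 ?(ltW t0)//.
  move: (t `^ _) (majorant _ _ _) (bump _ _ _) => p q u hu.
  have -> : M * (p / t) * (A * q) = M * A / t * (p * q) by ring.
  have -> : M * C * A * u = M * A / t * (C * (t * u)) by field; rewrite gt_eqF.
  by apply: ler_wpM2l => //; rewrite !mulr_ge0 ?invr_ge0 ?(ltW t0).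
have [] := @bump_dominated R _ _ (M * C * A) (fun t => h t * g t) s0 (exprn_gt0 2 r0) _ _ hb.
- by rewrite !mulr_ge0 ?(ltW C0).
- exact: measurable_funM.
move=> h1 h2; split=> //; apply: le_trans h2 _.
rewrite mulrDl mul1r; apply: le_trans (_ : M * C / (gain alpha / 2) * A <= _).
  by rewrite [leRHS]mulrAC.
by rewrite lerDl.
Qed.

Lemma riesz_estimates n : (0 < \sum_i n i)%N ->
  off_diagonal (fun x y =>
    mu.-integrable `]0, +oo[ (EFin \o riesz_integrand alpha n x y)) /\
  standard_estimates alpha cnorm (riesz_kernel alpha n).
Proof.
move=> n0; set w := (\sum_i n i)%N in n0 *; pose e := deltanS alpha n heat_symbol.
have ew : (order e <= w)%N.
  by apply: leq_trans (order_deltanS _ _ _) _; rewrite order_heat_symbol.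
have hk t x y : 0 < t -> orthant x -> orthant y -> delta_heat alpha n t x y = kern e t x y.
  by move=> t0 x0 y0; exact: delta_heat_kern.
pose h t : R := t `^ (w%:R / 2 - 1).
have mh : measurable_fun pos h.
  by apply: measurable_funS (@measurable_powR R _).
have [|B B0 hB] := @multiplier_bound w h 1 mh ler01.
  by apply: aeW => t _; rewrite mul1r ger0_norm ?powR_ge0.
have rE x y : riesz_integrand alpha n x y = (fun t => h t * delta_heat alpha n t x y).
  by apply/funext => t; rewrite /riesz_integrand mulrC.
pose G : R := Gamma (w%:R / 2).
have G0 : 0 < G by rewrite Gamma_gt0// divr_gt0 ?ltr0n.
have int x y : orthant x -> orthant y -> x != y ->
    mu.-integrable `]0, +oo[ (EFin \o riesz_integrand alpha n x y).
  move=> x0 y0 xy; rewrite rE; have [A A0 hA] := kern_majorant ew x0 y0 xy.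
  have [|//] := hB _ A _ A0 (enorm_gt0 xy) (measurable_family hk x0 y0).
  by move=> t t0; rewrite hk//; exact: hA.
split=> //.
apply: (standard_estimates_kern alpha_gt b_bounded der_b (e := e) (w := w) (B := G^-1 * B)) => //.
- by rewrite mulr_gt0 ?invr_gt0.
- move=> x y A r x0 y0 A0 r0 hA; rewrite /riesz_kernel -/w -/G rE cnorm_real lee_fin.
  rewrite normrM ger0_norm ?invr_ge0 ?(ltW G0)// -mulrA ler_pM2l ?invr_gt0//.
  have [|//] := hB _ A r A0 r0 (measurable_family hk x0 y0).
  by move=> t t0; rewrite hk//; exact: hA.
- move=> x y x' y' A r x0 y0 xy x'0 y'0 xy' A0 r0 hA.
  rewrite /riesz_kernel -/w -/G -raddfB/= cnorm_real lee_fin -mulrBr.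
  rewrite normrM ger0_norm ?invr_ge0 ?(ltW G0)// -mulrA ler_pM2l ?invr_gt0//.
  rewrite -RintegralB//; [|exact: int|exact: int].
  have mF := measurable_funB (measurable_family hk x0 y0) (measurable_family hk x'0 y'0).
  have [|_] := hB _ A r A0 r0 mF.
    by move=> t t0; rewrite /= !hk//; exact: hA.
  by apply: le_trans; rewrite !rE; under eq_Rintegral do rewrite -mulrBr.
Qed.

Lemma laplace_estimates (psi : R -> R[i]) : cLinfty psi ->
  off_diagonal (fun x y => cintegrable `]0, +oo[ (laplace_integrand alpha psi x y)) /\
  standard_estimates alpha cnorm (laplace_kernel alpha psi).
Proof.
move=> psiL; have [mR mI _] := psiL; have [M M0 hM] := cLinfty_bounded psiL.
pose e := iter 1 (D alpha DT) heat_symbol.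
have ew : (order e <= 2)%N by have := order_iter_DT alpha 1 heat_symbol; rewrite order_heat_symbol.
have hk t x y : 0 < t -> orthant x -> orthant y -> dt_heat alpha t x y = kern e t x y.
  by move=> t0 x0 y0; exact: dt_heat_kern.
have p1 t : t `^ (2%:R / 2 - 1) = 1 :> R by rewrite divff ?subrr ?powRr0.
have [|B1 B10 hB1] := @multiplier_bound 2 _ M mR M0.
  move: hM; apply: filterS; [exact: (ae_filter_ringOfSetsType mu)|move=> t h1 tp].
  by rewrite p1 mulr1; have [] := h1 tp.
have [|B2 B20 hB2] := @multiplier_bound 2 _ M mI M0.
  move: hM; apply: filterS; [exact: (ae_filter_ringOfSetsType mu)|move=> t h1 tp].
  by rewrite p1 mulr1; have [] := h1 tp.
have ReE x y : (fun t => complex.Re (laplace_integrand alpha psi x y t)) =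
    (fun t => complex.Re (psi t) * dt_heat alpha t x y).
  by apply/funext => t; exact: Re_mul_real.
have ImE x y : (fun t => complex.Im (laplace_integrand alpha psi x y t)) =
    (fun t => complex.Im (psi t) * dt_heat alpha t x y).
  by apply/funext => t; exact: Im_mul_real.
have int x y : orthant x -> orthant y -> x != y ->
    cintegrable `]0, +oo[ (laplace_integrand alpha psi x y).
  move=> x0 y0 xy; have [A A0 hA] := kern_majorant ew x0 y0 xy.
  have hA' t : 0 < t -> `|dt_heat alpha t x y| <= A * majorant 2 t (enorm (x - y)).
    by move=> t0; rewrite hk//; exact: hA.
  have mF := measurable_family hk x0 y0; have r0 := enorm_gt0 xy.
  split; rewrite ?ReE ?ImE; first by have [] := hB1 _ A _ A0 r0 mF hA'.
  by have [] := hB2 _ A _ A0 r0 mF hA'.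
split=> //.
apply: (standard_estimates_kern alpha_gt b_bounded der_b (e := e) (w := 2) (B := B1 + B2)) => //.
- exact: addr_gt0.
- move=> x y A r x0 y0 A0 r0 hA; rewrite /laplace_kernel /cintegral /=.
  apply: le_trans (cnorm_le _ _) _; rewrite lee_fin !normrN mulrDl.
  have hA' t : 0 < t -> `|dt_heat alpha t x y| <= A * majorant 2 t r.
    by move=> t0; rewrite hk//; exact: hA.
  have mF := measurable_family hk x0 y0.
  rewrite ReE ImE; apply: lerD; first by have [] := hB1 _ A _ A0 r0 mF hA'.
  by have [] := hB2 _ A _ A0 r0 mF hA'.
- move=> x y x' y' A r x0 y0 xy x'0 y'0 xy' A0 r0 hA.
  have mF := measurable_funB (measurable_family hk x0 y0) (measurable_family hk x'0 y'0).
  have hA' t : 0 < t -> `|dt_heat alpha t x y - dt_heat alpha t x' y'| <= A * majorant 2 t r.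
    by move=> t0; rewrite !hk//; exact: hA.
  have [i1 i2] := int x y x0 y0 xy; have [i1' i2'] := int x' y' x'0 y'0 xy'.
  have [_ h1] := hB1 _ A r A0 r0 mF hA'; have [_ h2] := hB2 _ A r A0 r0 mF hA'.
  have -> : (B1 + B2) * A = B1 * A + B2 * A by exact: mulrDl.
  apply: cnorm_oppB_le.
    rewrite -RintegralB; [|by []|exact: i1|exact: i1'].
    rewrite (@eq_Rintegral _ _ _ mu _ (fun t => complex.Re (psi t) * (dt_heat alpha t x y - dt_heat alpha t x' y'))).
      exact: h1.
    move=> t _; rewrite mulrBr; congr (_ - _); exact: Re_mul_real.
  rewrite -RintegralB; [|by []|exact: i2|exact: i2'].
  rewrite (@eq_Rintegral _ _ _ mu _ (fun t => complex.Im (psi t) * (dt_heat alpha t x y - dt_heat alpha t x' y'))).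
    exact: h2.
  move=> t _; rewrite mulrBr; congr (_ - _); exact: Im_mul_real.
Qed.

End FourKernels.

(** * Measures defined as suprema over finite families *)
Section SupMeasure.
Context {R : realType}.
Implicit Types (A B : set R) (phi nu : set R -> \bar R) (k p q : nat).
Local Open Scope ereal_scope.

(** The total variation and the Jordan parts are of this form, for [phi] the
    modulus and the positive parts of [nu] and [- nu]. *)
Definition sup_measure phi A : \bar R :=
  ereal_sup [set s | exists p (F : 'I_p -> set R),
    [/\ forall i, rel_compact_borel A (F i), trivIset setT F
      & s = \sum_(i < p) phi (F i)]].

Lemma rel_compact_borelS A B F : A `<=` B -> rel_compact_borel A F -> rel_compact_borel B F.
Proof. by move=> AB [mF FA kF]; split=> //; exact: subset_trans FA AB. Qed.

Lemma rel_compact_borelI A B F : measurable B -> rel_compact_borel A F ->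
  rel_compact_borel (A `&` B) (F `&` B).
Proof.
move=> mB [mF FA [k Fk]]; split; first exact: measurableI.
  by apply: setSI.
by exists k; apply: subset_trans Fk; exact: subIsetl.
Qed.

Lemma sup_measure_le phi A B : A `<=` B -> sup_measure phi A <= sup_measure phi B.
Proof.
move=> AB; apply: le_ereal_sup => s [p [F [hF tF sE]]]; exists p, F; split=> // i.
exact: rel_compact_borelS AB (hF i).
Qed.

Lemma le_sup_measure phi A p (F : 'I_p -> set R) :
  (forall i, rel_compact_borel A (F i)) -> trivIset setT F ->
  \sum_(i < p) phi (F i) <= sup_measure phi A.
Proof. by move=> hF tF; apply: ereal_sup_ubound; exists p, F. Qed.

Lemma le_sup_measure1 phi A F : rel_compact_borel A F -> phi F <= sup_measure phi A.
Proof.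
move=> hF; have := @le_sup_measure phi A 1 (fun=> F); rewrite big_ord1; apply=> //.
by move=> i j _ _ _; rewrite !ord1.
Qed.

Variable phi : set R -> \bar R.
Hypothesis phi_ge0 : forall A, 0 <= phi A.
Hypothesis phi0 : phi set0 = 0.
Hypothesis phi_subadditive : forall (E : nat -> set R) k, (forall n, measurable (E n)) ->
  trivIset setT E -> \bigcup_n E n `<=` compact_itv k ->
  phi (\bigcup_n E n) <= \sum_(n <oo) phi (E n).

Lemma sup_measure_ge0 A : 0 <= sup_measure phi A.
Proof.
have := @le_sup_measure phi A 0 (fun=> set0); rewrite big_ord0; apply; first by case.
by case.
Qed.

Lemma sup_measure0 : sup_measure phi set0 = 0.
Proof.
apply/eqP; rewrite eq_le sup_measure_ge0 andbT; apply: ge_ereal_sup => s [p [F [hF _ ->]]].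
rewrite big1// => i _; have [_ + _] := hF i; rewrite subset0 => ->; exact: phi0.
Qed.

(** The union of a family in [A] and a family in [B] is a family in their union. *)
Lemma sup_measure_superadditive A B : A `&` B = set0 ->
  sup_measure phi A + sup_measure phi B <= sup_measure phi (A `|` B).
Proof.
move=> AB.
have key p (F : 'I_p -> set R) q (G : 'I_q -> set R) :
    (forall i, rel_compact_borel A (F i)) -> trivIset setT F ->
    (forall i, rel_compact_borel B (G i)) -> trivIset setT G ->
    \sum_(i < p) phi (F i) + \sum_(i < q) phi (G i) <= sup_measure phi (A `|` B).
  move=> hF tF hG tG.
  pose H (i : 'I_(p + q)) := match fintype.split i with inl j => F j | inr j => G j end.
  have Hl j : H (lshift q j) = F j by rewrite /H (unsplitK (inl j)).
  have Hr j : H (rshift p j) = G j by rewrite /H (unsplitK (inr j)).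
  have := @le_sup_measure phi (A `|` B) _ H; rewrite big_split_ord/=.
  under eq_bigr do rewrite Hl.
  under [X in _ + X]eq_bigr do rewrite Hr.
  have disj i j z : F i z -> G j z -> False.
    have [_ FA _] := hF i; have [_ GB _] := hG j => Fz Gz.
    by have : (A `&` B) z by [split; [exact: FA|exact: GB]]; rewrite AB.
  apply.
  - move=> i; case: (split_ordP i) => j ->; rewrite ?Hl ?Hr.
      by apply: rel_compact_borelS (hF j); exact: subsetUl.
    by apply: rel_compact_borelS (hG j); exact: subsetUr.
  - move=> i j _ _; case: (split_ordP i) => i' ->; case: (split_ordP j) => j' ->;
      rewrite ?Hl ?Hr => -[z [h1 h2]].
    + by congr lshift; apply: tF => //; exists z.
    + by case: (disj _ _ _ h1 h2).
    + by case: (disj _ _ _ h2 h1).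
    + by congr rshift; apply: tG => //; exists z.
have := sup_measure_ge0 (A `|` B); case E : (sup_measure phi (A `|` B)) => [c| |]// _; last by rewrite leey.
have fin a : 0 <= a -> a <= c%:E -> a \is a fin_num.
  move=> a0 ac; rewrite ge0_fin_numE//; exact: le_lt_trans ac (ltry _).
have fB : sup_measure phi B \is a fin_num.
  by apply: fin (sup_measure_ge0 _) _; rewrite -E; apply: sup_measure_le; exact: subsetUr.
rewrite -leeBrDr//; apply: ge_ereal_sup => s [p [F [hF tF sE]]].
have s0 : 0 <= s by rewrite sE; apply: sume_ge0 => i _; exact: phi_ge0.
have fs : s \is a fin_num.
  apply: fin s0 _; rewrite sE -E; apply: le_sup_measure => // i.
  by apply: rel_compact_borelS (hF i); exact: subsetUl.
rewrite leeBrDr// addeC -leeBrDr//; apply: ge_ereal_sup => u [q [G [hG tG ->]]].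
by rewrite leeBrDr// addeC sE -E; exact: key.
Qed.

(** A family in the union of the [A n] is cut along the [A n], where countable
    subadditivity of [phi] applies; the other inequality is superadditivity. *)
Lemma sup_measure_sigma_additive : semi_sigma_additive (sup_measure phi).
Proof.
move=> A mA tA mUA.
have cv : cvgn (fun n => \sum_(0 <= i < n) sup_measure phi (A i)).
  by apply: is_cvg_nneseries => n _ _; exact: sup_measure_ge0.
apply: cvg_toP => //; apply/eqP; rewrite eq_le; apply/andP; split.
- apply: lime_le => //; apply: nearW => n.
  apply: (@le_trans _ _ (sup_measure phi (\big[setU/set0]_(i < n) A i))); last first.
    by apply: sup_measure_le; rewrite -bigcup_mkord => z [i _ Az]; exists i.
  elim: n => [|n IH]; first by rewrite big_geq// sup_measure_ge0.
  rewrite big_nat_recr//= big_ord_recr/=; apply: le_trans (leeD2r _ IH) _.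
  apply: sup_measure_superadditive; rewrite -bigcup_mkord; apply/seteqP; split => // z [[i /= ni Ai] An].
  have E : i = n by apply: tA => //; exists z.
  by move: ni; rewrite E ltnn.
- apply: ge_ereal_sup => s [p [F [hF tF ->]]].
  apply: (@le_trans _ _ (\sum_(i < p) \sum_(n <oo) phi (F i `&` A n))).
    apply: lee_sum => i _; have [mF FA [k Fk]] := hF i.
    have FE : F i = \bigcup_n (F i `&` A n) by rewrite -setI_bigcupr; apply/esym/setIidl.
    rewrite {1}FE; apply: (@phi_subadditive _ k).
    + by move=> n; exact: measurableI.
    + exact: trivIset_setIl.
    + by rewrite -FE.
  rewrite -nneseries_sum; last by move=> *; exact: phi_ge0.
  apply: lee_nneseries => [n _ _|n _]; first by apply: sume_ge0 => i _; exact: phi_ge0.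
  apply: (@le_sup_measure phi (A n) p (fun i => F i `&` A n)).
    move=> i; apply: rel_compact_borelS (rel_compact_borelI (mA n) (hF i)); exact: subIsetr.
  exact: trivIset_setIr.
Qed.

End SupMeasure.

(** * Comparison of integrals against different set functions *)
Section RawIntegral.
Context {R : realType}.
Implicit Types (A B K : set R) (m : set R -> \bar R) (f : R -> \bar R).
Local Open Scope ereal_scope.

(** A Chebyshev inequality for a set function not known to be additive: the simple
    function [c] on [K] competes in the supremum that defines the integral. *)
Lemma integral_ge_set_function m (D K : set R) (c : R) f :
  (forall A, 0 <= m A) -> m set0 = 0 -> measurable K -> (0 < c)%R ->
  (forall t, D t -> 0 <= f t) -> K `<=` D -> (forall t, K t -> c%:E <= f t) ->
  c%:E * m K <= \int[m]_(t in D) f t.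
Proof.
move=> m_ge0 m0 mK c0 f0 KD cf; rewrite /integral /=; set g := f \_ D.
have g0 t : 0 <= g t by rewrite /g patchE; case: ifPn => // /set_mem; exact: f0.
have -> : g^\+ = g by apply/funext => t; rewrite (@ge0_funeposE _ _ setT)// ?inE.
have -> : g^\- = cst 0 by apply/funext => t; rewrite (@ge0_funenegE _ _ setT)// ?inE.
rewrite [X in _ - X](_ : _ = 0); last first.
  have sint0 (h : R -> R) : (forall t, h t = 0%R) -> sintegral m h = 0.
    move=> h0; apply: fsbig1 => x _; have [->|x0] := eqVneq x 0%R; first by rewrite mul0e.
    rewrite (_ : h @^-1` [set x] = set0) ?m0 ?mule0//.
    by apply/seteqP; split => // t /=; rewrite h0 => /esym/eqP; rewrite (negbTE x0).
  apply/eqP; rewrite eq_le; apply/andP; split.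
    apply: ge_ereal_sup => _ [h hh <-]; rewrite sint0// => t.
    by apply/eqP; rewrite eq_le fun_ge0 andbT -lee_fin; exact: hh.
  by apply: ereal_sup_ubound; exists nnsfun0 => //; exact: sint0.
rewrite sube0; have [h hE] : exists h : {nnsfun R >-> R}, forall t, h t = (c * \1_K t)%R.
  by exists (scale_nnsfun (indic_nnsfun R mK) (ltW c0)).
apply: (@le_trans _ _ (sintegral m h)); last first.
  apply: ereal_sup_ubound; exists h => // t; rewrite hE indicE.
  case: (boolP (t \in K)) => [/set_mem tK|_]; last by rewrite mulr0; exact: g0.
  by rewrite mulr1 /g patchE mem_set; [exact: cf|exact: KD].
have -> : sintegral m h = \sum_(x \in range h) x%:E * m (h @^-1` [set x]).
  by rewrite [RHS](fsbig_widen (range h) setT)//= => x [_ Nhx]; rewrite /= (preimage10 Nhx) m0 mule0.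
have pos x : range h x -> 0 <= x%:E * m (h @^-1` [set x]).
  by move=> [t _ <-]; rewrite mule_ge0// lee_fin fun_ge0.
have [K0|/set0P[t0 Kt0]] := eqVneq K set0; first by rewrite [in leLHS]K0 m0 mule0; exact: fsume_ge0.
have hc : range h c by exists t0 => //; rewrite hE indicE mem_set// mulr1.
have hK : h @^-1` [set c] = K.
  apply/seteqP; split => t /=; rewrite hE indicE; last by move=> Kt; rewrite mem_set// mulr1.
  case: (boolP (t \in K)) => [/set_mem//|_]; rewrite mulr0 => /eqP.
  by rewrite lt_eqF.
rewrite (fsbigD1 c)//= hK leeDl//; apply: fsume_ge0 => x [hx _]; exact: pos.
Qed.

Lemma ge0_le_integral_measure (m1 m2 : {measure set R -> \bar R}) (D : set R) f :
  (forall A, measurable A -> m1 A <= m2 A) -> (forall t, D t -> 0 <= f t) ->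
  \int[m1]_(t in D) f t <= \int[m2]_(t in D) f t.
Proof.
move=> m12 f0; rewrite !ge0_integralE//; apply: ge_ereal_sup => _ [h hh <-].
apply: (@le_trans _ _ (sintegral m2 h)); last by apply: ereal_sup_ubound; exists h.
rewrite !sintegralE; apply: lee_fsum => // x [t _ <-].
by rewrite lee_wpmul2l ?lee_fin ?fun_ge0// m12.
Qed.

(** The set function [m] itself, under a name that carries its structure of
    measure: integrals against both are convertible. *)
Definition measure_of m (zero : m set0 = 0) (ge0 : forall A, 0 <= m A)
  (add : semi_sigma_additive m) := m.
HB.instance Definition _ m zero ge0 add :=
  isMeasure.Build _ _ _ (@measure_of m zero ge0 add) zero ge0 add.

End RawIntegral.

(** * Signed measures that are finite on compact sets *)
Section LocallyFinite.
Context {R : realType}.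
Implicit Types (A B : set R) (nu : set R -> \bar R) (k p q : nat).

(** Signed Radon measures on the half-line. *)
Definition locally_finite nu := [/\ nu set0 = 0%E,
  forall B k, measurable B -> B `<=` compact_itv k -> nu B \is a fin_num
  & forall (E : nat -> set R) k, (forall n, measurable (E n)) -> trivIset setT E ->
    \bigcup_n E n `<=` compact_itv k ->
    (\sum_(0 <= i < n) fine (nu (E i)) @[n --> \oo] --> fine (nu (\bigcup_n E n)))].

Lemma locally_finiteN nu : locally_finite nu -> locally_finite (fun B => (- nu B)%E).
Proof.
move=> [n0 nf ns]; split; first by rewrite n0 oppe0.
  by move=> B k mB Bk; rewrite fin_numN; exact: nf mB Bk.
move=> E k mE tE Ek; rewrite fineN.
have -> : (fun n => \sum_(0 <= i < n) fine (- nu (E i))%E) = \- (fun n => \sum_(0 <= i < n) fine (nu (E i))).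
  by apply/funext => n /=; rewrite -sumrN; apply: eq_bigr => i _; rewrite fineN.
exact: cvgN (ns E k mE tE Ek).
Qed.

Lemma locally_signed_finite nu : locally_signed_measure nu ->
  (forall B k, measurable B -> B `<=` compact_itv k -> nu B \is a fin_num) -> locally_finite nu.
Proof.
move=> sn nf; split=> //; first by have [+ _ _] := sn 0%N; rewrite set0I.
move=> E k mE tE Ek; have [_ _ add] := sn k.
have EK n : E n `&` compact_itv k = E n.
  by apply/setIidl; apply: subset_trans Ek => z Ez; exists n.
have mU : measurable (\bigcup_n E n) by exact: bigcup_measurable.
have := add E mE tE mU; rewrite (setIidl Ek).
under eq_fun do under eq_bigr do rewrite EK.
have -> : (fun n => \sum_(0 <= i < n) fine (nu (E i))) = fine \o (fun n => (\sum_(0 <= i < n) nu (E i))%E).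
  apply/funext => n /=; rewrite sum_fine// => i _.
  by apply: (nf _ k) => //; rewrite -EK; exact: subIsetr.
have E1 : nu (\bigcup_n E n) = (fine (nu (\bigcup_n E n)))%:E by rewrite fineK//; exact: nf mU Ek.
by move=> cv; apply: fine_cvg; rewrite -E1.
Qed.

Lemma le_nneseries_cvg (u : nat -> R) (l : R) (v : nat -> \bar R) :
  (forall n, (0 <= v n)%E) -> \sum_(0 <= i < n) u i @[n --> \oo] --> l ->
  (forall n, ((u n)%:E <= v n)%E) -> (l%:E <= \sum_(n <oo) v n)%E.
Proof.
move=> v0 cv uv; have h : (fun n => (\sum_(0 <= i < n) u i)%:E) @ \oo --> l%:E.
  by apply: cvg_EFin => //; exact: nearW.
apply: (cvge_le _ h); apply: nearW => n; apply: le_trans (nneseries_lim_ge n _) => //.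
by rewrite -sumEFin; apply: lee_sum.
Qed.

Lemma locally_finite_sum nu k p (F : 'I_p -> set R) : locally_finite nu ->
  (forall i, measurable (F i)) -> (forall i, F i `<=` compact_itv k) -> trivIset setT F ->
  nu (\bigcup_i F i) = (\sum_(i < p) nu (F i))%E.
Proof.
move=> [n0 nf ns] mF Fk tF.
pose E n := if insub n is Some i then F i else set0.
have EF (i : 'I_p) : E i = F i by rewrite /E valK.
have E0 n : (p <= n)%N -> E n = set0 by move=> pn; rewrite /E insubF// ltnNge pn.
have mE n : measurable (E n) by rewrite /E; case: insubP.
have EU : \bigcup_n E n = \bigcup_i F i.
  apply/seteqP; split => z; last by move=> [i _ Fz]; exists i => //; rewrite EF.
  by move=> [n _]; rewrite /E; case: insubP => // i _ _ Fz; exists i.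
have tE : trivIset setT E.
  move=> i j _ _; rewrite /E; case: insubP => [i' _ <-|_]; last by move=> [z []].
  case: insubP => [j' _ <-|_]; last by move=> [z []].
  by move=> h; congr (val _); exact: tF.
have Ek : \bigcup_n E n `<=` compact_itv k by rewrite EU => z [i _ /Fk].
have mU : measurable (\bigcup_n E n) by exact: bigcup_measurable.
have := ns E k mE tE Ek; rewrite EU => cv.
have cst : \sum_(0 <= i < n) fine (nu (E i)) @[n --> \oo] --> \sum_(i < p) fine (nu (F i)).
  apply: cvg_near_cst; exists p => // n /= pn.
  rewrite (big_cat_nat _ pn)//= [X in _ + X]big_nat_cond [X in _ + X]big1 ?addr0.
    by rewrite big_mkord; apply: eq_bigr => i _; rewrite EF.
  by move=> i /andP[/andP[pi _] _]; rewrite E0// n0.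
have e := cvg_unique _ cv cst; rewrite -[LHS]fineK; last by rewrite -EU; exact: nf mU Ek.
rewrite e// -sumEFin; apply: eq_bigr => i _; rewrite fineK//; exact: nf (mF i) (Fk i).
Qed.

(** In a disjoint family the members on which [nu] is negative can be discarded,
    and the union of the others is a single competitor. *)
Lemma positive_part_sup nu A : locally_finite nu ->
  positive_part nu A = sup_measure (fun B => maxe (nu B) 0%E) A.
Proof.
move=> lf; have [n0 nf ns] := lf; apply/eqP; rewrite eq_le; apply/andP; split.
  apply: ge_ereal_sup => _ [B hB <-].
  apply: (@le_trans _ _ (maxe (nu B) 0%E)); first by rewrite le_max lexx.
  exact: (@le_sup_measure1 _ (fun B => maxe (nu B) 0%E) A B hB).
apply: ge_ereal_sup => _ [p [F [hF tF ->]]].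
pose G i := if (0 <= nu (F i))%E then F i else set0.
have GF i : G i `<=` F i by move=> z; rewrite /G; case: ifP.
have -> : (\sum_(i < p) maxe (nu (F i)) 0 = \sum_(i < p) nu (G i))%E.
  apply: eq_bigr => i _; rewrite /G; case: ifPn => h; first exact: max_l.
  by rewrite n0 max_r// ltW// ltNge.
have [k Fk] : exists k, forall i, F i `<=` compact_itv k.
  have /choice[c hc] : forall i, exists k, F i `<=` compact_itv k by move=> i; have [_ _] := hF i.
  exists (\max_i c i) => i; apply: subset_trans (hc i) _.
  by apply/subsetPset/compact_itv_nd; exact: leq_bigmax.
have mG i : measurable (G i) by rewrite /G; case: ifP => // _; have [] := hF i.
have Gk i : G i `<=` compact_itv k by exact: subset_trans (GF i) (Fk i).
have tG : trivIset setT G.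
  by move=> i j _ _ [z [/GF h1 /GF h2]]; apply: tF => //; exists z.
rewrite -(locally_finite_sum lf mG Gk tG); apply: ereal_sup_ubound; exists (\bigcup_i G i) => //.
split.
- by apply: fin_bigcup_measurable => // i _; exact: mG.
- by move=> z [i _ /GF]; have [_ + _] := hF i; apply.
- by exists k => z [i _ /Gk].
Qed.

Lemma positive_part_measure nu : locally_finite nu ->
  [/\ positive_part nu set0 = 0%E, forall A, (0 <= positive_part nu A)%E
    & semi_sigma_additive (positive_part nu)].
Proof.
move=> lf; have [n0 nf ns] := lf; pose phi B := maxe (nu B) 0%E.
have p0 A : (0 <= phi A)%E by rewrite /phi le_max lexx orbT.
have pz : phi set0 = 0%E by rewrite /phi n0 maxxx.
have -> : positive_part nu = sup_measure phi by apply/funext => A; exact: positive_part_sup.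
split; [exact: sup_measure0|exact: sup_measure_ge0|].
apply: sup_measure_sigma_additive => // E k mE tE Ek.
rewrite {1}/phi ge_max nneseries_ge0// andbT.
have mU : measurable (\bigcup_n E n) by exact: bigcup_measurable.
rewrite -[X in (X <= _)%E]fineK; last exact: nf mU Ek.
apply: (le_nneseries_cvg _ (ns E k mE tE Ek)) => // n.
rewrite fineK; first by rewrite /phi le_max lexx.
by apply: (nf _ k) => //; apply: subset_trans Ek => z Ez; exists n.
Qed.

End LocallyFinite.

(** * The total variation of a complex measure *)
Section Variation.
Context {R : realType}.
Implicit Types (A B : set R) (nu : set R -> \bar R) (k : nat).
Local Notation pos := (`]0, +oo[%classic : set R).

Definition modulus nu1 nu2 B : \bar R := sqrte (nu1 B * nu1 B + nu2 B * nu2 B)%E.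

Lemma variation_measureE nu1 nu2 : variation_measure nu1 nu2 = sup_measure (modulus nu1 nu2).
Proof. by []. Qed.

Lemma modulus_ge0 nu1 nu2 B : (0 <= modulus nu1 nu2 B)%E.
Proof. exact: sqrte_ge0. Qed.

Lemma modulus0 nu1 nu2 : nu1 set0 = 0%E -> nu2 set0 = 0%E -> modulus nu1 nu2 set0 = 0%E.
Proof. by move=> h1 h2; rewrite /modulus h1 h2 mule0 adde0 /= sqrtr0. Qed.

Lemma modulus_fin nu1 nu2 B : nu1 B \is a fin_num -> nu2 B \is a fin_num ->
  modulus nu1 nu2 B = (Num.sqrt (fine (nu1 B) ^+ 2 + fine (nu2 B) ^+ 2))%:E.
Proof.
by move=> /fineK h1 /fineK h2; rewrite /modulus -h1 -h2 -!EFinM -EFinD /=.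
Qed.

Lemma modulus_lty nu1 nu2 B : (modulus nu1 nu2 B < +oo)%E ->
  nu1 B \is a fin_num /\ nu2 B \is a fin_num.
Proof.
by rewrite /modulus; case: (nu1 B) => [a| |]; case: (nu2 B) => [c| |].
Qed.

(** Cauchy-Schwarz, by Lagrange's identity. *)
Lemma mul_le_modulus (a b x y : R) : a ^+ 2 + b ^+ 2 <= 1 ->
  a * x + b * y <= Num.sqrt (x ^+ 2 + y ^+ 2).
Proof.
move=> ab; apply: le_trans (ler_norm _) _; rewrite -sqrtr_sqr ler_wsqrtr//.
have -> : (a * x + b * y) ^+ 2 = (a ^+ 2 + b ^+ 2) * (x ^+ 2 + y ^+ 2) - (a * y - b * x) ^+ 2 by ring.
have s0 : 0 <= x ^+ 2 + y ^+ 2 by rewrite addr_ge0 ?sqr_ge0.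
by rewrite lerBlDr; apply: ler_wpDr; [exact: sqr_ge0|exact: ler_piMl].
Qed.

(** The modulus of the total is attained along a fixed direction, in which the
    total is a limit of sums bounded by the moduli of the terms. *)
Lemma modulus_subadditive nu1 nu2 (E : nat -> set R) k : locally_finite nu1 -> locally_finite nu2 ->
  (forall n, measurable (E n)) -> trivIset setT E -> \bigcup_n E n `<=` compact_itv k ->
  (modulus nu1 nu2 (\bigcup_n E n) <= \sum_(n <oo) modulus nu1 nu2 (E n))%E.
Proof.
move=> [_ f1 s1] [_ f2 s2] mE tE Ek.
have mU : measurable (\bigcup_n E n) by exact: bigcup_measurable.
have fin nu n : (forall B k, measurable B -> B `<=` compact_itv k -> nu B \is a fin_num) -> nu (E n) \is a fin_num.
  by move=> h; apply: (h _ k) => //; apply: subset_trans Ek => z Ez; exists n.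
rewrite modulus_fin; [|exact: f1 mU Ek|exact: f2 mU Ek].
set x := fine (nu1 _); set y := fine (nu2 _); set r := Num.sqrt _.
have [r0|r0] := eqVneq r 0.
  by rewrite r0; apply: nneseries_ge0 => *; exact: modulus_ge0.
have rr : r ^+ 2 = x ^+ 2 + y ^+ 2 by rewrite sqr_sqrtr// addr_ge0 ?sqr_ge0.
pose u n := x / r * fine (nu1 (E n)) + y / r * fine (nu2 (E n)).
apply: (@le_nneseries_cvg _ u) => [n||n]; first exact: modulus_ge0.
  have -> : r = x / r * x + y / r * y.
    by rewrite ![_ / r * _]mulrAC -!expr2 -mulrDl -rr expr2 mulfK.
  have -> : (fun n => \sum_(0 <= i < n) u i) = (fun n =>
      x / r * (\sum_(0 <= i < n) fine (nu1 (E i))) + y / r * (\sum_(0 <= i < n) fine (nu2 (E i)))).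
    by apply/funext => n; rewrite !mulr_sumr -big_split.
  apply: cvgD; apply: cvgM; [exact: cvg_cst|exact: s1 mE tE Ek|exact: cvg_cst|exact: s2 mE tE Ek].
rewrite modulus_fin; [|exact: fin f1|exact: fin f2].
rewrite lee_fin; apply: mul_le_modulus.
by rewrite !expr_div_n -mulrDl -rr divff// expf_neq0.
Qed.

Lemma variation_measure_measure nu1 nu2 : locally_finite nu1 -> locally_finite nu2 ->
  [/\ variation_measure nu1 nu2 set0 = 0%E, forall A, (0 <= variation_measure nu1 nu2 A)%E
    & semi_sigma_additive (variation_measure nu1 nu2)].
Proof.
move=> lf1 lf2; rewrite variation_measureE.
have m0 : modulus nu1 nu2 set0 = 0%E by apply: modulus0; [have [] := lf1|have [] := lf2].
split; [exact: sup_measure0|move=> A; exact: sup_measure_ge0|].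
apply: sup_measure_sigma_additive => //; first exact: modulus_ge0.
by move=> E k; exact: modulus_subadditive.
Qed.

(** The Jordan parts of the real and imaginary parts correspond to the directions
    [(a, b)] equal to [(1, 0)], [(-1, 0)], [(0, 1)] and [(0, -1)]. *)
Lemma positive_part_le_variation nu1 nu2 (a b : R) nu A : locally_finite nu1 -> locally_finite nu2 ->
  a ^+ 2 + b ^+ 2 <= 1 ->
  (forall B, nu1 B \is a fin_num -> nu2 B \is a fin_num ->
    nu B = (a * fine (nu1 B) + b * fine (nu2 B))%:E) ->
  (positive_part nu A <= variation_measure nu1 nu2 A)%E.
Proof.
move=> [_ f1 _] [_ f2 _] ab nuE; apply: ge_ereal_sup => _ [B hB <-].
have [mB _ [k Bk]] := hB; have g1 := f1 B k mB Bk; have g2 := f2 B k mB Bk.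
apply: (@le_trans _ _ (modulus nu1 nu2 B)); last exact: (@le_sup_measure1 _ (modulus nu1 nu2) A B hB).
by rewrite nuE// modulus_fin// lee_fin; exact: mul_le_modulus.
Qed.

(** The exponential is bounded below on compact intervals, so that the variation
    is finite there; infinite values of [nu1] or [nu2] would make it infinite. *)
Lemma locally_complex_finite nu1 nu2 (c : R) : 0 <= c -> locally_complex_measure nu1 nu2 ->
  (\int[variation_measure nu1 nu2]_(t in pos) (expR (- t * c))%:E < +oo)%E ->
  locally_finite nu1 /\ locally_finite nu2.
Proof.
move=> c0 [l1 l2] fin.
have z1 : nu1 set0 = 0%E by have [+ _ _] := l1 0%N; rewrite set0I.
have z2 : nu2 set0 = 0%E by have [+ _ _] := l2 0%N; rewrite set0I.
have m0 := modulus0 z1 z2.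
have Vk k : (variation_measure nu1 nu2 (compact_itv k) < +oo)%E.
  pose e := expR (- (k.+1%:R * c)).
  have := @integral_ge_set_function R (variation_measure nu1 nu2) pos (compact_itv k) e (fun t => (expR (- t * c))%:E).
  have e0 : 0 < e by exact: expR_gt0.
  move=> /(_ (sup_measure_ge0 (modulus nu1 nu2)) (sup_measure0 m0) (measurable_itv _) e0) h.
  have {}h : (e%:E * variation_measure nu1 nu2 (compact_itv k) < +oo)%E.
    apply: le_lt_trans (h _ _ _) fin.
    - by move=> t _; rewrite lee_fin expR_ge0.
    - by move=> t /compact_itv_pos t0; rewrite /= in_itv/= t0.
    - move=> t; rewrite /compact_itv/= in_itv/= => /andP[_ tk].
      by rewrite lee_fin ler_expR mulNr lerN2 ler_wpM2r.
  move: h; case: (variation_measure _ _ _) => [v| |]//; first by move=> _; exact: ltry.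
  by rewrite gt0_muley ?lte_fin.
have fin12 B k : measurable B -> B `<=` compact_itv k -> nu1 B \is a fin_num /\ nu2 B \is a fin_num.
  move=> mB Bk; apply: modulus_lty; apply: le_lt_trans (Vk k).
  by apply: (@le_sup_measure1 _ (modulus nu1 nu2)); split=> //; exists k.
by split; apply: locally_signed_finite => // B k mB Bk; have [] := fin12 B k mB Bk.
Qed.

End Variation.

(** * Laplace-Stieltjes transform type kernels *)
Section Stieltjes.
Context {R : realType} {d : nat} (alpha : 'I_d -> R) (b : R -> nat -> R -> R).
Hypothesis d_gt0 : (0 < d)%N.
Hypothesis alpha_gt : forall i, -1 < alpha i.
Hypothesis b_bounded : forall (nu : R) l, -1 < nu ->
  exists2 C, 0 < C & forall z, 0 <= z -> `|b nu l z| <= C.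
Hypothesis der_b : forall (nu : R) l (z : R), -1 < nu -> 0 <= z -> is_derive z 1 (b nu l)
  ((1 + z)^-1 * ((l%:R + nu + 2^-1) * b nu l z + b nu l.+1 z)).
Hypothesis besselI_b : forall nu z : R, -1 < nu -> 0 < z -> besselI nu z =
  2 `^ (- nu) * z `^ nu * expR z * (1 + z) `^ (- (nu + 2^-1)) * b nu 0 z.
Implicit Types (t r A I : R) (x y : 'rV[R]_d) (f g : R -> R).
Local Notation pos := (`]0, +oo[%classic : set R).
Local Notation kern := (kern alpha b).
Local Notation decay := (decay alpha).
Local Notation majorant := (majorant alpha 256^-1).
Local Notation heat_symbol := (heat_symbol alpha).

Lemma decay_dominated (m : {measure set R -> \bar R}) I A f : 0 <= A -> measurable_fun pos f ->
  (forall t, 0 < t -> `|f t| <= A * decay t) ->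
  (\int[m]_(t in pos) (decay t)%:E <= I%:E)%E ->
  m.-integrable pos (EFin \o f) /\ `|\int[m]_(t in pos) f t| <= A * I.
Proof.
move=> A0 mf hf; apply: (dominated_Rintegral (g := decay)) => //.
- apply: (@measurableT_comp _ _ _ _ _ _ expR) => //.
  by apply: measurable_funM => //; exact: measurableT_comp.
- by move=> t _; exact: expR_ge0.
- by apply: aeW => t /posP; exact: hf.
Qed.

(** Both Jordan parts are measures below [V], and [signed_integral] is the
    difference of two integrals that are linear on functions dominated by
    [decay]. *)
Lemma signed_integral_estimates nu (V : {measure set R -> \bar R}) I : locally_finite nu ->
  (forall B, positive_part nu B <= V B)%E -> (forall B, negative_part nu B <= V B)%E ->
  (\int[V]_(t in pos) (decay t)%:E <= I%:E)%E ->
  (forall f A, 0 <= A -> measurable_fun pos f -> (forall t, 0 < t -> `|f t| <= A * decay t) ->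
    `|signed_integral nu f| <= 2 * I * A) /\
  (forall f g A A', 0 <= A -> 0 <= A' -> measurable_fun pos f -> measurable_fun pos g ->
    (forall t, 0 < t -> `|f t| <= A * decay t) -> (forall t, 0 < t -> `|g t| <= A' * decay t) ->
    signed_integral nu f - signed_integral nu g = signed_integral nu (fun t => f t - g t)).
Proof.
move=> lf PV NV hI.
have [z1 g1 a1] := positive_part_measure lf; pose P : {measure set R -> \bar R} := measure_of z1 g1 a1.
have [z2 g2 a2] := positive_part_measure (locally_finiteN lf).
pose N : {measure set R -> \bar R} := measure_of z2 g2 a2.
have sE f : signed_integral nu f = \int[P]_(t in pos) f t - \int[N]_(t in pos) f t by [].
have d0 t : pos t -> (0 <= (decay t)%:E)%E by move=> _; rewrite lee_fin expR_ge0.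
have IP : (\int[P]_(t in pos) (decay t)%:E <= I%:E)%E.
  by apply: le_trans hI; apply: ge0_le_integral_measure => // B _; exact: PV.
have IN : (\int[N]_(t in pos) (decay t)%:E <= I%:E)%E.
  by apply: le_trans hI; apply: ge0_le_integral_measure => // B _; exact: NV.
split=> [f A A0 mf hf|f g A A' A0 A'0 mf mg hf hg].
  have [_ h1] := decay_dominated A0 mf hf IP; have [_ h2] := decay_dominated A0 mf hf IN.
  rewrite sE; apply: le_trans (ler_normB _ _) _.
  have -> : 2 * I * A = A * I + A * I by ring.
  exact: lerD.
have [i1 _] := decay_dominated A0 mf hf IP; have [i2 _] := decay_dominated A0 mf hf IN.
have [j1 _] := decay_dominated A'0 mg hg IP; have [j2 _] := decay_dominated A'0 mg hg IN.
rewrite !sE RintegralB//; rewrite RintegralB//.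
by rewrite opprD addrACA -opprD.
Qed.

Lemma stieltjes_estimates nu1 nu2 : locally_complex_measure nu1 nu2 ->
  (\int[variation_measure nu1 nu2]_(t in pos) (decay t)%:E < +oo)%E ->
  off_diagonal (fun x y => (variation_measure nu1 nu2).-integrable pos
    (EFin \o (fun t => heat_kernel alpha t x y))) /\
  standard_estimates alpha cnorm (stieltjes_kernel alpha nu1 nu2).
Proof.
move=> loc fin; have [lf1 lf2] := locally_complex_finite (ltW (decay_rate_gt0 d_gt0 alpha_gt)) loc fin.
have [z g a] := variation_measure_measure lf1 lf2.
pose V : {measure set R -> \bar R} := measure_of z g a.
pose I := fine (\int[V]_(t in pos) (decay t)%:E)%E.
have I0' : (0 <= \int[V]_(t in pos) (decay t)%:E)%E.
  by apply: integral_ge0 => t _; rewrite lee_fin expR_ge0.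
have I0 : 0 <= I by exact: fine_ge0.
have hI : (\int[V]_(t in pos) (decay t)%:E <= I%:E)%E by rewrite fineK// ge0_fin_numE.
have part (s : R) (i : bool) nu B : `|s| <= 1 ->
    (forall B, nu1 B \is a fin_num -> nu2 B \is a fin_num ->
      nu B = (s * fine (if i then nu1 B else nu2 B))%:E) -> (positive_part nu B <= V B)%E.
  move=> s1 nuE; have ss : s ^+ 2 <= 1 by rewrite -real_normK ?num_real// expr_le1.
  case: i nuE => nuE.
    apply: (positive_part_le_variation (a := s) (b := 0) B lf1 lf2).
      by rewrite expr0n addr0.
    by move=> C h1 h2; rewrite nuE// mul0r addr0.
  apply: (positive_part_le_variation (a := 0) (b := s) B lf1 lf2).
    by rewrite expr0n add0r.
  by move=> C h1 h2; rewrite nuE// mul0r add0r.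
have n1 : `|1 : R| <= 1 by rewrite normr1.
have nN1 : `|-1 : R| <= 1 by rewrite normrN1.
have [b1 l1] := @signed_integral_estimates nu1 V I lf1
  (fun B => part 1 true nu1 B n1 (fun C h1 h2 => ltac:(by rewrite mul1r fineK)))
  (fun B => part (-1) true _ B nN1 (fun C h1 h2 => ltac:(by rewrite mulN1r EFinN fineK))) hI.
have [b2 l2] := @signed_integral_estimates nu2 V I lf2
  (fun B => part 1 false nu2 B n1 (fun C h1 h2 => ltac:(by rewrite mul1r fineK)))
  (fun B => part (-1) false _ B nN1 (fun C h1 h2 => ltac:(by rewrite mulN1r EFinN fineK))) hI.
have hk t x y : 0 < t -> orthant x -> orthant y -> heat_kernel alpha t x y = kern heat_symbol t x y.
  by move=> t0 x0 y0; exact: heat_kernel_kern.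
have k0 : 0 < 256^-1 :> R by rewrite invr_gt0 ltr0n.
have [C C0 hC] := majorant_decay d_gt0 alpha_gt k0.
have dom f A r : 0 <= A -> 0 < r -> (forall t, 0 < t -> `|f t| <= A * majorant 0 t r) ->
    forall t, 0 < t -> `|f t| <= A * C * decay t.
  move=> A0 r0 hf t t0; apply: le_trans (hf t t0) _; rewrite -[leRHS]mulrA ler_wpM2l//.
  exact: hC.
have off x y : orthant x -> orthant y -> x != y -> exists2 A, 0 <= A &
    forall t, 0 < t -> `|heat_kernel alpha t x y| <= A * decay t.
  move=> x0 y0 xy.
  have [|A A0 hA] := @kern_majorant _ _ alpha b alpha_gt b_bounded heat_symbol 0 x y _ x0 y0 xy.
    by rewrite order_heat_symbol.
  exists (A * C); first by rewrite mulr_ge0// ltW.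
  by apply: dom A0 (enorm_gt0 xy) _ => t t0; rewrite hk//; exact: hA.
have mF x y (x0 : orthant x) (y0 : orthant y) := measurable_family alpha_gt der_b hk x0 y0.
split.
- move=> x y x0 y0 xy; have [A A0 hA] := off x y x0 y0 xy.
  by have [] := @decay_dominated V I A _ A0 (mF x y x0 y0) hA hI.
(* The four Jordan parts contribute at most [A * C * I] each. *)
- pose B := 4 * I * C + 1; have B0 : 0 < B by rewrite ltr_wpDl// !mulr_ge0// ltW.
  have le4 A p q : 0 <= A -> p <= 2 * I * (A * C) -> q <= 2 * I * (A * C) -> p + q <= B * A.
    by move=> A0 h1 h2; rewrite /B; nra.
  have AC A : 0 <= A -> 0 <= A * C by move=> A0; rewrite mulr_ge0// ltW.
  apply: (standard_estimates_kern alpha_gt b_bounded der_b (e := heat_symbol) (w := 0) (B := B)) => //.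
  + by rewrite order_heat_symbol.
  + move=> x y A r x0 y0 A0 r0 h.
    have hf : forall t, 0 < t -> `|heat_kernel alpha t x y| <= A * C * decay t.
      by apply: dom A0 r0 _ => t t0; rewrite hk//; exact: h.
    apply: le_trans (cnorm_le _ _) _; rewrite lee_fin; apply: le4 => //.
      exact: b1 (AC A A0) (mF x y x0 y0) hf.
    exact: b2 (AC A A0) (mF x y x0 y0) hf.
  + move=> x y x' y' A r x0 y0 xy x'0 y'0 xy' A0 r0 h.
    have [A1 A10 h1] := off x y x0 y0 xy; have [A2 A20 h2] := off x' y' x'0 y'0 xy'.
    have mx := mF x y x0 y0; have mx' := mF x' y' x'0 y'0.
    have mD := measurable_funB mx mx'.
    have hf : forall t, 0 < t -> `|heat_kernel alpha t x y - heat_kernel alpha t x' y'| <= A * C * decay t.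
      by apply: dom A0 r0 _ => t t0; rewrite !hk//; exact: h.
    have e1 := l1 _ _ A1 A2 A10 A20 mx mx' h1 h2.
    have e2 := l2 _ _ A1 A2 A10 A20 mx mx' h1 h2.
    apply: (@le_trans _ _ (`|signed_integral nu1 (fun t => heat_kernel alpha t x y) -
        signed_integral nu1 (fun t => heat_kernel alpha t x' y')| +
        `|signed_integral nu2 (fun t => heat_kernel alpha t x y) -
        signed_integral nu2 (fun t => heat_kernel alpha t x' y')|)%:E).
      exact: cnorm_le.
    rewrite e1 e2 lee_fin; apply: le4 => //.
      exact: b1 (AC A A0) mD hf.
    exact: b2 (AC A A0) mD hf.
Qed.

End Stieltjes.

Theorem theorem3p1 (R : realType) (d : nat) (alpha : 'I_d -> R) :
  (0 < d)%N -> (forall i, -1 < alpha i) ->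
  [/\ off_diagonal (fun x y =>
        maximal_kernel alpha x y \in Lfun (pow_measure (0 : R)) +oo%E) /\
      standard_estimates alpha (Lp_norm (pow_measure (0 : R)) +oo%E)
        (maximal_kernel alpha),

      forall n : 'I_d -> nat, (0 < \sum_i n i)%N ->
      off_diagonal (fun x y =>
        lebesgue_measure.-integrable `]0, +oo[
          (EFin \o riesz_integrand alpha n x y)) /\
      standard_estimates alpha cnorm (riesz_kernel alpha n),

      forall (n : 'I_d -> nat) (m : nat), (0 < \sum_i n i + m)%N ->
      let mu := pow_measure ((\sum_i n i + m.*2)%:R - 1 : R) in
      off_diagonal (fun x y => square_kernel alpha n m x y \in Lfun mu 2%:E) /\
      standard_estimates alpha (Lp_norm mu 2%:E) (square_kernel alpha n m),

      forall psi : R -> R[i], cLinfty psi ->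
      off_diagonal (fun x y =>
        cintegrable `]0, +oo[ (laplace_integrand alpha psi x y)) /\
      standard_estimates alpha cnorm (laplace_kernel alpha psi)

    & forall nu1 nu2 : set R -> \bar R, locally_complex_measure nu1 nu2 ->
      (\int[variation_measure nu1 nu2]_(t in `]0%R, +oo[)
         (expR (- t * (2 * d%:R + 2 * \sum_i alpha i)))%:E < +oo)%E ->
      off_diagonal (fun x y =>
        (variation_measure nu1 nu2).-integrable `]0, +oo[
          (EFin \o (fun t => heat_kernel alpha t x y))) /\
      standard_estimates alpha cnorm (stieltjes_kernel alpha nu1 nu2)].
Proof.
move=> d0 alpha_gt; have [b [b_bounded der_b besselI_b]] := @bessel_symbol R.
split.
- exact: maximal_estimates d0 alpha_gt b_bounded der_b besselI_b.
- exact: riesz_estimates d0 alpha_gt b_bounded der_b besselI_b.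
- by move=> n m _; exact: square_estimates d0 alpha_gt b_bounded der_b besselI_b n m.
- exact: laplace_estimates d0 alpha_gt b_bounded der_b besselI_b.
- exact: stieltjes_estimates d0 alpha_gt b_bounded der_b besselI_b.
Qed.
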